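(* Suppose that $\lambda_n\to\lambda\in[0,1]$, $\gamma_n\to\gamma\in[0,1]$, $\frac{\log(1/\lambda_n)}{\alpha_n\lambda_n\log n}\to\eta\in[0,\infty]$, $\lambda_n^{1-\gamma_n}\to\xi\in[0,1]$, and $\rho_n\to\rho\in[0,1]$. Then in probability \[S_n\to\begin{cases}\gamma&\text{if }\lambda=1\text{ or }\eta=\infty,\\[2pt] \rho\cdot\dfrac{(1-(2-\xi)\lambda)\xi+\eta\gamma}{1-\lambda+\eta}&\text{otherwise.}\end{cases}\]
   Context: Let $(\alpha_n)$ be a sequence in $(0,\infty)$ with $0<\liminf\alpha_n\le\limsup\alpha_n<\infty$, $q_n=\alpha_n\log n/n$, $(\rho_n)$ a sequence in $(0,1)$. Let $G^{(1)}_n\sim\mathcal G(n,q_n)$ on $\{1,\dots,n\}$ and obtain $G^{(2)}_n$ by independently, for each unordered vertex pair, with probability $1-\rho_n$ resampling its adjacency as a fresh Bernoulli$(q_n)$. Let $d_n^*=\min\{d\in\mathbb Z:(nq_n)^d\ge n/(\log\log n)^2\}$, $\lambda_n\in(0,1)$ with $\log(1/\lambda_n)=(nq_n)^{d_n^*}/n$, $\gamma_n=\rho_n^{d_n^*}$. For a graph $G$, the shortest path DAG $\mathsf{SPD}_G$ is the union of all shortest paths starting at vertex $1$, each edge oriented away from $1$ along these paths. Define $S_n=\frac{|\mathsf{SPD}_{G^{(1)}_n}\cap\mathsf{SPD}_{G^{(2)}_n}|}{\sqrt{|\mathsf{SPD}_{G^{(1)}_n}|\,|\mathsf{SPD}_{G^{(2)}_n}|}}$,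 where $|\cdot|$ counts edges and the intersection counts edges present in both with the same orientation. *)

(* Defs.v *)
From mathcomp Require Import all_boot all_order all_algebra.
From mathcomp Require Import all_classical all_reals all_analysis.
Set Implicit Arguments.
Unset Strict Implicit.
Unset Printing Implicit Defensive.
Import Order.TTheory GRing.Theory Num.Theory.
Import numFieldNormedType.Exports.
Local Open Scope ring_scope.

(* The vertices 1, ..., n are the elements of 'I_n: vertex 1 is
   the ordinal of value 0. *)

Definition vpair (n : nat) := {e : {set 'I_n} | #|e| == 2%N}.

Definition graph (n : nat) := {set vpair n}.

Definition adj (n : nat) (G : graph n) : rel 'I_n :=
  fun u v => [exists e in G, val e == [set u; v]].

(* x :: p is a path of G of minimal length among those with the same ends. *)
Definition shortest_path (n : nat) (G : graph n) (x : 'I_n) (p : seq 'I_n) :=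
  path (adj G) x p /\
  forall p', path (adj G) x p' -> last x p' = last x p ->
    (size p <= size p')%N.

(* (u, v) is the edge {u, v} oriented from u to v; infix means contiguous. *)
Definition SPD (n : nat) (G : graph n) : {set 'I_n * 'I_n} :=
  [set uv : 'I_n * 'I_n |
    `[< exists (x : 'I_n) (p : seq 'I_n),
          [/\ x = 0%N :> nat, shortest_path G x p
            & infix [:: uv.1; uv.2] (x :: p)] >]].

(* Zero when one of the two DAGs has no edge, by x / 0 = 0. *)
Definition similarity (R : realType) (n : nat) (G1 G2 : graph n) : R :=
  #|SPD G1 :&: SPD G2|%:R / Num.sqrt (#|SPD G1|%:R * #|SPD G2|%:R).

(* For each vertex pair, an outcome records (a, r, b): the adjacency a in the
   first graph, whether the pair is resampled, and the fresh adjacency b. *)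
Definition outcome (n : nat) := {ffun vpair n -> bool * bool * bool}.

Definition G1 (n : nat) (w : outcome n) : graph n := [set e | (w e).1.1].

Definition G2 (n : nat) (w : outcome n) : graph n :=
  [set e | if (w e).1.2 then (w e).2 else (w e).1.1].

(* Product law: all the coordinates are independent, with a and b of law
   Bernoulli(q) and r of law Bernoulli(1 - rho). *)
Definition weight (R : realType) (n : nat) (q rho : R) (w : outcome n) : R :=
  \prod_(e : vpair n) (bernoulli_pmf q (w e).1.1 *
                       bernoulli_pmf (1 - rho) (w e).1.2 *
                       bernoulli_pmf q (w e).2).

Definition Pr (R : realType) (n : nat) (q rho : R) (E : pred (outcome n)) : R :=
  \sum_(w | E w) weight q rho w.

Definition cvg_in_probability (R : realType) (q rho : nat -> R)
    (X : forall n, outcome n -> R) (l : R) :=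
  forall eps : R, 0 < eps ->
    (Pr (q n) (rho n) (fun w : outcome n => eps < `|X n w - l|)
      @[n --> \oo] --> (0 : R))%classic.

(* The sequences below have their intended meaning for n large: q_n <= 1,
   n q_n > 1 and log log n > 0 hold eventually under the hypotheses on alpha. *)

Definition q_ (R : realType) (alpha : nat -> R) (n : nat) : R :=
  alpha n * ln n%:R / n%:R.

Definition is_least (A : set int) (d : int) :=
  A d /\ forall d', A d' -> d <= d'.

Definition dstar_set (R : realType) (alpha : nat -> R) (n : nat) : set int :=
  [set d : int | n%:R / (ln (ln n%:R)) ^+ 2 <= (n%:R * q_ alpha n) ^ d]%classic.

Definition dstar (R : realType) (alpha : nat -> R) (n : nat) : int :=
  xget 0 (is_least (dstar_set alpha n)).

(* The solution of log (1 / lambda) = (n q)^dstar / n; see lambdaP. *)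
Definition lambda_ (R : realType) (alpha : nat -> R) (n : nat) : R :=
  expR (- ((n%:R * q_ alpha n) ^ dstar alpha n / n%:R)).

Definition gamma_ (R : realType) (alpha rho : nat -> R) (n : nat) : R :=
  rho n ^ dstar alpha n.

Lemma dstarP (R : realType) (alpha : nat -> R) (n : nat) :
  0 < ln (ln (n%:R : R)) -> 1 < n%:R * q_ alpha n ->
  is_least (dstar_set alpha n) (dstar alpha n).
Proof.
move=> lln; rewrite /dstar /dstar_set; set b := _ * q_ _ _ => b1.
have b0 : 0 < b by exact: lt_trans b1.
have n0 : 0 < n%:R :> R.
  rewrite ltr0n lt0n; apply: contraTneq b1 => n0.
  by rewrite /b n0 mul0r -leNgt.
set t := _ / _; have t0 : 0 < t by rewrite divr_gt0 ?exprn_gt0.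
clearbody t.
have lb0 : 0 < ln b by rewrite ln_gt0.
have tb d : (t <= b ^ d) = (Num.ceil (ln t / ln b) <= d).
  rewrite ceil_le_int ler_pdivrMr// -ln_powR (powR_intmul _ (ltW b0)).
  by rewrite [RHS]ler_ln// posrE exprz_gt0.
apply: xgetPex; exists (Num.ceil (ln t / ln b)).
by split=> [|d] /=; rewrite tb.
Qed.

Lemma lambdaP (R : realType) (alpha : nat -> R) (n : nat) :
  0 < n%:R * q_ alpha n ->
  0 < lambda_ alpha n < 1 /\
  ln (lambda_ alpha n)^-1 = (n%:R * q_ alpha n) ^ dstar alpha n / n%:R.
Proof.
rewrite /lambda_; set b := _ * q_ _ _ => b0.
have n0 : 0 < n%:R :> R.
  rewrite ltr0n lt0n; apply: contraTneq b0 => n0.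
  by rewrite /b n0 mul0r ltxx.
rewrite -expRN opprK expRK expR_gt0 expR_lt1 oppr_lt0.
by rewrite divr_gt0// exprz_gt0.
Qed.

Lemma Pr_total (R : realType) (n : nat) (q rho : R) :
  Pr q rho (fun _ : outcome n => true) = 1.
Proof.
rewrite /Pr /weight.
rewrite -(bigA_distr_bigA (fun (_ : vpair n) (x : bool * bool * bool) =>
  bernoulli_pmf q x.1.1 * bernoulli_pmf (1 - rho) x.1.2 *
  bernoulli_pmf q x.2)) /=.
apply: big1 => e _.
rewrite -(pair_bigA _ (fun (x : bool * bool) (y : bool) =>
  bernoulli_pmf q x.1 * bernoulli_pmf (1 - rho) x.2 * bernoulli_pmf q y)) /=.
rewrite -(pair_bigA _ (fun (x y : bool) => \sum_(z : bool)
  bernoulli_pmf q x * bernoulli_pmf (1 - rho) y * bernoulli_pmf q z)) /=.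
rewrite !big_bool /bernoulli_pmf /= -!mulrDr (addrC q) subrK !mulr1.
by rewrite -!mulrDr (addrC (1 - rho)) subrK !mulr1 addrC subrK.
Qed.

(* Main.v *)
Require Import Defs.
From mathcomp Require Import all_boot all_order all_algebra.
From mathcomp Require Import all_classical all_reals all_analysis.
From mathcomp Require Import ring lra zify.
Set Implicit Arguments.
Unset Strict Implicit.
Unset Printing Implicit Defensive.
Import Order.TTheory GRing.Theory Num.Theory.
Import numFieldNormedType.Exports.
Local Open Scope ring_scope.

(* Put D = n q, m = d* - 1 and x = D^(m+1) / n = log (1 / lambda). Explore both
   graphs simultaneously from vertex 1. Given the k-th spheres and balls of the two
   graphs, the labels of the pairs that meet the complement of the balls are still
   independent, so the number of vertices that stay outside of both balls of radius
   k+1 and the number of common edges that leave the spheres are sums of independent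
   indicators, controlled by Chebyshev's inequality with deviations D^(3(k+1)/4).
   Applied to the pairs of graphs (G1, G1), (G2, G2) and (G1, G2), this shows that
   the spheres of radius k <= m have size about D^k, and, by inclusion-exclusion,
   that their common part has size about (rho D)^k. One more step gives proportions
   1 - lambda for each sphere of radius m+1 and lambda^(2 - gamma) for the vertices
   outside of both balls. Nearly all edges of the DAGs leave the spheres of radii m
   and m+1: there are about n x and n D lambda (1 - lambda) of them. The edges are
   then counted in the three regimes eta = oo, lambda = 1, and the remaining one. *)

(** * Balls, spheres and the layers of the DAG *)

(** All randomness is spent on one event of probability 1 - O(1/B), with B = D^(1/4); the rest is
    deterministic analysis of inequalities between counts. The exponent 3/4 balances two needs. The
    counts of step k+1 have variance O(D^(k+1)), so Chebyshev loses O(B^(-2(k+1))), while the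
    relative errors B^(-(k+1)) accumulate to O(1/B); both series are small even though the number of
    steps grows.

    The threshold defining [dstar] gives x >= (log log n)^(-2) >= 1/B and x/D < (log log n)^(-2):
    the balls of radius m are negligible, yet D x still exceeds B.

    Two obstacles shape the argument. A vertex may be reached at different times in the two graphs,
    and then its labels are biased by what the earlier exploration has seen. And the proportion of
    survivors is exponential in the size of a sphere, so a relative error on x is not enough when x
    is large; a finite eta forces x = o(B), which repairs this, while an infinite eta makes the
    survivors irrelevant.

    In the limit the edges leaving the spheres of radius m carry no separate factor rho: gamma rho =
    gamma, since gamma > 0 forces rho = 1. *)

Fixpoint gball (n : nat) (G : graph n) (k : nat) : {set 'I_n} :=
  if k is k'.+1 then
    gball G k' :|: [set v | [exists a in gball G k', adj G a v]]
  else [set v | val v == 0%N].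

Definition gsphere (n : nat) (G : graph n) (k : nat) : {set 'I_n} :=
  if k is k'.+1 then gball G k :\: gball G k' else gball G 0.

(** The head is only required to avoid the ball of radius [k]; adjacency then puts it in the next
    sphere. In this form membership depends on the [k]-th sphere and ball and on a single label. *)
Definition layer_edges (n : nat) (G : graph n) (k : nat) : {set 'I_n * 'I_n} :=
  [set uv | [&& uv.1 \in gsphere G k, uv.2 \notin gball G k & adj G uv.1 uv.2]].

Section Balls.
Context (n : nat) (G : graph n).
Implicit Types (u v a : 'I_n) (k j : nat).

Lemma adj_sym u v : adj G u v = adj G v u.
Proof. by rewrite /adj; under eq_existsb do rewrite finset.setUC. Qed.

Lemma gballS k : gball G k \subset gball G k.+1.
Proof. exact: finset.subsetUl. Qed.

Lemma ball_sub j k : (j <= k)%N -> gball G j \subset gball G k.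
Proof.
move=> /subnK <-; elim: (k - j)%N => [|i IH]; first by rewrite add0n.
by rewrite addSn; apply: fintype.subset_trans IH (gballS _).
Qed.

Lemma sphere_sub k : gsphere G k \subset gball G k.
Proof. by case: k => [|k] //=; exact: finset.subsetDl. Qed.

Lemma in_sphereS k v : (v \in gsphere G k.+1) =
  (v \notin gball G k) && [exists a in gsphere G k, adj G a v].
Proof.
rewrite [in LHS]/= !inE; case: (boolP (v \in gball G k)) => //= vk.
apply/existsP/existsP => -[a /andP[ak av]]; exists a; last first.
  by rewrite av andbT; apply: (fintype.subsetP (sphere_sub k)).
rewrite av andbT; case: k ak vk => [|k] ak vk //.
rewrite [gsphere _ _]/= inE ak andbT; apply/negP => ak'.
by move/negP: vk; apply; rewrite /= !inE; apply/orP; right; apply/existsP; exists a; rewrite ak'.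
Qed.

Lemma gballSE k : gball G k.+1 = gball G k :|: gsphere G k.+1.
Proof. by apply/setP => v; rewrite [gsphere _ _]/= !inE; case: (v \in gball G k). Qed.

Lemma sphere_ball_disj j k v : (j < k)%N -> v \in gsphere G k -> v \notin gball G j.
Proof.
case: k => // k; rewrite ltnS => jk; rewrite in_sphereS => /andP[+ _].
by apply: contra; apply: (fintype.subsetP (ball_sub jk)).
Qed.

Lemma sphere_inj j k v : v \in gsphere G j -> v \in gsphere G k -> j = k.
Proof.
move=> vj vk; case: (ltngtP j k) => // h.
  by have := sphere_ball_disj h vk; rewrite (fintype.subsetP (sphere_sub j) _ vj).
by have := sphere_ball_disj h vj; rewrite (fintype.subsetP (sphere_sub k) _ vk).
Qed.

Lemma ball_path k v : reflect
  (exists (x : 'I_n) (p : seq 'I_n),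
     [/\ x = 0%N :> nat, path (adj G) x p, last x p = v & (size p <= k)%N])
  (v \in gball G k).
Proof.
apply: (iffP idP).
  elim: k v => [|k IH] v; first by rewrite inE => /eqP v0; exists v, [::].
  rewrite /= 2!inE => /orP[/IH[x [p [x0 xp lp sp]]]|/existsP[a /andP[/IH]]].
    by exists x, p; split => //; apply: leqW.
  move=> [x [p [x0 xp lp sp]]] av; exists x, (rcons p v).
  by rewrite rcons_path xp lp av last_rcons size_rcons.
move=> [x [p [x0 xp <-]]]; elim/last_ind: p k xp => [|p y IH] k /=.
  by move=> _ _; apply: (fintype.subsetP (ball_sub (leq0n k))); rewrite inE; apply/eqP.
rewrite rcons_path last_rcons size_rcons => /andP[xp py]; case: k => // k sp.
rewrite /= 2!inE; apply/orP; right; apply/existsP; exists (last x p).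
by rewrite py andbT IH.
Qed.

Lemma in_sphere k v : (v \in gsphere G k) =
  (v \in gball G k) && (if k is j.+1 then v \notin gball G j else true).
Proof. by case: k => [|k]; rewrite ?andbT //= finset.inE andbC. Qed.

(** Exchange argument: a shorter way to [v], continued by [s], would beat the whole path. *)
Lemma prefix_sphere (x : 'I_n) (q s : seq 'I_n) v : x = 0%N :> nat -> shortest_path G x (rcons q v ++ s) ->
  v \in gsphere G (size q).+1.
Proof.
move=> x0 [xp sh]; rewrite in_sphere; apply/andP; split.
  apply/ball_path; exists x, (rcons q v); rewrite size_rcons last_rcons; split => //.
  by move: xp; rewrite cat_path => /andP[].
apply/negP => /ball_path[y [p [y0 yp lp sp]]].
have xy : x = y by apply: val_inj => /=; rewrite x0 y0.
have := sh (p ++ s); rewrite cat_path last_cat -xy in yp lp *.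
rewrite yp lp last_cat last_rcons; move: xp; rewrite cat_path last_rcons => /andP[_ ->].
by move=> /(_ isT erefl); rewrite !size_cat size_rcons leq_add2r ltnNge sp.
Qed.

(** From here on paths disappear. For the converse, a path of length at most [k] to the tail,
    extended by the head, is shortest because no path of length at most [k] reaches the head. *)
Lemma SPD_layerP (uv : 'I_n * 'I_n) :
  reflect (exists k, uv \in layer_edges G k) (uv \in SPD G).
Proof.
case: uv => u v; apply: (iffP idP).
  rewrite inE => /asboolP[x [p [x0 xp /infixP[s1 [s2 /= es]]]]].
  have xs0 : x \in gsphere G 0 by rewrite inE; apply/eqP.
  case: s1 es => [[<- ep]|y q [_ ep]].
    exists 0%N; rewrite inE /=.
    have : v \in gsphere G 1 by apply: (@prefix_sphere x [::] s2) => //; rewrite /= -ep.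
    rewrite in_sphereS => /andP[-> _]; case: xp; rewrite ep xs0 /= => /andP[-> _] _.
    by [].
  exists (size q).+1; rewrite inE /=.
  have uk : u \in gsphere G (size q).+1.
    by apply: (@prefix_sphere x q (v :: s2)) => //; rewrite cat_rcons -ep.
  rewrite uk /=.
  have : v \in gsphere G (size (rcons q u)).+1.
    by apply: (@prefix_sphere x (rcons q u) s2) => //; rewrite !cat_rcons -ep.
  rewrite size_rcons in_sphereS => /andP[-> _] /=.
  by case: xp; rewrite ep cat_path /= => /and3P[_ _ /andP[->]].
move=> [k]; rewrite [in X in X -> _]inE => /and3P[/= uk vk uv].
rewrite inE; apply: asboolT.
have /ball_path[x [p [x0 xp lp sp]]] := fintype.subsetP (sphere_sub k) _ uk.
exists x, (rcons p v); split => //; last first.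
  have : x :: p = rcons (belast x p) u by rewrite lastI lp.
  by move=> e; rewrite -[x :: rcons p v]/(rcons (x :: p) v) e -!cats1 -catA; apply: infix_infix.
split; first by rewrite rcons_path xp lp.
move=> p' xp'; rewrite last_rcons size_rcons => lp'.
rewrite ltnNge; apply/negP => h; move/negP: vk; apply; apply/ball_path.
by exists x, p'; split => //; apply: leq_trans h sp.
Qed.

Lemma layer_edges_inj j k (uv : 'I_n * 'I_n) :
  uv \in layer_edges G j -> uv \in layer_edges G k -> j = k.
Proof. by rewrite !inE => /and3P[uj _ _] /and3P[uk _ _]; apply: sphere_inj uj uk. Qed.

Lemma layer_edges_ball k (uv : 'I_n * 'I_n) :
  uv \in layer_edges G k -> uv.2 \in gball G k.+1.
Proof.
rewrite inE => /and3P[uk _ uv2]; rewrite /= !inE; apply/orP; right; apply/existsP.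
by exists uv.1; rewrite uv2 andbT; apply: (fintype.subsetP (sphere_sub k)).
Qed.

(** A neighbour of the ball of radius [k - 1] belongs to the ball of radius [k]. This is all that
    exploration reveals about the pairs leaving the ball, and [compat] records it. *)
Lemma nonadj_interior k u a : a \in gball G k :\: gsphere G k -> u \notin gball G k ->
  ~~ adj G u a.
Proof.
case: k => [|k]; first by rewrite /= finset.setDv inE.
rewrite inE [gsphere _ _]/= inE negb_and negbK => /andP[/orP[ak _|/negP//]].
apply: contra; rewrite adj_sym => ua; rewrite /= !inE; apply/orP; right.
by apply/existsP; exists a; rewrite ak.
Qed.

Lemma sphereS_card k : (#|gball G k.+1| = #|gball G k| + #|gsphere G k.+1|)%N.
Proof.
rewrite gballSE cardsU [X in (_ - X)%N](_ : _ = 0%N) ?subn0 //.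
by apply/eqP; rewrite cards_eq0 -finset.subset0; apply/fintype.subsetP => v; rewrite inE [gsphere _ _]/= inE => /andP[-> ].
Qed.

End Balls.

(** Growing the balls up to radius [k] can read the pair [{u, a}] only from its end [a], once [a] is
    interior, and the pair is then absent in both graphs. So its status never matters. *)
Lemma ball_congr (n : nat) (G G' : graph n) (u a : 'I_n) (k : nat) :
  (forall x y, [set x; y] != [set u; a] -> adj G' x y = adj G x y) ->
  u \notin gball G k ->
  (a \in gball G k :\: gsphere G k -> ~~ adj G u a /\ ~~ adj G' u a) ->
  gball G' k = gball G k.
Proof.
move=> h; elim: k => [//|k IH] uk ak.
have kk := fintype.subsetP (gballS G k).
have uk' : u \notin gball G k by apply: contra uk; apply: kk.
have ak' : a \in gball G k -> ~~ adj G u a /\ ~~ adj G' u a.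
  by move=> a_k; apply: ak; rewrite inE [gsphere _ _]/= inE a_k kk.
have e : gball G' k = gball G k.
  by apply: IH => //; rewrite inE => /andP[_]; apply: ak'.
rewrite /= e; congr (_ :|: _); apply/setP => v; rewrite !inE; apply: eq_existsb => b.
case: (boolP (b \in gball G k)) => //= bk.
case: (eqVneq [set b; v] [set u; a]) => [E|]; last exact: h.
have bu : b != u by apply: contraNneq uk' => <-.
have ba : b = a.
  have : b \in [set u; a] by rewrite -E !inE eqxx.
  by rewrite !inE (negbTE bu) => /eqP.
have vu : v = u.
  have : u \in [set b; v] by rewrite E !inE eqxx.
  by rewrite !inE eq_sym (negbTE bu) => /eqP.
rewrite ba vu in bk *; rewrite ![adj _ a u]adj_sym.
by have [/negbTE-> /negbTE->] := ak' bk.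
Qed.

(** These edges are rare because the head has to miss a whole sphere of [H]. With [H = G] and [X]
    the complement of the ball they contain all layers beyond [k]; with [X] a sphere and two
    distinct graphs they contain the edges lying in different layers of the two DAGs. *)
Definition escape (n : nat) (X : {set 'I_n}) (G H : graph n) (k : nat) :
    {set 'I_n * 'I_n} :=
  [set uv | [&& uv.1 \in X, uv.2 \notin gball G k, adj G uv.1 uv.2
              & uv.2 \notin gball H k.+1]].

Lemma card_SPD_ge (n : nat) (G : graph n) (k : nat) :
  (#|layer_edges G k| + #|layer_edges G k.+1| <= #|SPD G|)%N.
Proof.
have d : layer_edges G k :&: layer_edges G k.+1 = finset.set0.
  apply/setP => uv; rewrite !inE; apply/negP => /andP[h1 h2].
  have := @layer_edges_inj _ G k k.+1 uv; rewrite !inE => /(_ h1 h2); lia.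
have := cardsU (layer_edges G k) (layer_edges G k.+1); rewrite d cards0 subn0 => <-.
apply: subset_leq_card; apply/fintype.subsetP => uv; rewrite finset.in_setU => /orP[h|h];
  by apply/SPD_layerP; eexists; exact: h.
Qed.

Lemma SPD_layer_cases (n : nat) (G : graph n) (k : nat) uv : uv \in SPD G ->
  [\/ uv \in \bigcup_(j < k) layer_edges G j, uv \in layer_edges G k,
      uv \in layer_edges G k.+1 | uv \in escape (~: gball G k.+1) G G k.+1].
Proof.
move=> /SPD_layerP[j h].
case: (ltngtP j k) => [jk|kj|jk]; last by constructor 2; rewrite -jk.
  by constructor 1; apply/finset.bigcupP; exists (Ordinal jk).
case: (ltngtP j k.+1) => [|kj'|jk]; [lia| |by constructor 3; rewrite -jk].
constructor 4; move: h; rewrite [in X in X -> _]inE => /and3P[uj vj uvj].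
rewrite inE finset.in_setC (sphere_ball_disj kj' uj) uvj /=; have s := ball_sub G.
apply/andP; split; first by apply: contra vj => vj; apply: (fintype.subsetP (s k.+1 j _)) => //; lia.
by apply: contra vj => vj; apply: (fintype.subsetP (s k.+2 j _)) => //.
Qed.

Lemma card_bigcup_layers (n : nat) (G : graph n) (k : nat) :
  (#|\bigcup_(j < k) layer_edges G j| <= \sum_(j < k) #|layer_edges G j|)%N.
Proof.
elim/big_ind2: _ => [|x a y b xa yb|//]; first by rewrite cards0.
by apply: (leq_trans (leq_card_setU _ _)); apply: leq_add.
Qed.

Lemma card_SPD_le (n : nat) (G : graph n) (k : nat) :
  (#|SPD G| <= #|layer_edges G k| + #|layer_edges G k.+1|
     + (\sum_(j < k) #|layer_edges G j| + #|escape (~: gball G k.+1) G G k.+1|))%N.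
Proof.
apply: (@leq_trans #|layer_edges G k :|: layer_edges G k.+1 :|:
   (\bigcup_(j < k) layer_edges G j :|: escape (~: gball G k.+1) G G k.+1)|).
  apply: subset_leq_card; apply/fintype.subsetP => uv /(@SPD_layer_cases _ _ k).
  by rewrite 3!finset.in_setU => -[->|->|->|->]; rewrite ?orbT.
apply: (leq_trans (leq_card_setU _ _)); apply: leq_add; first exact: leq_card_setU.
apply: (leq_trans (leq_card_setU _ _)); rewrite leq_add2r; exact: card_bigcup_layers.
Qed.

Lemma card_SPDI_ge (n : nat) (G H : graph n) (k : nat) :
  (#|layer_edges G k :&: layer_edges H k| + #|layer_edges G k.+1 :&: layer_edges H k.+1|
    <= #|SPD G :&: SPD H|)%N.
Proof.
have d : (layer_edges G k :&: layer_edges H k) :&: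
         (layer_edges G k.+1 :&: layer_edges H k.+1) = finset.set0.
  apply/setP => uv; rewrite 3!finset.in_setI finset.in_set0; apply/negP => /andP[/andP[h1 _] /andP[h2 _]].
  by have := layer_edges_inj h1 h2; lia.
have := cardsU (layer_edges G k :&: layer_edges H k)
               (layer_edges G k.+1 :&: layer_edges H k.+1); rewrite d cards0 subn0 => <-.
apply: subset_leq_card; apply/fintype.subsetP => uv; rewrite finset.in_setU finset.in_setI.
move=> /orP[/andP[h1 h2]|]; first by rewrite finset.in_setI; apply/andP; split; apply/SPD_layerP; exists k.
by rewrite finset.in_setI => /andP[h1 h2]; rewrite finset.in_setI; apply/andP; split; apply/SPD_layerP; exists k.+1.
Qed.

(* An edge of both DAGs that lies in layer k of G and in layer k+1 of H has an
   end that is adjacent to gsphere G k and yet farther than k+1 from 1 in H. *)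
Lemma cross_layer (n : nat) (G H : graph n) (k : nat) uv :
  uv \in layer_edges G k -> uv \in layer_edges H k.+1 -> uv \in escape (gsphere G k) G H k.
Proof.
rewrite inE => /and3P[uk vk uv1]; rewrite inE => /and3P[_ vk' _].
by rewrite inE uk vk uv1 vk'.
Qed.

Lemma card_SPDI_le (n : nat) (G H : graph n) (k : nat) :
  (#|SPD G :&: SPD H| <=
     (#|layer_edges G k :&: layer_edges H k| + #|layer_edges G k.+1 :&: layer_edges H k.+1|)
     + ((\sum_(j < k) #|layer_edges G j| + #|escape (~: gball G k.+1) G G k.+1|)
     +  (\sum_(j < k) #|layer_edges H j| + #|escape (~: gball H k.+1) H H k.+1|))
     + (#|escape (gsphere G k) G H k| + #|escape (gsphere H k) H G k|))%N.
Proof.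
apply: (@leq_trans #|((layer_edges G k :&: layer_edges H k) :|:
                      (layer_edges G k.+1 :&: layer_edges H k.+1)) :|:
   ((\bigcup_(j < k) layer_edges G j :|: escape (~: gball G k.+1) G G k.+1) :|:
    (\bigcup_(j < k) layer_edges H j :|: escape (~: gball H k.+1) H H k.+1)) :|:
   (escape (gsphere G k) G H k :|: escape (gsphere H k) H G k)|).
  apply: subset_leq_card; apply/fintype.subsetP => uv; rewrite finset.in_setI.
  move=> /andP[/(@SPD_layer_cases _ _ k) h1 /(@SPD_layer_cases _ _ k) h2].
  rewrite 7!finset.in_setU 2!finset.in_setI.
  case: h1 => [->|h1|h1|->]; rewrite ?orbT //; case: h2 => [->|h2|h2|->]; rewrite ?orbT //.
  - by rewrite h1 h2.
  - by rewrite (cross_layer h1 h2) ?orbT.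
  - by rewrite (cross_layer h2 h1) ?orbT.
  - by rewrite h1 h2 ?orbT.
do ![apply: (leq_trans (leq_card_setU _ _)); apply: leq_add] => //.
all: exact: card_bigcup_layers.
Qed.

(** * Product measure on the labels *)

Definition blank : bool * bool * bool := (false, false, false).

(** Total in [u] and [v]: the degenerate pair [u = v] gets the blank label, so that [adj_label]
    needs no side condition. *)
Definition label_at (n : nat) (w : outcome n) (u v : 'I_n) : bool * bool * bool :=
  if insub [set u; v] is Some e then w e else blank.

Definition relabel (n : nat) (w : outcome n) (u v : 'I_n) x : outcome n :=
  [ffun e => if val e == [set u; v] then x else w e].

Definition graph_of (n : nat) (f : bool * bool * bool -> bool) (w : outcome n) :
  graph n := [set e | f (w e)].

Section Labels.
Context (n : nat).
Implicit Types (w : outcome n) (u v : 'I_n).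

Lemma adj_label f w u v : f blank = false -> adj (graph_of f w) u v = f (label_at w u v).
Proof.
move=> f0; rewrite /adj /label_at; case: insubP => [e _ ve|h].
  apply/existsP/idP => [[e' /andP[]]|fe]; last by exists e; rewrite inE fe ve /=.
  rewrite inE => fe' /eqP ve'; suff -> : e = e' by [].
  by apply: val_inj; rewrite ve ve'.
rewrite f0; apply/existsP => -[e /andP[_ /eqP ve]].
by move/negP: h; apply; rewrite -ve; exact: (valP e).
Qed.

Lemma label_relabel w u v x : u != v -> label_at (relabel w u v x) u v = x.
Proof.
move=> uv; rewrite /label_at insubT => [|h]; first by rewrite cards2 uv.
by rewrite ffunE /= eqxx.
Qed.

Lemma label_relabel_neq w u v x a b : [set a; b] != [set u; v] ->
  label_at (relabel w u v x) a b = label_at w a b.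
Proof.
move=> h; rewrite /label_at; case: insubP => // e _ ve.
by rewrite ffunE /= ve (negbTE h).
Qed.

End Labels.

Section ProductMeasure.
Context (R : realType) (n : nat) (mu : bool * bool * bool -> R).
Hypothesis mu_sum : \sum_x mu x = 1.
Hypothesis mu_ge0 : forall x, 0 <= mu x.

Definition Ex (F : outcome n -> R) : R := \sum_(w : outcome n) (\prod_e mu (w e)) * F w.

Definition lab (h : bool * bool * bool -> R) : R := \sum_x mu x * h x.

Lemma ExD F G : Ex (fun w => F w + G w) = Ex F + Ex G.
Proof. by rewrite /Ex -big_split; apply: eq_bigr => w _; rewrite mulrDr. Qed.

Lemma ExZ c F : Ex (fun w => c * F w) = c * Ex F.
Proof. by rewrite /Ex big_distrr; apply: eq_bigr => w _; rewrite mulrCA. Qed.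

Lemma ExB F G : Ex (fun w => F w - G w) = Ex F - Ex G.
Proof.
rewrite -mulN1r -ExZ -ExD; congr Ex; apply: funext => w; by rewrite mulN1r.
Qed.

Lemma Ex_sum (I : Type) (r : seq I) (P : pred I) (F : I -> outcome n -> R) :
  Ex (fun w => \sum_(i <- r | P i) F i w) = \sum_(i <- r | P i) Ex (F i).
Proof.
rewrite /Ex exchange_big /=; apply: eq_bigr => w _; by rewrite big_distrr.
Qed.

Lemma eq_Ex F G : F =1 G -> Ex F = Ex G.
Proof. by move=> FG; congr Ex; apply: funext. Qed.

Lemma le_Ex F G : (forall w, F w <= G w) -> Ex F <= Ex G.
Proof.
move=> FG; apply: ler_sum => w _; apply: ler_wpM2l => //.
by apply: prodr_ge0.
Qed.

Lemma Ex_ge0 F : (forall w, 0 <= F w) -> 0 <= Ex F.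
Proof.
move=> F0; apply: sumr_ge0 => w _; apply: mulr_ge0 => //; exact: prodr_ge0.
Qed.

(** Resampling one coordinate preserves a product law: the involution [sw] exchanges the old label
    with the fresh one and leaves the joint weight of outcome and fresh label unchanged. *)
Lemma Ex_relabel u v F : u != v ->
  Ex F = Ex (fun w => \sum_x mu x * F (relabel w u v x)).
Proof.
move=> uv; have c2 : #|[set u; v]| == 2%N by rewrite cards2 uv.
pose e0 : vpair n := exist _ [set u; v] c2.
have vE e : (val e == [set u; v]) = (e == e0) by [].
pose sw (p : outcome n * (bool * bool * bool)) := (relabel p.1 u v p.2, p.1 e0).
have swK : involutive sw.
  move=> [w x]; rewrite /sw /=; congr pair; last by rewrite ffunE eqxx.
  by apply/ffunP => e; rewrite !ffunE vE; case: eqVneq => // ->.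
rewrite /Ex; under [RHS]eq_bigr do rewrite big_distrr /=.
rewrite pair_bigA (reindex_inj (inv_inj swK)) /=.
rewrite -(pair_bigA _ (fun w x => (\prod_e mu (relabel w u v x e)) *
  (mu (w e0) * F (relabel (relabel w u v x) u v (w e0))))) /=.
apply: eq_bigr => w _.
have rr x : relabel (relabel w u v x) u v (w e0) = w by have [] := swK (w, x).
under [RHS]eq_bigr do rewrite rr.
have pe x : (\prod_e mu (relabel w u v x e)) * mu (w e0) = mu x * \prod_e mu (w e).
  rewrite (bigD1 e0) //= ffunE vE eqxx [in RHS](bigD1 e0) //= -mulrA; congr (_ * _).
  rewrite mulrC; congr (_ * _); apply: eq_bigr => e ne.
  by rewrite ffunE vE (negbTE ne).
under [RHS]eq_bigr do rewrite mulrA pe -mulrA.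
by rewrite -big_distrl /= mu_sum mul1r.
Qed.

Lemma Ex_cst c : Ex (fun=> c) = c.
Proof.
rewrite /Ex -big_distrl /= -(bigA_distr_bigA (fun (_ : vpair n) x => mu x)) /=.
by rewrite big1 ?mul1r.
Qed.

Definition PrE (E : pred (outcome n)) : R := Ex (fun w => (E w)%:R).

Lemma PrE_le (E E' : pred (outcome n)) : (forall w, E w -> E' w) -> PrE E <= PrE E'.
Proof. by move=> h; apply: le_Ex => w; rewrite ler_nat; case: (E w) (h w) => // ->. Qed.

Lemma PrE_or (E E' : pred (outcome n)) : PrE (fun w => E w || E' w) <= PrE E + PrE E'.
Proof.
rewrite -ExD; apply: le_Ex => w; rewrite -natrD ler_nat.
by case: (E w); case: (E' w).
Qed.

Lemma PrE_exists (N : nat) (E : nat -> pred (outcome n)) :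
  PrE (fun w => [exists k : 'I_N, E k w]) <= \sum_(k < N) PrE (E k).
Proof.
rewrite -Ex_sum; apply: le_Ex => w; case: existsP => [[k Ek]|_].
  rewrite (bigD1 k) //= Ek lerDl; apply: sumr_ge0 => i _; exact: ler0n.
by apply: sumr_ge0 => i _; exact: ler0n.
Qed.

Lemma markov (X : outcome n -> R) (c : R) : 0 < c -> (forall w, 0 <= X w) ->
  PrE (fun w => c < X w) <= Ex X / c.
Proof.
move=> c0 X0; rewrite ler_pdivlMr // mulrC /PrE -ExZ; apply: le_Ex => w.
by case: ltP => h; rewrite ?mulr1 ?mulr0 // ltW.
Qed.

Lemma chebyshev2 (X : outcome n -> R) (c : R) : 0 < c ->
  PrE (fun w => c < `|X w|) <= Ex (fun w => X w ^+ 2) / c ^+ 2.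
Proof.
move=> c0; apply: le_trans (markov _ _); last 2 first.
- by rewrite exprn_gt0.
- by move=> w; exact: sqr_ge0.
apply: PrE_le => w h; by rewrite -[X w ^+ 2]real_normK ?num_real // ltr_pXn2r ?nnegrE // ltW.
Qed.

End ProductMeasure.

(** * Conditioning on the explored balls *)

(* The k-th gsphere and the k-th gball of two graphs. *)
Definition state (n : nat) : Type :=
  ({set 'I_n} * {set 'I_n}) * ({set 'I_n} * {set 'I_n}).

Definition outside (n : nat) (s : state n) : {set 'I_n} := ~: (s.1.2 :|: s.2.2).

Definition explore (n : nat) (f1 f2 : bool * bool * bool -> bool) (k : nat)
    (w : outcome n) : state n :=
  ((gsphere (graph_of f1 w) k, gball (graph_of f1 w) k),
   (gsphere (graph_of f2 w) k, gball (graph_of f2 w) k)).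

(* What the state s reveals on the label of a pair formed by a and a vertex
   outside of both balls. *)
Definition compat (n : nat) (f1 f2 : bool * bool * bool -> bool) (s : state n)
    (a : 'I_n) (x : bool * bool * bool) : bool :=
  ((a \in s.1.2 :\: s.1.1) ==> ~~ f1 x) && ((a \in s.2.2 :\: s.2.1) ==> ~~ f2 x).

Section Conditional.
Context (R : realType) (n : nat) (mu : bool * bool * bool -> R).
Context (f1 f2 : bool * bool * bool -> bool) (k : nat).
Hypothesis mu_sum : \sum_x mu x = 1.
Hypothesis f1_blank : f1 blank = false.
Hypothesis f2_blank : f2 blank = false.
Implicit Types (w : outcome n) (s : state n) (u v a : 'I_n).

Notation cst s a := (compat f1 f2 s a).
Notation st w := (explore f1 f2 k w).
Notation E := (Ex (n := n) mu).

Lemma ball_relabel f w u a x y : f blank = false -> u != a ->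
  u \notin gball (graph_of f (relabel w u a x)) k ->
  (a \in gball (graph_of f (relabel w u a x)) k :\: gsphere (graph_of f (relabel w u a x)) k ->
     ~~ f x /\ ~~ f y) ->
  forall j, (j <= k)%N ->
  gball (graph_of f (relabel w u a y)) j = gball (graph_of f (relabel w u a x)) j.
Proof.
move=> f0 ua; set G := graph_of f (relabel w u a x); set G' := graph_of f (relabel w u a y).
move=> uk ak j jk; apply: (@ball_congr _ _ _ u a).
- by move=> p q h; rewrite !adj_label // !label_relabel_neq.
- by apply: contra uk; apply: (fintype.subsetP (ball_sub G jk)).
rewrite !adj_label // !label_relabel // => aj; apply: ak.
move: jk aj; rewrite leq_eqVlt => /predU1P[->//|jk].
rewrite !finset.in_setD => /andP[_ aj].
have ak : a \in gball G k by apply: (fintype.subsetP (ball_sub G (ltnW jk))).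
rewrite ak andbT; apply/negP => /(sphere_ball_disj jk); by rewrite aj.
Qed.

Lemma sphere_congr (G G' : graph n) : (forall j, (j <= k)%N -> gball G' j = gball G j) ->
  gsphere G' k = gsphere G k.
Proof.
case: k => [|i] h; first by rewrite /gsphere h.
by rewrite /gsphere !h.
Qed.

Lemma explore_relabel_eq s w u a x y : u \in outside s -> u != a ->
  st (relabel w u a x) = s -> cst s a x -> cst s a y -> st (relabel w u a y) = s.
Proof.
move=> us ua ss; subst s => /andP[/implyP c1 /implyP c2] /andP[/implyP d1 /implyP d2].
have [u1 u2] : u \notin gball (graph_of f1 (relabel w u a x)) k /\
               u \notin gball (graph_of f2 (relabel w u a x)) k.
  move: us; rewrite finset.in_setC finset.in_setU negb_or => /andP[v1 v2].
  by split; [exact: v1|exact: v2].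
have b1 := ball_relabel f1_blank ua u1 (fun h => conj (c1 h) (d1 h)).
have b2 := ball_relabel f2_blank ua u2 (fun h => conj (c2 h) (d2 h)).
rewrite /explore (sphere_congr b1) (sphere_congr b2).
by rewrite (b1 k) // (b2 k).
Qed.

Lemma explore_compat s w u a : u \in outside s -> st w = s -> cst s a (label_at w u a).
Proof.
move=> us ss; move: us; rewrite -ss finset.in_setC finset.in_setU negb_or => /andP[u1 u2].
apply/andP; split; apply/implyP => h.
  by have := nonadj_interior h u1; rewrite adj_label.
by have := nonadj_interior h u2; rewrite adj_label.
Qed.

Lemma compat_blank s a : cst s a blank.
Proof. by rewrite /compat f1_blank f2_blank !implybT. Qed.

(** The event of being in state [s] splits into a condition on one label and an event blind to that
    label. The blank label, compatible with every state, serves as reference value. *)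
Lemma explore_relabel s w u a x : u \in outside s -> u != a ->
  (st (relabel w u a x) == s) = cst s a x && (st (relabel w u a blank) == s).
Proof.
move=> us ua; apply/eqP/andP => [h|[c /eqP h]].
  have c : cst s a x.
    by have := explore_compat a us h; rewrite label_relabel.
  split => //; apply/eqP; exact: explore_relabel_eq us ua h c (compat_blank s a).
exact: explore_relabel_eq us ua h (compat_blank s a) c.
Qed.

Definition cond (s : state n) (a : 'I_n) (h : bool * bool * bool -> R) : R :=
  lab mu (fun x => (cst s a x)%:R * h x) / lab mu (fun x => (cst s a x)%:R).

Lemma Ex_cond s u a (Psi : outcome n -> R) h : u \in outside s -> u != a ->
  lab mu (fun x => (cst s a x)%:R) != 0 ->
  (forall w x, Psi (relabel w u a x) = Psi w) ->
  E (fun w => (st w == s)%:R * (h (label_at w u a) * Psi w)) =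
  cond s a h * E (fun w => (st w == s)%:R * Psi w).
Proof.
move=> us ua c0 hPsi.
have key g : E (fun w => (st w == s)%:R * (g (label_at w u a) * Psi w)) =
   lab mu (fun x => (cst s a x)%:R * g x) *
   E (fun w => (st (relabel w u a blank) == s)%:R * Psi w).
  rewrite (@Ex_relabel _ _ _ mu_sum u a) // -ExZ; apply: eq_Ex => w.
  rewrite /lab big_distrl; apply: eq_bigr => x _ /=.
  rewrite explore_relabel // label_relabel // hPsi -mulnb natrM; ring.
rewrite key /cond.
have -> : E (fun w => (st w == s)%:R * Psi w) =
    lab mu (fun x => (cst s a x)%:R) *
    E (fun w => (st (relabel w u a blank) == s)%:R * Psi w).
  have := key (fun=> 1); under eq_Ex do rewrite mul1r.
  move=> ->; congr (_ * _); apply: eq_bigr => x _; by rewrite mulr1.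
by rewrite mulrA divfK.
Qed.

(** Conditional independence given the state. Labels are integrated one at a time by [Ex_cond];
    since the pairs are distinct, the remaining product does not see the label being resampled. *)
Lemma Ex_prod s (l : seq ('I_n * 'I_n)) (h : 'I_n * 'I_n -> bool * bool * bool -> R) :
  (forall a, lab mu (fun x => (cst s a x)%:R) != 0) ->
  uniq [seq [set p.1; p.2] | p <- l] ->
  all (fun p => (p.1 \in outside s) && (p.1 != p.2)) l ->
  E (fun w => (st w == s)%:R * \prod_(p <- l) h p (label_at w p.1 p.2)) =
  (\prod_(p <- l) cond s p.2 (h p)) * E (fun w => (st w == s)%:R).
Proof.
move=> c0; elim: l => [|[u a] l IH] /=.
  by move=> _ _; rewrite big_nil mul1r; apply: eq_Ex => w; rewrite big_nil mulr1.
move=> /andP[ul unl] /andP[/andP[us ua] al]; rewrite big_cons -mulrA -IH //.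
rewrite -(@Ex_cond s u a (fun w => \prod_(p <- l) h p (label_at w p.1 p.2))) //=.
  by apply: eq_Ex => w; rewrite big_cons.
move=> w x; apply: eq_big_seq => -[u' a'] pl; rewrite label_relabel_neq //=.
apply: contra ul => /eqP <-; by apply: (map_f (fun p : 'I_n * 'I_n => [set p.1; p.2])) pl.
Qed.

End Conditional.

(** Conditional probability, given [s], that a vertex outside of both balls is reached through [a].
    The product [a1 * a2] corrects for both labels being present. If [a] is in one sphere and
    interior to the other ball, the absence of the other label lowers the probability from [q] to
    [(1 - rho) * q]. Then [survival] is the conditional probability of staying outside, and [hazard]
    its exponent to first order. *)
Definition loss (R : realType) (n : nat) (q rho : R) (s : state n) (a : 'I_n) : R :=
  let a1 := (a \in s.1.1)%:R in let a2 := (a \in s.2.1)%:R in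
  let b1 := (a \in s.1.2 :\: s.1.1)%:R in let b2 := (a \in s.2.2 :\: s.2.1)%:R in
  q * a1 + q * a2 - (rho + (1 - rho) * q) * q * (a1 * a2) - rho * q * (a1 * b2 + a2 * b1).

Definition hazard (R : realType) (n : nat) (q rho : R) (s : state n) : R :=
  \sum_(a in s.1.1 :|: s.2.1) loss q rho s a.

Definition survival (R : realType) (n : nat) (q rho : R) (s : state n) : R :=
  \prod_(a in s.1.1 :|: s.2.1) (1 - loss q rho s a).

(** Vertices that one exploration has just reached and that the other has already passed. *)
Definition mixed (n : nat) (s : state n) : nat :=
  (#|s.1.1 :&: (s.2.2 :\: s.2.1)| + #|s.2.1 :&: (s.1.2 :\: s.1.1)|)%N.

Section Bounds.
Context (R : realType) (n : nat) (q rho : R).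
Hypothesis q_in : 0 <= q <= 4^-1.
Hypothesis rho_in : 0 <= rho <= 1.
Implicit Types (s : state n) (a : 'I_n).

Lemma loss_in s a : 0 <= loss q rho s a <= 2 * q.
Proof.
have [q0 q1] := andP q_in; have [r0 r1] := andP rho_in.
rewrite /loss !finset.in_setD.
case: (a \in s.1.1); case: (a \in s.2.1); case: (a \in s.1.2); case: (a \in s.2.2);
  rewrite /= ?(mulr0, mulr1, addr0, add0r, subr0); apply/andP; split; nra.
Qed.

Lemma hazardE s : hazard q rho s = q * (#|s.1.1|%:R + #|s.2.1|%:R)
  - (rho + (1 - rho) * q) * q * #|s.1.1 :&: s.2.1|%:R - rho * q * (mixed s)%:R.
Proof.
have cE (A : {set 'I_n}) : #|A|%:R = \sum_a (a \in A)%:R :> R.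
  by rewrite -sum1_card natr_sum big_mkcond; apply: eq_bigr => a _; case: (a \in A).
rewrite /hazard /mixed natrD !cE !mulrDr !big_distrr /= -!sumrN -!big_split /= -!sumrN -!big_split /=.
rewrite big_mkcond /=; apply: eq_bigr => a _; rewrite /loss !inE.
by case: (a \in s.1.1); case: (a \in s.2.1); case: (a \in s.1.2); case: (a \in s.2.2) => /=; ring.
Qed.

Lemma hazard_ge0 s : 0 <= hazard q rho s.
Proof. by apply: sumr_ge0 => a _; have /andP[] := loss_in s a. Qed.

Lemma survival_in s : 0 <= survival q rho s <= 1.
Proof.
have [q0 q1] := andP q_in.
apply/andP; split; first by apply: prodr_ge0 => a _; have /andP[] := loss_in s a; lra.
by apply: prodr_ile1 => a _; have /andP[] := loss_in s a; lra.
Qed.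

Lemma survival_ge s : 1 - hazard q rho s <= survival q rho s.
Proof.
have [q0 q1] := andP q_in.
suff [] : 0 <= survival q rho s <= 1 /\ 1 - hazard q rho s <= survival q rho s by [].
rewrite /survival /hazard; elim/big_rec2: _ => [|a h p _ [/andP[p0 p1] hp]].
  by split; rewrite ?subr0 ?ler01 ?lexx.
have /andP[l0 l1] := loss_in s a.
have lp : loss q rho s a * p <= loss q rho s a by rewrite ler_piMr.
split; last by rewrite mulrBl mul1r; lra.
apply/andP; split; first by apply: mulr_ge0 => //; lra.
by rewrite mulrBl mul1r; have := mulr_ge0 l0 p0; lra.
Qed.

Lemma survival_le_exp s : survival q rho s <= expR (- hazard q rho s).
Proof.
rewrite /survival /hazard -sumrN expR_sum; apply: ler_prod => a _.
have /andP[l0 l1] := loss_in s a; have [q0 q1] := andP q_in.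
apply/andP; split; first by lra.
exact: expR_ge1Dx.
Qed.

(** For a loss [l], [1 - l >= expR (- (l / (1 - l)))], and [l <= 2 * q] gives
    [1 / (1 - l) <= 1 + 4 * q] precisely because [q <= 1 / 4]. *)
Lemma survival_ge_exp s : expR (- ((1 + 4 * q) * hazard q rho s)) <= survival q rho s.
Proof.
rewrite /survival /hazard big_distrr /= -sumrN expR_sum; apply: ler_prod => a _.
have /andP[l0 l1] := loss_in s a; have [q0 q1] := andP q_in.
set l := loss q rho s a in l0 l1 *; rewrite expR_ge0 /=.
have l2 : 0 < 1 - l by lra.
apply: (@le_trans _ _ (expR (- (l / (1 - l))))).
  rewrite ler_expR lerN2 ler_pdivrMr //; nra.
rewrite expRN invf_ple ?posrE ?expR_gt0 //.
apply: le_trans (expR_ge1Dx _); rewrite le_eqVlt; apply/orP; left; apply/eqP.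
by field; rewrite gt_eqF.
Qed.

End Bounds.

(** * First and second moments of one exploration step, given the state *)

Section SecondMoment.
Context (R : realType) (n : nat) (mu : bool * bool * bool -> R).
Notation E := (Ex (n := n) mu).

(** [Z] will be the indicator of a state, so that [p] is a conditional probability and the
    right-hand side a binomial variance. Pairwise products are enough for this. *)
Lemma sum_indicator_second_moment (I : finType) (A : {set I}) (Z : outcome n -> R)
    (X : I -> outcome n -> R) (p : R) :
  (forall i w, X i w ^+ 2 = X i w) ->
  (forall i, i \in A -> E (fun w => Z w * X i w) = p * E Z) ->
  (forall i j, i \in A -> j \in A -> i != j ->
     E (fun w => Z w * (X i w * X j w)) = p ^+ 2 * E Z) ->
  E (fun w => Z w * (\sum_(i in A) X i w - #|A|%:R * p) ^+ 2) =
  #|A|%:R * (p * (1 - p)) * E Z.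
Proof.
move=> XX m1 m2; pose N : R := #|A|%:R.
have -> : E (fun w => Z w * (\sum_(i in A) X i w - N * p) ^+ 2) =
    \sum_(i in A) \sum_(j in A) E (fun w => Z w * (X i w * X j w))
    - 2 * (N * p) * \sum_(i in A) E (fun w => Z w * X i w) + (N * p) ^+ 2 * E Z.
  have -> : \sum_(i in A) E (fun w => Z w * X i w) = E (fun w => Z w * \sum_(i in A) X i w).
    by rewrite -Ex_sum; apply: eq_Ex => w; rewrite big_distrr.
  have -> : \sum_(i in A) \sum_(j in A) E (fun w => Z w * (X i w * X j w)) =
      E (fun w => Z w * (\sum_(i in A) X i w) ^+ 2).
    rewrite (eq_bigr (fun i => E (fun w => \sum_(j in A) Z w * (X i w * X j w)))).
      rewrite -Ex_sum; apply: eq_Ex => w; rewrite expr2 big_distrl big_distrr /=.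
      by apply: eq_bigr => i _; rewrite !big_distrr.
    by move=> i _; rewrite -Ex_sum.
  by rewrite -!ExZ -ExB -ExD; apply: eq_Ex => w; ring.
have -> : \sum_(i in A) E (fun w => Z w * X i w) = N * (p * E Z).
  by rewrite (eq_bigr (fun=> p * E Z)) // sumr_const -mulr_natl.
have -> : \sum_(i in A) \sum_(j in A) E (fun w => Z w * (X i w * X j w)) =
    N * (N * (p ^+ 2 * E Z) + (p - p ^+ 2) * E Z).
  rewrite (eq_bigr (fun=> N * (p ^+ 2 * E Z) + (p - p ^+ 2) * E Z)).
    by rewrite sumr_const -mulr_natl.
  move=> i iA; rewrite (bigD1 i) //=.
  have -> : E (fun w => Z w * (X i w * X i w)) = p * E Z.
    by rewrite -(m1 i iA); apply: eq_Ex => w; rewrite -expr2 XX.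
  have -> : N * (p ^+ 2 * E Z) = \sum_(j in A) (p ^+ 2 * E Z) by rewrite sumr_const mulr_natl.
  rewrite [in RHS](bigD1 i) //= (eq_bigr (fun=> p ^+ 2 * E Z)); first by ring.
  by move=> j /andP[jA ji]; rewrite m2 // eq_sym.
by ring.
Qed.

End SecondMoment.

Lemma set2_inj (T : finType) (u v a b : T) : [set u; a] = [set v; b] -> u != b ->
  u = v /\ a = b.
Proof.
move=> e ub; have uv : u = v.
  have : u \in [set v; b] by rewrite -e !inE eqxx.
  by rewrite !inE (negbTE ub) orbF => /eqP.
split=> //; have : b \in [set u; a] by rewrite e !inE eqxx orbT.
by rewrite !inE eq_sym (negbTE ub) => /eqP.
Qed.

Lemma uniq_star (T : finType) (u : T) (A : {set T}) : u \notin A ->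
  uniq [seq [set p.1; p.2] | p <- [seq (u, a) | a <- enum A]].
Proof.
move=> uA; rewrite -map_comp map_inj_in_uniq ?enum_uniq // => a b.
rewrite !mem_enum => aA bA /= /set2_inj h; apply: (proj2 (h _)).
by apply: contraNneq uA => ->.
Qed.

Section Moments.
Context (R : realType) (n : nat) (mu : bool * bool * bool -> R).
Context (f1 f2 : bool * bool * bool -> bool) (k : nat) (q rho : R).
Hypothesis mu_sum : \sum_x mu x = 1.
Hypothesis mu_ge0 : forall x, 0 <= mu x.
Hypothesis f1_blank : f1 blank = false.
Hypothesis f2_blank : f2 blank = false.
Hypothesis q_in : 0 <= q <= 4^-1.
Hypothesis rho_in : 0 <= rho <= 1.
Hypothesis lab_f1 : lab mu (fun x => (f1 x)%:R) = q.
Hypothesis lab_f2 : lab mu (fun x => (f2 x)%:R) = q.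
Hypothesis lab_f12 : lab mu (fun x => (f1 x && f2 x)%:R) = (rho + (1 - rho) * q) * q.
Implicit Types (w : outcome n) (s : state n) (u v a : 'I_n).

Notation cst s a := (compat f1 f2 s a).
Notation st w := (explore f1 f2 k w).
Notation E := (Ex (n := n) mu).
Notation q12 := ((rho + (1 - rho) * q) * q).
Notation cnd := (cond mu f1 f2).

(** A function of two bits is a combination of 1, the two bits and their product, whose means are
    all given. Every conditional law below is computed from this by cases. *)
Lemma lab_bool2 (g : bool -> bool -> R) :
  lab mu (fun x => g (f1 x) (f2 x)) =
  q12 * g true true + (q - q12) * (g true false + g false true)
  + (1 - 2 * q + q12) * g false false.
Proof.
have -> : lab mu (fun x => g (f1 x) (f2 x)) =
    g false false * lab mu (fun=> 1)
    + (g true false - g false false) * lab mu (fun x => (f1 x)%:R)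
    + (g false true - g false false) * lab mu (fun x => (f2 x)%:R)
    + (g true true - g true false - g false true + g false false)
      * lab mu (fun x => (f1 x && f2 x)%:R).
  rewrite /lab !big_distrr -!big_split /=; apply: eq_bigr => x _.
  by case: (f1 x); case: (f2 x) => /=; ring.
have -> : lab mu (fun=> 1) = 1 by rewrite -[RHS]mu_sum; apply: eq_bigr => x _; rewrite mulr1.
rewrite lab_f1 lab_f2 lab_f12; ring.
Qed.

Lemma lab_compat s a : lab mu (fun x => (cst s a x)%:R) =
  if a \in s.1.2 :\: s.1.1 then
    if a \in s.2.2 :\: s.2.1 then 1 - 2 * q + q12 else 1 - q
  else if a \in s.2.2 :\: s.2.1 then 1 - q else 1.
Proof.
rewrite /compat (lab_bool2 (fun b1 b2 => ((_ ==> ~~ b1) && (_ ==> ~~ b2))%:R)).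
by case: (a \in s.1.2 :\: s.1.1); case: (a \in s.2.2 :\: s.2.1) => /=; ring.
Qed.

Lemma lab_compat_gt0 s a : 0 < lab mu (fun x => (cst s a x)%:R).
Proof.
have [q0 q1] := andP q_in; have [r0 r1] := andP rho_in.
rewrite lab_compat; case: ifP; case: ifP => _ _; nra.
Qed.

Lemma cond_bool2 s a (g : bool -> bool -> R) (c : R) :
  lab mu (fun x => (cst s a x)%:R * g (f1 x) (f2 x)) = c * lab mu (fun x => (cst s a x)%:R) ->
  cnd s a (fun x => g (f1 x) (f2 x)) = c.
Proof. by move=> h; rewrite /cond h mulfK // gt_eqF // lab_compat_gt0. Qed.

Definition avoid (s : state n) (a : 'I_n) (x : bool * bool * bool) : bool :=
  ((a \in s.1.1) ==> ~~ f1 x) && ((a \in s.2.1) ==> ~~ f2 x).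

Lemma cond_avoid s a : cnd s a (fun x => (avoid s a x)%:R) = 1 - loss q rho s a.
Proof.
rewrite /avoid (@cond_bool2 s a (fun b1 b2 => ((_ ==> ~~ b1) && (_ ==> ~~ b2))%:R)
   (1 - loss q rho s a)) //.
rewrite lab_compat /compat.
rewrite (lab_bool2 (fun b1 b2 => ((_ ==> ~~ b1) && (_ ==> ~~ b2))%:R *
                                 ((_ ==> ~~ b1) && (_ ==> ~~ b2))%:R)).
rewrite /loss !finset.in_setD.
by case: (a \in s.1.1); case: (a \in s.2.1); case: (a \in s.1.2); case: (a \in s.2.2) => /=; ring.
Qed.

Lemma cond_both s a : a \in s.1.1 -> a \in s.2.1 ->
  cnd s a (fun x => (f1 x && f2 x)%:R) = q12.
Proof.
move=> a1 a2; rewrite (@cond_bool2 s a (fun b1 b2 => (b1 && b2)%:R) q12) //.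
rewrite lab_compat /compat (lab_bool2 (fun b1 b2 => ((_ ==> ~~ b1) && (_ ==> ~~ b2))%:R * (b1 && b2)%:R)).
by rewrite !finset.in_setD a1 a2 /=; ring.
Qed.

Lemma cond_f1_le s a : cnd s a (fun x => (f1 x)%:R) <= q.
Proof.
have [q0 q1] := andP q_in; have [r0 r1] := andP rho_in.
rewrite /cond ler_pdivrMr ?lab_compat_gt0 //.
rewrite lab_compat /compat (lab_bool2 (fun b1 b2 => ((_ ==> ~~ b1) && (_ ==> ~~ b2))%:R * b1%:R)).
have h1 : 0 <= rho * (q * (1 - q)) by rewrite !mulr_ge0 //; lra.
have h2 : 0 <= q * (1 - q) by rewrite !mulr_ge0 //; lra.
have h3 : 0 <= q * (1 - 2 * q) by rewrite !mulr_ge0 //; lra.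
have h4 : 0 <= q * q12 by rewrite !mulr_ge0 ?addr_ge0 ?mulr_ge0 //; lra.
case: (a \in s.1.2 :\: s.1.1); case: (a \in s.2.2 :\: s.2.1) => /=;
  rewrite ?(mulr1, mulr0, mul0r, addr0, add0r) //; lra.
Qed.

Lemma cond_f1_ge0 s a : 0 <= cnd s a (fun x => (f1 x)%:R).
Proof.
rewrite /cond divr_ge0 // ?(ltW (lab_compat_gt0 _ _)) //.
by apply: sumr_ge0 => x _; rewrite !mulr_ge0.
Qed.

(** When [a] is interior to the first ball, the absence of its first label makes the second label
    less likely; only the trivial bound 1 is kept then. This is why [mixed] enters the exponent in
    [escape_mean]. *)
Lemma cond_not_f2 s a : a \in s.2.1 ->
  0 <= cnd s a (fun x => (~~ f2 x)%:R) <= 1 - q * (a \notin s.1.2 :\: s.1.1)%:R.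
Proof.
have [q0 q1] := andP q_in; have [r0 r1] := andP rho_in.
move=> a2; rewrite /cond; apply/andP; split.
  rewrite divr_ge0 // ?(ltW (lab_compat_gt0 _ _)) //.
  by apply: sumr_ge0 => x _; rewrite !mulr_ge0.
rewrite ler_pdivrMr ?lab_compat_gt0 //.
rewrite lab_compat /compat (lab_bool2 (fun b1 b2 => ((_ ==> ~~ b1) && (_ ==> ~~ b2))%:R * (~~ b2)%:R)).
rewrite [_ \in s.2.2 :\: _]finset.in_setD a2 /=.
have h1 : 0 <= (1 - rho) * (q * (1 - q)) by rewrite !mulr_ge0 //; lra.
case: (a \in s.1.2 :\: s.1.1) => /=;
  rewrite ?(mulr1, mulr0, mul0r, addr0, add0r, subr0) //; lra.
Qed.

Definition proper_state (s : state n) : bool := (s.1.1 \subset s.1.2) && (s.2.1 \subset s.2.2).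

(** Law of total expectation over the states. States that are not proper never occur, so nothing has
    to be checked for them. *)
Lemma Ex_state_le (F : outcome n -> R) (H : state n -> R) :
  (forall s, proper_state s ->
     E (fun w => (st w == s)%:R * F w) <= H s * E (fun w => (st w == s)%:R)) ->
  E F <= E (fun w => H (st w)).
Proof.
move=> h.
have tot (K : outcome n -> R) : E K = \sum_(s : state n) E (fun w => (st w == s)%:R * K w).
  rewrite -Ex_sum; apply: eq_Ex => w; rewrite -big_distrl /= (bigD1 (st w)) //= eqxx.
  by rewrite big1 ?addr0 ?mul1r // => s; rewrite eq_sym => /negbTE->.
rewrite (tot F) (tot (fun w => H (st w))); apply: ler_sum => s _.
have -> : E (fun w => (st w == s)%:R * H (st w)) = H s * E (fun w => (st w == s)%:R).
  by rewrite -ExZ; apply: eq_Ex => w; case: eqVneq => [->|_]; rewrite ?mul0r ?mulr0 // mulrC.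
case: (boolP (proper_state s)) => [/h//|ns].
have z w : (st w == s) = false.
  by apply: contraNF ns => /eqP <-; rewrite /proper_state !sphere_sub.
by rewrite (@eq_Ex _ _ _ _ (fun=> 0 * 0)) ?ExZ ?(@eq_Ex _ _ _ (fun w => (st w == s)%:R) (fun=> 0 * 0)) ?ExZ ?mul0r ?mulr0 // => w; rewrite z ?mul0r.
Qed.

Lemma in_outside s u : (u \in outside s) = (u \notin s.1.2) && (u \notin s.2.2).
Proof. by rewrite finset.in_setC finset.in_setU negb_or. Qed.

Lemma outside_disj s u : proper_state s -> u \in outside s -> u \notin s.1.1 :|: s.2.1.
Proof.
move=> /andP[/fintype.subsetP s1 /fintype.subsetP s2]; rewrite finset.in_setC; apply: contra.
by rewrite !finset.in_setU => /orP[/s1->|/s2->]; rewrite ?orbT.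
Qed.

Definition unseen (s : state n) (u : 'I_n) (w : outcome n) : R :=
  \prod_(a in s.1.1 :|: s.2.1) (avoid s a (label_at w u a))%:R.

Lemma unseen_sq s u w : unseen s u w ^+ 2 = unseen s u w.
Proof.
rewrite expr2 /unseen -big_split; apply: eq_bigr => a _ /=.
by case: (avoid _ _ _); rewrite ?mulr1 ?mulr0.
Qed.

Let compat_neq0 s a : lab mu (fun x => (cst s a x)%:R) != 0.
Proof. by rewrite gt_eqF // lab_compat_gt0. Qed.

Let star s u := [seq (u, a) | a <- enum (s.1.1 :|: s.2.1)].

Let unseenE s u w : unseen s u w =
  \prod_(p <- star s u) (avoid s p.2 (label_at w p.1 p.2))%:R.
Proof. by rewrite big_map big_enum. Qed.

Let star_cond s u :
  \prod_(p <- star s u) cnd s p.2 (fun x => (avoid s p.2 x)%:R) = survival q rho s.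
Proof.
by rewrite big_map big_enum; apply: eq_bigr => a _ /=; rewrite cond_avoid.
Qed.

Let star_ok s u : proper_state s -> u \in outside s ->
  all (fun p => (p.1 \in outside s) && (p.1 != p.2)) (star s u).
Proof.
move=> ps us; apply/allP => p /mapP[a]; rewrite mem_enum => aA -> /=.
by rewrite us /=; apply: contraNneq (outside_disj ps us) => ->.
Qed.

Lemma Ex_unseen s u : proper_state s -> u \in outside s ->
  E (fun w => (st w == s)%:R * unseen s u w) = survival q rho s * E (fun w => (st w == s)%:R).
Proof.
move=> ps us; rewrite -(star_cond s u).
rewrite -(Ex_prod k mu_sum f1_blank f2_blank (fun p x => (avoid s p.2 x)%:R)) //.
- by apply: eq_Ex => w; rewrite unseenE.
- exact: uniq_star (outside_disj ps us).
- exact: star_ok.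
Qed.

Lemma Ex_unseen2 s u v : proper_state s -> u \in outside s -> v \in outside s -> u != v ->
  E (fun w => (st w == s)%:R * (unseen s u w * unseen s v w)) =
  survival q rho s ^+ 2 * E (fun w => (st w == s)%:R).
Proof.
move=> ps us vs uv; rewrite expr2 -{1}(star_cond s u) -(star_cond s v) -big_cat.
rewrite -(Ex_prod k mu_sum f1_blank f2_blank (fun p x => (avoid s p.2 x)%:R)) //.
- by apply: eq_Ex => w; rewrite !unseenE -big_cat.
(* The stars of two distinct outside vertices share no pair: as no centre lies in the spheres, a
   common pair would identify the centres. *)
- rewrite map_cat cat_uniq !uniq_star ?outside_disj // andbT /=.
  apply/hasPn => _ /mapP[_ /mapP[b +] ->] ->; rewrite mem_enum => bA /=.
  apply/negP => /mapP[_ /mapP[a +] ->] /= e; rewrite mem_enum => aA.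
  have := set2_inj e; case; first by apply: contraNneq (outside_disj ps vs) => ->.
  by move=> /eqP; rewrite eq_sym (negbTE uv).
- by rewrite all_cat !star_ok.
Qed.

Lemma in_outsideS s u w : st w = s ->
  (u \in outside (explore f1 f2 k.+1 w)) =
  (u \in outside s) && [forall a in s.1.1 :|: s.2.1, avoid s a (label_at w u a)].
Proof.
move=> <-; rewrite !in_outside.
rewrite -[(explore f1 f2 k.+1 w).1.2]/(gball (graph_of f1 w) k.+1).
rewrite -[(explore f1 f2 k.+1 w).2.2]/(gball (graph_of f2 w) k.+1).
rewrite !gballSE !finset.in_setU !in_sphereS !negb_or /=.
case: (boolP (u \in gball (graph_of f1 w) k)) => //= u1.
case: (boolP (u \in gball (graph_of f2 w) k)) => //= u2; first by rewrite andbF.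
apply/andP/forallP => [[/existsPn h1 /existsPn h2] a|h].
  apply/implyP => _; rewrite /avoid; have := h1 a; have := h2 a.
  rewrite ![adj _ a u]adj_sym !adj_label //.
  case: (a \in gsphere (graph_of f1 w) k); case: (a \in gsphere (graph_of f2 w) k);
    by move=> /= g2 g1; rewrite ?g1 ?g2.
split; apply/existsPn => a; apply/negP => /andP[aA];
  rewrite adj_sym adj_label // => fa; have := h a;
  rewrite /avoid finset.in_setU aA ?orbT /= fa /= ?andbF //.
Qed.

Lemma card_outsideS s w : st w = s ->
  #|outside (explore f1 f2 k.+1 w)|%:R = \sum_(u in outside s) unseen s u w.
Proof.
move=> ws; rewrite -sum1_card natr_sum big_mkcond [RHS]big_mkcond /=.
apply: eq_bigr => u _; rewrite (in_outsideS u ws); case: (u \in outside s) => //=.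
rewrite /unseen; case: forallP => h.
  by rewrite big1 // => a aA; have := h a; rewrite aA /= => ->.
have [a] : exists a, ~~ ((a \in s.1.1 :|: s.2.1) ==> avoid s a (label_at w u a)).
  by apply/existsP; rewrite -negb_forall; apply/negP => /forallP.
by rewrite negb_imply => /andP[aA na]; rewrite (bigD1 a) //= (negbTE na) mul0r.
Qed.

Let yk w : R := #|outside (st w)|%:R.
Let yS w : R := #|outside (explore f1 f2 k.+1 w)|%:R.

(** Each outside vertex survives with the same probability [p], and
    [p * (1 - p) <= 1 - p <= hazard]. *)
Lemma outside_variance :
  E (fun w => (yS w - yk w * survival q rho (st w)) ^+ 2) <= E (fun w => n%:R * hazard q rho (st w)).
Proof.
apply: (@le_trans _ _ (E (fun w => (fun s : state n => #|outside s|%:R * (survival q rho s * (1 - survival q rho s))) (st w)))).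
  apply: (Ex_state_le (H := fun s => #|outside s|%:R * (survival q rho s * (1 - survival q rho s)))) => s ps.
  rewrite -(@sum_indicator_second_moment R n mu _ (outside s) _ (unseen s)).
  - rewrite le_eqVlt; apply/orP; left; apply/eqP; apply: eq_Ex => w.
    case: eqVneq => [ws|]; rewrite ?mul0r // /yS /yk (card_outsideS ws) ws //.
  - by move=> u w; exact: unseen_sq.
  - by move=> u us; exact: Ex_unseen.
  - by move=> u v us vs uv; exact: Ex_unseen2.
apply: le_Ex => // w /=; set s := st w.
have /andP[p0 p1] := survival_in q_in rho_in s; have hp := survival_ge q_in rho_in s.
apply: ler_pM => //; first by rewrite mulr_ge0 // subr_ge0.
  by rewrite ler_nat -[X in (_ <= X)%N]card_ord; exact: max_card.
by apply: (@le_trans _ _ (1 - survival q rho s)); [apply: ler_piMl; lra|lra].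
Qed.

Lemma outside_mean : E (fun w => yk w - yS w) <= E (fun w => n%:R * hazard q rho (st w)).
Proof.
apply: (Ex_state_le (H := fun s => n%:R * hazard q rho s)) => s ps.
apply: (@le_trans _ _ (#|outside s|%:R * (1 - survival q rho s) * E (fun w => (st w == s)%:R))).
  rewrite le_eqVlt; apply/orP; left; apply/eqP.
  have -> : E (fun w => (st w == s)%:R * (yk w - yS w)) =
     #|outside s|%:R * E (fun w => (st w == s)%:R) -
     \sum_(u in outside s) E (fun w => (st w == s)%:R * unseen s u w).
    rewrite -Ex_sum -ExZ -ExB; apply: eq_Ex => w; case: eqVneq => [ws|_].
      rewrite mul1r mulr1 /yk /yS ws (card_outsideS ws); congr (_ - _).
      by apply: eq_bigr => u _; rewrite mul1r.
    by rewrite mul0r mulr0 big1 ?subr0 // => u _; rewrite mul0r.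
  rewrite (eq_bigr (fun=> survival q rho s * E (fun w => (st w == s)%:R))).
    by rewrite sumr_const -mulr_natl; ring.
  by move=> u us; rewrite Ex_unseen.
apply: ler_wpM2r; first by apply: Ex_ge0.
have /andP[p0 p1] := survival_in q_in rho_in s; have hp := survival_ge q_in rho_in s.
apply: ler_pM => //; first by rewrite subr_ge0.
  by rewrite ler_nat -[X in (_ <= X)%N]card_ord; exact: max_card.
by lra.
Qed.

Definition common_edges (w : outcome n) : {set 'I_n * 'I_n} :=
  layer_edges (graph_of f1 w) k :&: layer_edges (graph_of f2 w) k.

Let both (p : 'I_n * 'I_n) w : R :=
  (f1 (label_at w p.2 p.1) && f2 (label_at w p.2 p.1))%:R.
Let slots s : {set 'I_n * 'I_n} := finset.setX (s.1.1 :&: s.2.1) (outside s).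

Lemma card_common_edges s w : st w = s ->
  #|common_edges w|%:R = \sum_(p in slots s) both p w.
Proof.
move=> ws; rewrite -sum1_card natr_sum big_mkcond [RHS]big_mkcond /=.
apply: eq_bigr => -[a u] _; rewrite finset.in_setI !finset.inE /both -ws /=.
rewrite !(adj_sym _ a u) !adj_label //.
case: (a \in gsphere (graph_of f1 w) k); case: (a \in gsphere (graph_of f2 w) k);
case: (u \in gball (graph_of f1 w) k); case: (u \in gball (graph_of f2 w) k);
by case: (f1 _); case: (f2 _).
Qed.

Lemma in_slots s a u : (a, u) \in slots s =
  [&& a \in s.1.1, a \in s.2.1 & u \in outside s].
Proof. by rewrite finset.in_setX /= finset.in_setI andbA. Qed.

(** A slot starts in both spheres, hence is interior to neither ball: the state says nothing about
    its label, and both adjacencies hold with the unconditional probability [q12]. *)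
Lemma common_edges_variance :
  E (fun w => (#|common_edges w|%:R
     - #|(st w).1.1 :&: (st w).2.1|%:R * #|outside (st w)|%:R * q12) ^+ 2)
  <= E (fun w => n%:R * q * #|(st w).1.1|%:R).
Proof.
have [q0 q1] := andP q_in; have [r0 r1] := andP rho_in.
have q120 : 0 <= q12 by rewrite mulr_ge0 // addr_ge0 // mulr_ge0 //; lra.
have q12q : q12 <= q.
  have : 0 <= (1 - rho) * (q * (1 - q)) by rewrite !mulr_ge0 //; lra.
  lra.
apply: (Ex_state_le (H := fun s => n%:R * q * #|s.1.1|%:R)) => s ps.
have disj a u : (a, u) \in slots s -> u \in outside s /\ u != a.
  rewrite in_slots => /and3P[a1 a2 us]; split => //.
  by apply: contraNneq (outside_disj ps us) => ->; rewrite finset.in_setU a1.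
have := @sum_indicator_second_moment R n mu _ (slots s) (fun w => (st w == s)%:R) both q12.
move=> /(_ _ _ _) h.
rewrite [leLHS](_ : _ = #|slots s|%:R * (q12 * (1 - q12)) * E (fun w => (st w == s)%:R)).
  apply: ler_wpM2r; first exact: Ex_ge0.
  rewrite cardsX natrM mulrC [leRHS](_ : _ = q * (#|s.1.1|%:R * n%:R)); last by ring.
  have qq : q12 * (1 - q12) <= q by apply: le_trans q12q; rewrite ler_piMr //; lra.
  have qq0 : 0 <= q12 * (1 - q12) by apply: mulr_ge0 => //; lra.
  apply: (ler_pM qq0 _ qq); first by rewrite -natrM ler0n.
  apply: ler_pM; rewrite ?ler_nat //; first exact: subset_leq_card (finset.subsetIl _ _).
  by rewrite -[X in (_ <= X)%N]card_ord; exact: max_card.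
rewrite -h.
- apply: eq_Ex => w; case: eqVneq => [ws|]; rewrite ?mul0r // ws.
  by rewrite (card_common_edges ws) cardsX natrM.
- by move=> p w; rewrite /both; case: (_ && _); rewrite ?expr1n ?expr0n.
- move=> [a u] au; have [us ua] := disj _ _ au.
  move: au; rewrite in_slots => /and3P[a1 a2 _].
  have := @Ex_prod R n mu f1 f2 k mu_sum f1_blank f2_blank s [:: (u, a)]
    (fun _ x => (f1 x && f2 x)%:R) (compat_neq0 s) isT.
  rewrite /= us ua big_seq1 cond_both // => <- //.
  by apply: eq_Ex => w; rewrite big_seq1.
- move=> [a u] [b v] au bv ne; have [us ua] := disj _ _ au; have [vs vb] := disj _ _ bv.
  move: au bv; rewrite !in_slots => /and3P[a1 a2 _] /and3P[b1 b2 _].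
  have := @Ex_prod R n mu f1 f2 k mu_sum f1_blank f2_blank s [:: (u, a); (v, b)]
    (fun _ x => (f1 x && f2 x)%:R) (compat_neq0 s).
  rewrite /= us ua vs vb !big_cons big_nil mulr1 !cond_both // -expr2 => <- //.
    by apply: eq_Ex => w; rewrite !big_cons big_nil mulr1.
  rewrite andbT inE; apply/negP => /eqP /set2_inj []; last first.
    by move=> uv ab; move: ne; rewrite uv ab eqxx.
  by apply: contraNneq (outside_disj ps us) => ->; rewrite finset.in_setU b1.
Qed.

(** An escaping edge from [u] to [v] needs its own label to be present in the first graph, and [v]
    to miss the second sphere. The vertex [u] is left out of that product because its label is
    already used, whence the 1 in the exponent. The natural bound depends on the random state, so
    the count is divided by it before averaging; Markov's inequality then applies to the ratio. *)
Lemma escape_mean (X : state n -> {set 'I_n}) :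
  forall (c : state n -> R), (forall s, 0 < c s) ->
  (forall s, #|X s|%:R * n%:R * q * expR (- (q * (#|s.2.1|%:R - (mixed s)%:R - 1))) <= c s) ->
  E (fun w => #|escape (X (st w)) (graph_of f1 w) (graph_of f2 w) k|%:R / c (st w)) <= 1.
Proof.
have [q0 q1] := andP q_in.
move=> c c0 hc; rewrite -[leRHS](Ex_cst n mu_sum) .
apply: (Ex_state_le (H := fun=> 1)) => s ps; rewrite mul1r.
pose Y (u v : 'I_n) w : R := (f1 (label_at w v u))%:R *
  \prod_(a in s.2.1 :\ u) (~~ f2 (label_at w v a))%:R.
pose P := finset.setX (X s) (outside s).
have YE u v : v \in outside s -> u != v ->
    E (fun w => (st w == s)%:R * Y u v w) <=
    q * expR (- (q * (#|s.2.1|%:R - (mixed s)%:R - 1))) * E (fun w => (st w == s)%:R).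
  move=> vs uv.
  have vA : v \notin s.2.1.
    by apply: contra (outside_disj ps vs) => v2; rewrite finset.in_setU v2 orbT.
  pose h (p : 'I_n * 'I_n) x : R := if p.2 == u then (f1 x)%:R else (~~ f2 x)%:R.
  pose l := (v, u) :: [seq (v, a) | a <- enum (s.2.1 :\ u)].
  have -> : E (fun w => (st w == s)%:R * Y u v w) =
      E (fun w => (st w == s)%:R * \prod_(p <- l) h p (label_at w p.1 p.2)).
    apply: eq_Ex => w; rewrite big_cons big_map big_enum /= {1}/h eqxx.
    congr (_ * (_ * _)); apply: eq_bigr => a; rewrite !inE /h /= => /andP[/negbTE-> _].
    by [].
  rewrite Ex_prod //; last 2 first.
  - rewrite /l /= uniq_star ?andbT; last by rewrite finset.in_setD1 negb_and vA orbT.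
    apply/negP => /mapP[_ /mapP[a +] ->] /= e; rewrite mem_enum finset.in_setD1 => /andP[au a2].
    have [|_ ua] := set2_inj e; first by apply: contraNneq vA => ->.
    by rewrite ua eqxx in au.
  - rewrite /= vs eq_sym uv /=; apply/allP => p /mapP[a +] -> /=.
    rewrite vs /= mem_enum finset.in_setD1 => /andP[_ a2].
    by apply: contraNneq vA => ->.
  apply: ler_wpM2r; first exact: Ex_ge0.
  rewrite big_cons big_map big_enum /=; apply: ler_pM.
  - by rewrite /h /= eqxx cond_f1_ge0.
  - apply: prodr_ge0 => a; rewrite !inE /h /= => /andP[/negbTE-> a2].
    by have /andP[] := cond_not_f2 a2.
  - by rewrite /h /= eqxx cond_f1_le.
  apply: (@le_trans _ _ (\prod_(a in s.2.1 :\ u) expR (- (q * (a \notin s.1.2 :\: s.1.1)%:R)))).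
    apply: ler_prod => a; rewrite !inE /h /= => /andP[/negbTE-> a2].
    have /andP[-> /=] := cond_not_f2 a2; move=> /le_trans; apply.
    by rewrite !inE; exact: expR_ge1Dx.
  rewrite -expR_sum ler_expR sumrN lerN2 -big_distrr /=; apply: ler_wpM2l => //.
  have -> : \sum_(a in s.2.1 :\ u) (a \notin s.1.2 :\: s.1.1)%:R =
      #|(s.2.1 :\ u) :\: (s.1.2 :\: s.1.1)|%:R :> R.
    rewrite -sum1_card natr_sum big_mkcond [RHS]big_mkcond /=; apply: eq_bigr => a _.
    by rewrite [in RHS]finset.in_setD andbC; case: (a \in _ :\ _) => //=; case: (a \in _).
  rewrite !lerBlDr natr1 -natrD ler_nat (cardsD1 u) -(cardsID (s.1.2 :\: s.1.1) (s.2.1 :\ u)).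
  have TN := subset_leq_card (finset.setSI (s.1.2 :\: s.1.1) (finset.subD1set s.2.1 u)).
  have aux (b i j i' j' : nat) : (b <= 1 -> i <= j -> b + (i + i') <= i'.+1 + (j' + j))%N by lia.
  by apply: aux TN; exact: leq_b1.
apply: (@le_trans _ _ ((c s)^-1 * \sum_(p in P)
    E (fun w => (st w == s)%:R * (if p.1 != p.2 then Y p.1 p.2 w else 0)))).
  rewrite -Ex_sum -ExZ; apply: le_Ex => // w; case: eqVneq => [ws|]; last first.
    by rewrite !mul0r; rewrite big1 ?mulr0 // => p _; rewrite mul0r.
  rewrite mul1r mulrC ws; apply: ler_wpM2l; first by rewrite invr_ge0 ltW.
  rewrite -sum1_card natr_sum big_mkcond [leRHS]big_mkcond /=; apply: ler_sum => -[u v] _.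
  have Y0 : 0 <= Y u v w by rewrite mulr_ge0 // prodr_ge0.
  rewrite finset.inE -[(u, v).1]/u -[(u, v).2]/v; case: ifP => [|_]; last first.
    by case: ifP => //; case: ifP; rewrite ?mul1r // mulr0.
  move=> /and4P[uX v1 uv v2].
  have vs : v \in outside s.
    rewrite in_outside -ws v1 /=; apply: contra v2; apply: (fintype.subsetP (gballS _ k)).
  have uv' : u != v.
    apply: contraTneq uv => ->; rewrite adj_label // /label_at.
    by rewrite finset.setUid insubN ?cards1 // f1_blank.
  rewrite finset.in_setX /= uX vs uv' mul1r /Y /=.
  move: uv; rewrite adj_sym adj_label // => ->; rewrite mul1r big1 // => a.
  rewrite finset.in_setD1 -ws /= => /andP[_ a2].
  suff -> : f2 (label_at w v a) = false by [].
  apply: contraNF v2 => fa; rewrite gballSE finset.in_setU in_sphereS.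
  case: (v \in gball (graph_of f2 w) k) => //=; apply/existsP; exists a.
  by rewrite a2 adj_sym adj_label.
rewrite ler_pdivrMl //.
apply: (@le_trans _ _ (\sum_(p in P) q * expR (- (q * (#|s.2.1|%:R - (mixed s)%:R - 1)))
    * E (fun w => (st w == s)%:R))).
  apply: ler_sum => -[u v]; rewrite finset.in_setX => /andP[/= uX vs].
  case: (eqVneq u v) => uv; last exact: YE.
  rewrite (@eq_Ex _ _ _ _ (fun=> 0)) ?Ex_cst ?mulr_ge0 ?expR_ge0 ?Ex_ge0 //.
  by move=> w; rewrite mulr0.
rewrite sumr_const -[X in X <= _]mulr_natl mulrA; apply: ler_wpM2r; first exact: Ex_ge0.
apply: le_trans (hc s); rewrite cardsX natrM -!mulrA; apply: ler_wpM2l => //.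
apply: ler_wpM2r; first by rewrite mulr_ge0 // expR_ge0.
by rewrite ler_nat -[X in (_ <= X)%N]card_ord; exact: max_card.
Qed.

End Moments.

(** * The joint law of the two adjacencies of one pair *)

Definition pair_law (R : realType) (q rho : R) (x : bool * bool * bool) : R :=
  bernoulli_pmf q x.1.1 * bernoulli_pmf (1 - rho) x.1.2 * bernoulli_pmf q x.2.

Definition first_adj (x : bool * bool * bool) : bool := x.1.1.

Definition second_adj (x : bool * bool * bool) : bool := if x.1.2 then x.2 else x.1.1.

Section Law.
Context (R : realType) (q rho : R).
Notation mu := (pair_law q rho).

Let lab_expand (h : bool * bool * bool -> R) : lab mu h =
  \sum_(a : bool) \sum_(r : bool) \sum_(b : bool) mu (a, r, b) * h (a, r, b).
Proof.
by rewrite [RHS]pair_bigA /= pair_bigA; apply: eq_bigr => -[[a r] b] _.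
Qed.

Lemma pair_law_sum : \sum_x mu x = 1.
Proof.
have -> : \sum_x mu x = lab mu (fun=> 1) by apply: eq_bigr => x _; rewrite mulr1.
by rewrite lab_expand !big_bool /pair_law /bernoulli_pmf /=; ring.
Qed.

Lemma lab_first : lab mu (fun x => (first_adj x)%:R) = q.
Proof. by rewrite lab_expand !big_bool /pair_law /bernoulli_pmf /=; ring. Qed.

Lemma lab_second : lab mu (fun x => (second_adj x)%:R) = q.
Proof. by rewrite lab_expand !big_bool /pair_law /bernoulli_pmf /=; ring. Qed.

Lemma lab_both : lab mu (fun x => (first_adj x && second_adj x)%:R) = (rho + (1 - rho) * q) * q.
Proof. by rewrite lab_expand !big_bool /pair_law /bernoulli_pmf /=; ring. Qed.

(** A graph paired with itself is the case [rho = 1], so the moments computed for two graphs also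
    cover a single one. *)
Lemma lab_diag (f : bool * bool * bool -> bool) : lab mu (fun x => (f x)%:R) = q ->
  lab mu (fun x => (f x && f x)%:R) = (1 + (1 - 1) * q) * q.
Proof. by move=> h; under eq_fun do rewrite andbb; rewrite h; ring. Qed.

Lemma pair_law_ge0 : 0 <= q <= 1 -> 0 <= rho <= 1 -> forall x, 0 <= mu x.
Proof.
move=> /andP[q0 q1] /andP[r0 r1] [[a r] b]; rewrite /pair_law /bernoulli_pmf /=.
by case: a; case: r; case: b; rewrite !mulr_ge0 //; lra.
Qed.

Lemma Pr_PrE (n : nat) (E : pred (outcome n)) : Pr q rho E = PrE mu E.
Proof.
rewrite /Pr /PrE /Ex big_mkcond; apply: eq_bigr => w _.
by case: (E w); rewrite ?mulr1 ?mulr0.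
Qed.

End Law.

Lemma card_outside_diag (n : nat) (f : bool * bool * bool -> bool) (k : nat) (w : outcome n) :
  #|outside (explore f f k w)| = (n - #|gball (graph_of f w) k|)%N.
Proof.
rewrite (_ : outside _ = ~: gball (graph_of f w) k); last first.
  by apply/setP => v; rewrite in_outside finset.in_setC andbb.
by have := cardsC (gball (graph_of f w) k); rewrite card_ord => e; rewrite -[X in (X - _)%N]e addKn.
Qed.

Lemma mixed_diag (n : nat) (f : bool * bool * bool -> bool) (k : nat) (w : outcome n) :
  mixed (explore f f k w) = 0%N.
Proof.
rewrite /mixed /= (_ : _ :&: _ = finset.set0) ?cards0 //.
by apply/setP => v; rewrite finset.in_setI finset.in_setD finset.in_set0; case: (v \in gsphere _ _).
Qed.

(** * The good event and its probability *)

Section Good.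
Context (R : realType) (n : nat).

Definition regular (f1 f2 : bool * bool * bool -> bool) (q rho t : R) (k : nat)
    (w : outcome n) : bool :=
  let s := explore f1 f2 k w in
  (`|#|outside (explore f1 f2 k.+1 w)|%:R - #|outside s|%:R * survival q rho s| <= t) &&
  (`|#|common_edges f1 f2 k w|%:R
     - #|s.1.1 :&: s.2.1|%:R * #|outside s|%:R * ((rho + (1 - rho) * q) * q)| <= t).

(** The added 1 keeps the bound positive when [X s] is empty, as [escape_mean] divides by it. *)
Definition confined (f1 f2 : bool * bool * bool -> bool) (q c : R)
    (X : state n -> {set 'I_n}) (k : nat) (w : outcome n) : bool :=
  let s := explore f1 f2 k w in
  #|escape (X s) (graph_of f1 w) (graph_of f2 w) k|%:R
    <= c * ((#|X s|%:R + 1) * n%:R * q * expR (- (q * (#|s.2.1|%:R - (mixed s)%:R - 1)))).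

(* B is the fourth root of n q; the k-th spheres have size about B^(4k), with
   fluctuations at the first steps of relative order B^-1. *)
Definition good (q rho B : R) (m : nat) (w : outcome n) : bool :=
  [&& [forall k : 'I_m.+2,
        [&& regular first_adj first_adj q 1 (B ^+ (3 * k.+1)) k w,
            regular second_adj second_adj q 1 (B ^+ (3 * k.+1)) k w &
            regular first_adj second_adj q rho (B ^+ (3 * k.+1)) k w]],
      confined first_adj first_adj q B (@outside n) m.+1 w,
      confined second_adj second_adj q B (@outside n) m.+1 w,
      confined first_adj second_adj q B (fun s => s.1.1) m w &
      confined second_adj first_adj q B (fun s => s.1.1) m w].

Context (q rho B : R).
Hypothesis q_in : 0 <= q <= 4^-1.
Hypothesis rho_in : 0 <= rho <= 1.
Hypothesis qn : n%:R * q = B ^+ 4.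
Hypothesis B_ge2 : 2 <= B.
Notation mu := (pair_law q rho).

Let q1 : 0 <= q <= 1. Proof. by move/andP: q_in => [-> h] /=; lra. Qed.
Let one_in : 0 <= (1 : R) <= 1. Proof. by rewrite ler01 lexx. Qed.
Let B_gt0 : 0 < B. Proof. by apply: lt_le_trans B_ge2; rewrite ltr0n. Qed.
Let mu0 := pair_law_ge0 q1 rho_in.

(** For a graph paired with itself the outside set shrinks by exactly the next sphere and the hazard
    is [q] times the current one, so [outside_mean] reads as a recursion of factor [n q]. *)
Lemma sphere_mean (f : bool * bool * bool -> bool) (k : nat) : f blank = false ->
  lab mu (fun x => (f x)%:R) = q ->
  Ex mu (fun w : outcome n => #|gsphere (graph_of f w) k|%:R) <= (n%:R * q) ^+ k.
Proof.
move=> f0 labf; elim: k => [|k IH].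
  rewrite expr0 -[leRHS](Ex_cst n (pair_law_sum q rho)); apply: le_Ex => // w.
  rewrite lern1; apply/card_le1P => x; rewrite !inE => /eqP x0 y; rewrite !inE.
  by apply/eqP/eqP => [y0|->//]; apply: val_inj; rewrite /= x0 y0.
have := @outside_mean R n mu f f k q 1 (pair_law_sum q rho) mu0 f0 f0 q_in one_in labf labf
  (lab_diag labf).
set L := Ex _ _; set L' := Ex _ _; move=> h.
rewrite exprS; apply: le_trans (ler_wpM2l _ IH); last first.
  by rewrite mulr_ge0 //; have /andP[] := q_in.
rewrite -ExZ; apply: le_trans (le_trans h _).
  rewrite le_eqVlt; apply/orP; left; apply/eqP; apply: eq_Ex => w.
  rewrite !card_outside_diag; have := sphereS_card (graph_of f w) k.
  have := max_card (mem (gball (graph_of f w) k.+1)); rewrite card_ord => le1 e.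
  rewrite !natrB //; last by apply: leq_trans le1; rewrite e leq_addr.
  by rewrite e natrD; lra.
apply: le_Ex => // w; rewrite hazardE mixed_diag /= finset.setIid.
by rewrite le_eqVlt; apply/orP; left; apply/eqP; ring.
Qed.

(** By [sphere_mean] the two variances are at most [2 D^(k+1)] and [D^(k+1)] with [D = B^4], while
    the squared threshold is [D^(k+1) B^(2(k+1))]; hence the constant 3 = 2 + 1. *)
Lemma Pr_not_regular (f1 f2 : bool * bool * bool -> bool) (r : R) (k : nat) :
  f1 blank = false -> f2 blank = false -> 0 <= r <= 1 ->
  lab mu (fun x => (f1 x)%:R) = q -> lab mu (fun x => (f2 x)%:R) = q ->
  lab mu (fun x => (f1 x && f2 x)%:R) = (r + (1 - r) * q) * q ->
  PrE (n := n) mu (fun w => ~~ regular f1 f2 q r (B ^+ (3 * k.+1)) k w)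
    <= 3 * (B ^+ 2)^-1 ^+ k.+1.
Proof.
move=> f10 f20 r_in l1 l2 l12; have [q0 _] := andP q_in.
have B0 := B_gt0.
have t0 : 0 < B ^+ (3 * k.+1) by rewrite exprn_gt0.
apply: (@le_trans _ _ (PrE mu (fun w : outcome n =>
  (B ^+ (3 * k.+1) < `|#|outside (explore f1 f2 k.+1 w)|%:R - #|outside (explore f1 f2 k w)|%:R
       * survival q r (explore f1 f2 k w)|) ||
  (B ^+ (3 * k.+1) < `|#|common_edges f1 f2 k w|%:R
     - #|(explore f1 f2 k w).1.1 :&: (explore f1 f2 k w).2.1|%:R
       * #|outside (explore f1 f2 k w)|%:R * ((r + (1 - r) * q) * q)|)))).
  by apply: PrE_le => // w; rewrite /regular negb_and -!ltNge.
apply: le_trans (PrE_or mu0 _ _) _.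
have tt : (B ^+ (3 * k.+1)) ^+ 2 = B ^+ 4 ^+ k.+1 * (B ^+ 2) ^+ k.+1.
  by rewrite -!exprM -exprD -mulnDl mulnAC.
have D0 : 0 < B ^+ 4 ^+ k.+1 by rewrite !exprn_gt0.
have E0 : 0 < (B ^+ 2) ^+ k.+1 by rewrite !exprn_gt0.
have s1 := sphere_mean k f10 l1; have s2 := sphere_mean k f20 l2.
rewrite qn in s1 s2; have nq0 : 0 <= n%:R * q by rewrite mulr_ge0.
rewrite (_ : 3 * _ = 2 * (B ^+ 2)^-1 ^+ k.+1 + 1 * (B ^+ 2)^-1 ^+ k.+1); last by ring.
apply: lerD; apply: le_trans (chebyshev2 mu0 _ t0) _;
  rewrite tt exprVn invfM mulrA ler_wpM2r ?invr_ge0 ?(ltW E0) // ler_pdivrMr //.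
  apply: le_trans (@outside_variance R n mu f1 f2 k q r (pair_law_sum q rho) mu0 f10 f20 q_in r_in l1 l2 l12) _.
  apply: (@le_trans _ _ (Ex mu (fun w : outcome n => n%:R * q *
     (#|gsphere (graph_of f1 w) k|%:R + #|gsphere (graph_of f2 w) k|%:R)))).
    apply: le_Ex => // w; rewrite hazardE // -[leRHS]mulrA; apply: ler_wpM2l => //=.
    have [r0 r1] := andP r_in; have [_ q41] := andP q_in.
    have r' : 0 <= r + (1 - r) * q by rewrite addr_ge0 // mulr_ge0 //; lra.
    by rewrite -addrA gerDl -opprD oppr_le0 addr_ge0 // mulr_ge0 // mulr_ge0.
  rewrite ExZ ExD qn (exprS (B ^+ 4)) [leRHS]mulrCA; apply: ler_wpM2l; first by rewrite exprn_ge0 // ltW.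
  by lra.
apply: le_trans (@common_edges_variance R n mu f1 f2 k q r (pair_law_sum q rho) mu0 f10 f20 q_in r_in l1 l2 l12) _.
by rewrite ExZ qn (exprS (B ^+ 4)) mul1r ler_wpM2l // exprn_ge0 // ltW.
Qed.

Lemma Pr_not_confined (f1 f2 : bool * bool * bool -> bool) (r : R) X (k : nat) :
  f1 blank = false -> f2 blank = false -> 0 <= r <= 1 ->
  lab mu (fun x => (f1 x)%:R) = q -> lab mu (fun x => (f2 x)%:R) = q ->
  lab mu (fun x => (f1 x && f2 x)%:R) = (r + (1 - r) * q) * q ->
  PrE mu (fun w => ~~ confined f1 f2 q B X k w) <= B^-1.
Proof.
move=> f10 f20 r_in l1 l2 l12; have [q0 _] := andP q_in.
have B0 := B_gt0.
have nq0 : 0 < n%:R * q by rewrite qn exprn_gt0.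
pose c (s : state n) := (#|X s|%:R + 1) * n%:R * q *
  expR (- (q * (#|s.2.1|%:R - (mixed s)%:R - 1))).
have c0 s : 0 < c s.
  rewrite /c -(mulrA (_ + 1)); apply: mulr_gt0; last exact: expR_gt0.
  by apply: mulr_gt0 => //; exact: ltr_wpDl.
have := @escape_mean R n mu f1 f2 k q r (pair_law_sum q rho) mu0 f10 f20 q_in r_in l1 l2 l12
  X c c0.
set F := (fun w => _ / _) => /(_ _) h.
apply: (@le_trans _ _ (PrE mu (fun w : outcome n => B < F w))).
  apply: PrE_le => // w; rewrite /confined -ltNge /F => hh.
  by rewrite ltr_pdivlMr.
apply: le_trans (markov mu0 B0 _) _.
  by move=> w; rewrite divr_ge0 // ltW.
rewrite ler_pdivrMr // mulVf ?gt_eqF //; apply: h => s.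
rewrite /c ler_wpM2r ?expR_ge0 // ler_wpM2r // ler_wpM2r // lerDl //.
Qed.

Lemma geometric_sum_le (r : R) (N : nat) : 0 <= r <= 2^-1 ->
  \sum_(k < N) r ^+ k.+1 <= 2 * r.
Proof.
move=> /andP[r0 r1]; suff : \sum_(k < N) r ^+ k.+1 <= 2 * r - 2 * r ^+ N.+1.
  by move=> h; apply: le_trans h _; rewrite gerBl mulr_ge0 // exprn_ge0.
elim: N => [|N IH]; first by rewrite big_ord0 expr1 subrr.
rewrite big_ord_recr /= (exprS r N.+1).
have : 0 <= (1 - 2 * r) * r ^+ N.+1 by rewrite mulr_ge0 ?exprn_ge0 //; lra.
by lra.
Qed.

Let sum_bound (N : nat) : 9 * \sum_(k < N) (B ^+ 2)^-1 ^+ k.+1 <= 18 / B.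
Proof.
have B0 := B_gt0.
have BB : (B ^+ 2)^-1 <= B^-1 / 2.
  rewrite expr2 invfM; apply: ler_wpM2l; first by rewrite invr_ge0 ltW.
  by rewrite lef_pV2 ?posrE.
have B2 : B^-1 <= 1 by rewrite invf_le1 //; apply: le_trans B_ge2; rewrite ler1n.
have B3 : 0 <= (B ^+ 2)^-1 by rewrite invr_ge0 exprn_ge0 // ltW.
have r_in : 0 <= (B ^+ 2)^-1 <= 2^-1 by rewrite B3 /=; lra.
have := geometric_sum_le N r_in; move: (\sum_(_ < _) _) => z; lra.
Qed.

(** Three regularity events at each radius give 9 times a geometric series of ratio [B^-2], bounded
    by [18 / B]; the four confinement events add [1 / B] each. *)
Lemma Pr_not_good (m : nat) :
  Pr q rho (fun w : outcome n => ~~ good q rho B m w) <= 22 / B.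
Proof.
have B0 := B_gt0.
have b0 : first_adj blank = false by []. have b1 : second_adj blank = false by [].
have l1 := lab_first q rho; have l2 := lab_second q rho; have l12 := lab_both q rho.
have l21 : lab mu (fun x => (second_adj x && first_adj x)%:R) = (rho + (1 - rho) * q) * q.
  by rewrite -l12; under eq_fun do rewrite andbC.
have c1 := Pr_not_confined (@outside n) m.+1 b0 b0 one_in l1 l1 (lab_diag l1).
have c2 := Pr_not_confined (@outside n) m.+1 b1 b1 one_in l2 l2 (lab_diag l2).
have c3 := Pr_not_confined (fun s : state n => s.1.1) m b0 b1 rho_in l1 l2 l12.
have c4 := Pr_not_confined (fun s : state n => s.1.1) m b1 b0 rho_in l2 l1 l21.
rewrite Pr_PrE.
pose bad k (w : outcome n) := [|| ~~ regular first_adj first_adj q 1 (B ^+ (3 * k.+1)) k w,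
            ~~ regular second_adj second_adj q 1 (B ^+ (3 * k.+1)) k w |
            ~~ regular first_adj second_adj q rho (B ^+ (3 * k.+1)) k w].
have badk k : PrE mu (bad k) <= 9 * (B ^+ 2)^-1 ^+ k.+1.
  have -> : 9 * (B ^+ 2)^-1 ^+ k.+1 = 3 * (B ^+ 2)^-1 ^+ k.+1 +
    (3 * (B ^+ 2)^-1 ^+ k.+1 + 3 * (B ^+ 2)^-1 ^+ k.+1) by ring.
  apply: le_trans (PrE_or mu0 _ _) (lerD _ (le_trans (PrE_or mu0 _ _) (lerD _ _))).
  - exact: (Pr_not_regular k b0 b0 one_in l1 l1 (lab_diag l1)).
  - exact: (Pr_not_regular k b1 b1 one_in l2 l2 (lab_diag l2)).
  - exact: (Pr_not_regular k b0 b1 rho_in l1 l2 l12).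
have step1 : PrE mu (fun w : outcome n => [exists k : 'I_m.+2, bad k w]) <= 18 / B.
  apply: le_trans (PrE_exists mu0 _ _) _.
  apply: (@le_trans _ _ (\sum_(k < m.+2) 9 * (B ^+ 2)^-1 ^+ k.+1)); first exact: ler_sum.
  by rewrite -big_distrr /=; exact: sum_bound.
have -> : 22 / B = 18 / B + (B^-1 + (B^-1 + (B^-1 + B^-1))) by ring.
rewrite /good.
apply: (@le_trans _ _ (PrE mu (fun w : outcome n => [exists k : 'I_m.+2, bad k w] ||
   (~~ confined first_adj first_adj q B (@outside n) m.+1 w ||
   (~~ confined second_adj second_adj q B (@outside n) m.+1 w ||
   (~~ confined first_adj second_adj q B (fun s => s.1.1) m w ||
    ~~ confined second_adj first_adj q B (fun s => s.1.1) m w)))))).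
  apply: PrE_le => // w; rewrite !negb_and negb_forall.
  suff -> : [exists k : 'I_m.+2, ~~ [&& regular first_adj first_adj q 1 (B ^+ (3 * k.+1)) k w,
            regular second_adj second_adj q 1 (B ^+ (3 * k.+1)) k w &
            regular first_adj second_adj q rho (B ^+ (3 * k.+1)) k w]] =
            [exists k : 'I_m.+2, bad k w] by [].
  by apply: eq_existsb => k; rewrite /bad 2!negb_and.
apply: le_trans (PrE_or mu0 _ _) (lerD step1 _).
apply: le_trans (PrE_or mu0 _ _) (lerD c1 _).
apply: le_trans (PrE_or mu0 _ _) (lerD c2 _).
exact: le_trans (PrE_or mu0 _ _) (lerD c3 c4).
Qed.

End Good.

(** * Growth of the spheres *)

Lemma card_sum (R : realType) (T : finType) (A : {set T}) :
  #|A|%:R = \sum_a (a \in A)%:R :> R.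
Proof.
by rewrite -sum1_card natr_sum big_mkcond; apply: eq_bigr => a _; case: (a \in A).
Qed.

(** Inclusion-exclusion for the vertices entering the union of the balls: those entering both at
    once are counted twice, and those already in the other ball were not outside any more. *)
Lemma outside_step_set (R : realType) (n : nat) (B1 C1 B2 C2 : {set 'I_n}) :
  B1 \subset C1 -> B2 \subset C2 ->
  #|~: (B1 :|: B2)|%:R - #|~: (C1 :|: C2)|%:R =
  #|C1 :\: B1|%:R + #|C2 :\: B2|%:R - #|(C1 :\: B1) :&: (C2 :\: B2)|%:R
  - (#|(C1 :\: B1) :&: (C2 :\: (C2 :\: B2))| + #|(C2 :\: B2) :&: (C1 :\: (C1 :\: B1))|)%:R :> R.
Proof.
move=> /fintype.subsetP s1 /fintype.subsetP s2.
rewrite natrD !(card_sum R) -!sumrN -!big_split /= -!sumrN -!big_split /=.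
apply: eq_bigr => v _; rewrite !inE; move: (s1 v) (s2 v).
case: (v \in B1); case: (v \in B2).
- by move=> -> // -> //=; ring.
- by move=> -> // _; case: (v \in C2) => /=; ring.
- by move=> _ -> //; case: (v \in C1) => /=; ring.
- by move=> _ _; case: (v \in C1); case: (v \in C2) => /=; ring.
Qed.

Section Counts.
Context (R : realType) (n : nat) (f1 f2 : bool * bool * bool -> bool) (w : outcome n).
Notation S k := (explore f1 f2 k w).

Lemma outside_step k :
  #|outside (S k)|%:R - #|outside (S k.+1)|%:R =
  #|(S k.+1).1.1|%:R + #|(S k.+1).2.1|%:R - #|(S k.+1).1.1 :&: (S k.+1).2.1|%:R
  - (mixed (S k.+1))%:R :> R.
Proof.
exact: (outside_step_set R (gballS (graph_of f1 w) k) (gballS (graph_of f2 w) k)).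
Qed.

Lemma outside_ge k :
  n%:R - #|(S k).1.2|%:R - #|(S k).2.2|%:R <= #|outside (S k)|%:R :> R.
Proof.
have -> : n%:R = \sum_(v < n) 1 :> R by rewrite sumr_const card_ord.
rewrite !(card_sum R) -!sumrN -!big_split /=; apply: ler_sum => v _.
by rewrite in_outside; case: (_ \in _); case: (_ \in _) => /=; lra.
Qed.

Lemma outside_le k : #|outside (S k)|%:R <= n%:R :> R.
Proof. by rewrite ler_nat -[X in (_ <= X)%N]card_ord; exact: max_card. Qed.

Lemma mixedS_le k : (mixed (S k.+1))%:R <=
  #|gball (graph_of f1 w) k|%:R + #|gball (graph_of f2 w) k|%:R :> R.
Proof.
have aux (A C B : {set 'I_n}) : A :&: (C :\: (C :\: B)) \subset B.
  by apply/fintype.subsetP => v; rewrite !inE; case: (v \in B); case: (v \in C); rewrite ?andbF.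
rewrite -natrD ler_nat addnC; apply: leq_add; apply: subset_leq_card.
  exact: (aux _ (gball (graph_of f2 w) k.+1) (gball (graph_of f2 w) k)).
exact: (aux _ (gball (graph_of f1 w) k.+1) (gball (graph_of f1 w) k)).
Qed.

Lemma mixed_le k : (mixed (S k))%:R <= #|(S k).1.1|%:R + #|(S k).2.1|%:R :> R.
Proof.
rewrite -natrD ler_nat; apply: leq_add; apply: subset_leq_card; exact: finset.subsetIl.
Qed.

End Counts.

Section Step.
Context (R : realType) (n : nat) (f1 f2 : bool * bool * bool -> bool) (w : outcome n).
Context (q rho t : R) (k : nat).
Hypothesis q_in : 0 <= q <= 4^-1.
Hypothesis rho_in : 0 <= rho <= 1.
Hypothesis reg : regular f1 f2 q rho t k w.
Notation S k := (explore f1 f2 k w).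
Notation Q := (hazard q rho (S k)).

Lemma step_upper : #|outside (S k)|%:R - #|outside (S k.+1)|%:R <= n%:R * Q + t.
Proof.
have /andP[+ _] := reg; rewrite ler_distl => /andP[h _].
have Q0 := hazard_ge0 q_in rho_in (S k).
have p1 := survival_ge q_in rho_in (S k); have u0 := outside_le R f1 f2 w k.
set u : R := #|outside (S k)|%:R in h u0 *; set p := survival _ _ _ in h p1.
have uu : 0 <= u by rewrite ler0n.
have : u * (1 - p) <= n%:R * Q by apply: ler_pM => //; have /andP[] := survival_in q_in rho_in (S k); rewrite -/p; lra.
lra.
Qed.

(** Two second-order losses: the outside set lacks the vertices of both balls, and
    [1 - expR (- Q) >= Q - Q ^+ 2]. *)
Lemma step_lower :
  n%:R * Q - (#|(S k).1.2|%:R + #|(S k).2.2|%:R) * Q - n%:R * Q ^+ 2 - t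
    <= #|outside (S k)|%:R - #|outside (S k.+1)|%:R.
Proof.
have /andP[+ _] := reg; rewrite ler_distl => /andP[_ h].
have Q0 := hazard_ge0 q_in rho_in (S k).
have p1 := survival_le_exp q_in rho_in (S k); have u0 := outside_le R f1 f2 w k.
have u1 := outside_ge R f1 f2 w k.
set u : R := #|outside (S k)|%:R in h u0 u1 *; set p := survival _ _ _ in h p1.
set b : R := #|(S k).1.2|%:R in u1 *; set b' : R := #|(S k).2.2|%:R in u1 *.
have uu : 0 <= u by rewrite ler0n.
have e : expR (- Q) <= 1 - Q + Q ^+ 2.
  rewrite expRN invf_ple ?posrE ?expR_gt0 //; last by nra.
  apply: le_trans (expR_ge1Dx _).
  rewrite -[leLHS]mul1r ler_pdivrMr; last by nra.
  by have := exprn_ge0 3 Q0; lra.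
have m1 : u * (Q - Q ^+ 2) <= u * (1 - p) by apply: ler_wpM2l => //; lra.
have m2 : (n%:R - b - b') * Q <= u * Q by apply: ler_wpM2r.
have m3 : u * Q ^+ 2 <= n%:R * Q ^+ 2 by apply: ler_wpM2r => //; exact: sqr_ge0.
lra.
Qed.

End Step.

Lemma exp3S (R : realType) (B : R) (k : nat) : 0 < B ->
  B ^+ (3 * k.+1) = (B ^+ 4) ^+ k.+1 * B^-1 ^+ k.+1.
Proof.
move=> B0; rewrite -exprMn exprM; congr (_ ^+ _).
by rewrite [in RHS]exprSr mulfK // gt_eqF.
Qed.

(** Since [theta <= B ^+ 4], an error measured relatively to [(B ^+ 4) ^+ k] is not amplified by
    later steps, so the relative errors just add up. The first kind grows geometrically and is
    dominated by its last term, the second decays geometrically and is dominated by its first. *)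
Lemma perturbed_power (R : realType) (z : nat -> R) (theta B N K : R) (m : nat) :
  2 <= B -> 0 <= theta <= B ^+ 4 -> 0 < N -> 0 <= K -> z 0%N = 1 ->
  (forall k, (k < m)%N -> `|z k.+1 - theta * z k| <=
     K * ((B ^+ 4) ^+ (2 * k.+1) / N + B ^+ (3 * k.+1))) ->
  forall k, (k <= m)%N ->
    `|z k - theta ^+ k| <= K * ((B ^+ 4) ^+ k * (2 * (B ^+ 4) ^+ k / N + 2 / B)).
Proof.
move=> B2 /andP[th0 thD] N0 K0 z0 hz k km; have B0 : 0 < B by apply: lt_le_trans B2; rewrite ltr0n.
set D := B ^+ 4 in thD hz *.
have D2 : 2 <= D by rewrite /D; have := exprn_ege1 3 (le_trans _ B2); rewrite ler1n => /(_ isT); rewrite exprS; nra.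
have Bi0 : 0 < B^-1 by rewrite invr_gt0.
have Bi2 : B^-1 <= 2^-1 by rewrite lef_pV2 ?posrE.
have Ni0 : 0 < N^-1 by rewrite invr_gt0.
(* The subtracted term makes the induction close: for [B >= 2] its decrease from one step to the
   next, [2 B^-(k+1) - 2 B^-(k+2)], pays for the new error [B^-(k+1)]. *)
suff : `|z k - theta ^+ k| <= K * (D ^+ k * (2 * D ^+ k / N + 2 / B - 2 * B^-1 ^+ k.+1)).
  move=> h; apply: le_trans h _; apply: ler_wpM2l => //; apply: ler_wpM2l.
    by rewrite exprn_ge0 //; lra.
  by rewrite gerBl mulr_ge0 // exprn_ge0 // ltW.
elim: k km => [|k IH] km.
  rewrite z0 !expr0 subrr normr0 mulr_ge0 // expr1 mul1r mulr1 addrK.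
  by rewrite divr_ge0 // ltW.
have {}IH := IH (ltnW km); have h := hz k km.
rewrite exp3S // -/D in h.
have d0 : 0 <= D ^+ k by rewrite exprn_ge0 //; lra.
have e0 : 0 <= B^-1 ^+ k.+1 by rewrite exprn_ge0 // ltW.
rewrite (mulnC 2) exprM [D ^+ k.+1]exprS in h.
rewrite exprS (exprS D) (exprS B^-1 k.+1); move: IH h d0 e0.
set d := D ^+ k; set e := B^-1 ^+ k.+1; move=> IH h d0 e0.
have -> : z k.+1 - theta * theta ^+ k = (z k.+1 - theta * z k) + theta * (z k - theta ^+ k) by ring.
apply: le_trans (ler_normD _ _) _; rewrite normrM (ger0_norm th0).
have m1 : theta * `|z k - theta ^+ k| <= D * (K * (d * (2 * d / N + 2 / B - 2 * e))).
  by apply: ler_pM.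
apply: le_trans (lerD h m1) _.
rewrite -mulrA [D * (K * _)]mulrCA -mulrDr; apply: ler_wpM2l => //.
have -> : (D * d) ^+ 2 / N + D * (d * e) + D * (d * (2 * d / N + 2 / B - 2 * e)) =
  (D * d) * ((D * d / N) + 2 * d / N + 2 / B - e) by ring.
rewrite mulrA; apply: ler_wpM2l; first by rewrite mulr_ge0 //; lra.
have p1 : B^-1 * e <= 2^-1 * e by apply: ler_wpM2r.
have p2 : 2 * (d / N) <= D * (d / N) by apply: ler_wpM2r => //; rewrite mulr_ge0 // ltW.
lra.
Qed.

Section Growth.
Context (R : realType) (n : nat) (w : outcome n) (q B : R) (m : nat).
Hypothesis n_gt0 : (0 < n)%N.
Hypothesis q_in : 0 <= q <= 4^-1.
Hypothesis qn : n%:R * q = B ^+ 4.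
Hypothesis B_ge2 : 2 <= B.
Notation D := (B ^+ 4).

Let B_gt0 : 0 < B. Proof. by apply: lt_le_trans B_ge2; rewrite ltr0n. Qed.
Let D_ge2 : 2 <= D.
Proof.
have := exprn_ege1 3 (le_trans _ B_ge2); rewrite ler1n => /(_ isT) h.
by rewrite exprS -[leLHS]mulr1; apply: ler_pM => //; rewrite ltW.
Qed.
Let n0 : 0 < n%:R :> R. Proof. by rewrite ltr0n. Qed.
Let qE : q = D / n%:R. Proof. by rewrite -qn mulrAC divff ?mul1r // gt_eqF. Qed.

Lemma card_ball0 (G : graph n) : #|gball G 0| = 1%N.
Proof.
rewrite (_ : gball G 0 = [set Ordinal n_gt0]) ?cards1 //.
by apply/setP => v; rewrite !inE; apply/eqP/eqP => [v0|->//]; apply: val_inj.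
Qed.

Section OneGraph.
Context (f : bool * bool * bool -> bool).
Hypothesis reg : forall k, (k <= m.+1)%N -> regular f f q 1 (B ^+ (3 * k.+1)) k w.
Notation a k := (#|gsphere (graph_of f w) k|%:R : R).
Notation b k := (#|gball (graph_of f w) k|%:R : R).

Let one_in : 0 <= (1 : R) <= 1. Proof. by rewrite ler01 lexx. Qed.

Lemma hazard_diag k : hazard q 1 (explore f f k w) = q * a k.
Proof. by rewrite hazardE // mixed_diag /= finset.setIid; ring. Qed.

Lemma outside_diag_step k :
  #|outside (explore f f k w)|%:R - #|outside (explore f f k.+1 w)|%:R = a k.+1.
Proof. by rewrite outside_step mixed_diag /= finset.setIid; ring. Qed.

Lemma growth_upper k : (k <= m.+1)%N -> a k.+1 <= D * a k + B ^+ (3 * k.+1).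
Proof.
move=> km; have := step_upper q_in one_in (reg km).
by rewrite hazard_diag outside_diag_step mulrA qn.
Qed.

Lemma growth_bound k : (k <= m.+2)%N -> a k <= 2 * D ^+ k /\ b k <= 4 * D ^+ k.
Proof.
(* The slack [B^-k] in the factor shrinks at each step by at least the new relative fluctuation
   [B^-(k+1)], because [B >= 2]. *)
move=> km; suff [h1 h2] : a k <= D ^+ k * (2 - B^-1 ^+ k) /\ b k <= 4 * D ^+ k.
  split => //; apply: le_trans h1 _; rewrite mulrC; apply: ler_wpM2r.
    by rewrite exprn_ge0 // exprn_ge0 // ltW.
  by rewrite gerBl exprn_ge0 // invr_ge0 ltW.
elim: k km => [|k IH] km.
  by rewrite [gsphere _ _]/= card_ball0 !expr0; split; lra.
have [ha hb] := IH (ltnW km); have hu := growth_upper (km : (k <= m.+1)%N).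
have Di : 0 <= D ^+ k by rewrite exprn_ge0 //; apply: le_trans D_ge2; rewrite ler0n.
have e0 : 0 <= B^-1 ^+ k by rewrite exprn_ge0 // invr_ge0 ltW.
have Bi : B^-1 <= 2^-1 by rewrite lef_pV2 ?posrE.
have hh : a k.+1 <= D ^+ k.+1 * (2 - B^-1 ^+ k.+1).
  apply: le_trans hu _; rewrite exp3S // (exprS D) (exprS B^-1).
  have D0 : 0 <= D by apply: le_trans D_ge2; rewrite ler0n.
  move: ha D0 Di e0; set d := D ^+ k; set e := B^-1 ^+ k; move=> ha D0 Di e0.
  have s1 : D * a k <= D * (d * (2 - e)) by apply: ler_wpM2l.
  have s2 : D * d * (B^-1 * e) <= D * d * (2^-1 * e).
    by apply: ler_wpM2l; [exact: mulr_ge0|apply: ler_wpM2r].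
  lra.
split => //; rewrite sphereS_card natrD.
have a2 : a k.+1 <= 2 * D ^+ k.+1.
  apply: le_trans hh _; rewrite mulrC; apply: ler_wpM2r; first by rewrite exprn_ge0 // exprn_ge0 // ltW.
  by rewrite gerBl exprn_ge0 // invr_ge0 ltW.
have s3 : 2 * D ^+ k <= D ^+ k.+1 by rewrite (exprS D); apply: ler_wpM2r.
lra.
Qed.

(** In the constant 20, 16 comes from the vertices already in the ball, which is counted twice as
    the graph is paired with itself, and 4 from the quadratic term in the hazard. *)
Lemma growth_step k : (k <= m.+1)%N ->
  `|a k.+1 - D * a k| <= 20 * (D ^+ (2 * k.+1) / n%:R) + B ^+ (3 * k.+1).
Proof.
move=> km; have [ha hb] := growth_bound (leqW km).
have := step_lower q_in one_in (reg km); rewrite hazard_diag outside_diag_step mulrA qn /=.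
have := growth_upper km; rewrite ler_distl.
have D0 : 0 <= D by apply: le_trans D_ge2; rewrite ler0n.
have a0 : 0 <= a k by rewrite ler0n.
have b0 : 0 <= b k by rewrite ler0n.
have Dk : D ^+ (2 * k.+1) = (D * D ^+ k) ^+ 2 by rewrite -exprS mulnC exprM.
rewrite Dk; set d := D ^+ k in ha hb *; set t := B ^+ (3 * k.+1) => hu hl.
have d0 : 0 <= d by rewrite exprn_ge0.
have q0 : 0 <= q by have /andP[] := q_in.
have s1 : (b k + b k) * (q * a k) <= 16 * (D * d ^+ 2 / n%:R).
  rewrite (_ : 16 * _ = (4 * d + 4 * d) * (q * (2 * d))); last by rewrite qE; ring.
  by apply: ler_pM; rewrite ?addr_ge0 ?mulr_ge0 ?lerD ?ler_wpM2l.
have s2 : n%:R * (q * a k) ^+ 2 <= 4 * ((D * d) ^+ 2 / n%:R).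
  rewrite (_ : 4 * _ = n%:R * (q * (2 * d)) ^+ 2).
    apply: ler_wpM2l => //; rewrite ler_pXn2r ?nnegrE ?mulr_ge0 ?ler_wpM2l //.
  by rewrite qE; field; rewrite gt_eqF.
have s3 : D * d ^+ 2 / n%:R <= (D * d) ^+ 2 / n%:R.
  apply: ler_wpM2r; first by rewrite invr_ge0 ltW.
  rewrite exprMn; apply: ler_wpM2r; first exact: sqr_ge0.
  by rewrite expr2 ler_peMr // (le_trans _ D_ge2) // ler1n.
have x0 : 0 <= (D * d) ^+ 2 / n%:R by rewrite divr_ge0 ?sqr_ge0 // ltW.
apply/andP; split; last by apply: le_trans hu _; rewrite lerD2l lerDr mulr_ge0.
move: hl s1 s2 s3; set x := (D * d) ^+ 2 / n%:R; set y := D * d ^+ 2 / n%:R.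
move: (_ * (q * a k)) (_ * (q * a k) ^+ 2) => z1 z2; lra.
Qed.

Lemma growth_mean k : (k <= m.+2)%N ->
  `|a k - D ^+ k| <= 20 * (D ^+ k * (2 * D ^+ k / n%:R + 2 / B)).
Proof.
move=> km; apply: (@perturbed_power _ (fun k => a k) D B n%:R 20 m.+2) => //.
- by rewrite exprn_ge0 ?lexx // ltW.
- by rewrite -[LHS]/(#|gball (graph_of f w) 0|%:R) card_ball0.
move=> j jm; apply: le_trans (growth_step jm) _; rewrite mulrDr lerD2l.
by rewrite ler_peMl // ?ler1n // exprn_ge0 // ltW.
Qed.

Lemma layer_edges_reg k : (k <= m.+1)%N ->
  `|#|layer_edges (graph_of f w) k|%:R - a k * #|outside (explore f f k w)|%:R * q|
    <= B ^+ (3 * k.+1).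
Proof.
move=> km; have /andP[_] := reg km; rewrite /common_edges finset.setIid /= finset.setIid.
by rewrite (_ : (1 + (1 - 1) * q) * q = q) //; ring.
Qed.

(** Layer [k] has at most [2 D^(k+1)] edges up to a deviation of at most [D^(k+1)]; as [D >= 2], the
    sum is at most twice its last term. *)
Lemma low_layers : \sum_(k < m) #|layer_edges (graph_of f w) k|%:R <= 6 * D ^+ m.
Proof.
have q0 : 0 <= q by have /andP[] := q_in.
have D0 : 0 <= D by apply: le_trans D_ge2; rewrite ler0n.
have lk k : (k < m)%N -> #|layer_edges (graph_of f w) k|%:R <= 3 * D ^+ k.+1.
  move=> km; have km1 : (k <= m.+1)%N by rewrite ltnW // ltnW.
  have := layer_edges_reg km1; rewrite ler_distl => /andP[_ h]; apply: le_trans h _.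
  have [ha _] := growth_bound (leqW km1).
  have s1 : a k * #|outside (explore f f k w)|%:R * q <= 2 * D ^+ k.+1.
    rewrite (exprS D) -qn mulrC [leRHS](_ : _ = q * (2 * (n%:R * q) ^+ k * n%:R)); last by ring.
    apply: ler_wpM2l => //; apply: ler_pM => //; first by rewrite qn.
    exact: outside_le.
  have s2 : B ^+ (3 * k.+1) <= D ^+ k.+1.
    rewrite exp3S //; apply: ler_piMr; first exact: exprn_ge0.
    apply: exprn_ile1; first by rewrite invr_ge0 ltW.
    by rewrite invf_le1 // (le_trans _ B_ge2) // ler1n.
  by move: s1 s2; move: (_ * q) => z; lra.
have {lk} : forall j, (j <= m)%N ->
    \sum_(k < j) #|layer_edges (graph_of f w) k|%:R <= 6 * D ^+ j.
  elim=> [|j IH] jm; first by rewrite big_ord0 mulr_ge0.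
  rewrite big_ord_recr /=; have := IH (ltnW jm); have := lk j jm.
  have : 2 * D ^+ j <= D ^+ j.+1 by rewrite (exprS D); apply: ler_wpM2r => //; rewrite exprn_ge0.
  move: (\sum_(k < j) _) => z; lra.
by apply.
Qed.

End OneGraph.

Section TwoGraphs.
Context (f1 f2 : bool * bool * bool -> bool) (rho : R).
Hypothesis rho_in : 0 <= rho <= 1.
Hypothesis reg1 : forall k, (k <= m.+1)%N -> regular f1 f1 q 1 (B ^+ (3 * k.+1)) k w.
Hypothesis reg2 : forall k, (k <= m.+1)%N -> regular f2 f2 q 1 (B ^+ (3 * k.+1)) k w.
Hypothesis reg12 : forall k, (k <= m.+1)%N -> regular f1 f2 q rho (B ^+ (3 * k.+1)) k w.
Notation S k := (explore f1 f2 k w).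
Notation a1 k := (#|gsphere (graph_of f1 w) k|%:R : R).
Notation a2 k := (#|gsphere (graph_of f2 w) k|%:R : R).
Notation i k := (#|gsphere (graph_of f1 w) k :&: gsphere (graph_of f2 w) k|%:R : R).
Notation r k := ((mixed (S k))%:R : R).
Notation rho' := (rho + (1 - rho) * q).

(** In the hazard, the common vertices weigh [rho'] and the mixed ones [rho]. The two weights differ
    by [(1 - rho) * q] only, so a single variable, their sum, carries the main part. *)
Lemma hazard_pair k : hazard q rho (S k) =
  q * (a1 k + a2 k - rho' * (i k + r k)) + (1 - rho) * q * (q * r k).
Proof. by rewrite hazardE //=; ring. Qed.

(* The number i + r of vertices that enter the intersection of the two balls
   satisfies a closed recursion, although i alone does not. *)
Lemma common_step k : (k <= m.+1)%N ->
  `|(i k.+1 + r k.+1) - D * rho' * (i k + r k)|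
    <= 100 * (D ^+ (2 * k.+1) / n%:R + B ^+ (3 * k.+1)).
Proof.
move=> km; have [ha1 hb1] := growth_bound reg1 (leqW km).
have [ha2 hb2] := growth_bound reg2 (leqW km).
have q0 : 0 <= q by have /andP[] := q_in.
have [r0 r1] := andP rho_in.
have D0 : 0 <= D by apply: le_trans D_ge2; rewrite ler0n.
have := growth_step reg1 km; have := growth_step reg2 km.
have := step_upper q_in rho_in (reg12 km); have := step_lower q_in rho_in (reg12 km).
rewrite outside_step [(S k).1.2]/= [(S k).2.2]/=.
rewrite -[(S k.+1).1.1]/(gsphere (graph_of f1 w) k.+1) -[(S k.+1).2.1]/(gsphere (graph_of f2 w) k.+1).
have Q0 := hazard_ge0 q_in rho_in (S k).
have HQ := hazard_pair k; have mx : r k <= a1 k + a2 k := mixed_le R f1 f2 w k.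
have mx0 : 0 <= r k by rewrite ler0n.
have Dk : D ^+ (2 * k.+1) = (D * D ^+ k) ^+ 2 by rewrite -exprS mulnC exprM.
rewrite Dk; set Q := hazard q rho (S k) in Q0 HQ *; set d := D ^+ k in ha1 hb1 ha2 hb2 *.
have d1 : 1 <= d by rewrite exprn_ege1 // (le_trans _ D_ge2) // ler1n.
have i0 : 0 <= i k by rewrite ler0n.
have QQ : Q <= 4 * (q * d).
  rewrite HQ; have t1 : 0 <= q * (rho' * i k).
    by rewrite !mulr_ge0 ?addr_ge0 ?mulr_ge0 //; lra.
  have t2 : 0 <= q * (rho * r k) by rewrite !mulr_ge0.
  have t3 : q * (a1 k + a2 k) <= q * (4 * d) by apply: ler_wpM2l => //; lra.
  by move: t1 t2 t3; lra.
set X := (D * d) ^+ 2 / n%:R; set t := B ^+ (3 * k.+1).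
have X0 : 0 <= X by rewrite divr_ge0 ?sqr_ge0 // ltW.
have t0 : 0 <= t by rewrite exprn_ge0 // ltW.
have q4d : 4 * (q * d) = 4 * (D * d / n%:R) by rewrite qE; ring.
have s3 : D * d ^+ 2 / n%:R <= X.
  apply: ler_wpM2r; first by rewrite invr_ge0 ltW.
  rewrite exprMn; apply: ler_wpM2r; first exact: sqr_ge0.
  by rewrite expr2 ler_peMr // (le_trans _ D_ge2) // ler1n.
have s1 : (#|gball (graph_of f1 w) k|%:R + #|gball (graph_of f2 w) k|%:R) * Q
    <= 32 * X.
  apply: (@le_trans _ _ (32 * (D * d ^+ 2 / n%:R))); last by apply: ler_wpM2l.
  rewrite (_ : 32 * _ = (4 * d + 4 * d) * (4 * (q * d))); last by rewrite qE; ring.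
  by apply: ler_pM; rewrite ?addr_ge0 ?lerD.
have s2 : n%:R * Q ^+ 2 <= 16 * X.
  rewrite (_ : 16 * X = n%:R * (4 * (q * d)) ^+ 2).
    by apply: ler_wpM2l => //; rewrite ler_pXn2r ?nnegrE // (le_trans Q0).
  by rewrite /X qE; field; rewrite gt_eqF.
have s4 : 0 <= n%:R * ((1 - rho) * q * (q * r k)) <= 4 * X.
  rewrite !mulr_ge0 //=; last by lra.
  apply: (@le_trans _ _ (n%:R * (1 * q * (q * (4 * d))))).
    apply: ler_wpM2l => //; apply: ler_pM; rewrite ?mulr_ge0 //; first by lra.
      by apply: ler_wpM2r => //; lra.
    by apply: ler_wpM2l => //; lra.
  rewrite (_ : _ * _ = 4 * (D * D * d / n%:R)); last by rewrite qE; field; rewrite gt_eqF.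
  apply: ler_wpM2l => //; apply: ler_wpM2r; first by rewrite invr_ge0 ltW.
  rewrite exprMn -expr2; apply: ler_wpM2l; first exact: sqr_ge0.
  by rewrite expr2 ler_peMr //; lra.
have nQ : n%:R * Q = D * (a1 k + a2 k) - D * rho' * (i k + r k)
    + n%:R * ((1 - rho) * q * (q * r k)) by rewrite HQ mulrDr mulrA qn; ring.
move: nQ s1 s2 s4; rewrite -mulrA => ->.
move: (n%:R * (_ * _)) (n%:R * _ ^+ 2) (_ * Q) => z1 z2 z3 h3 h2 /andP[z10 z11].
(* The deviations add up to [88 X + 3 t] on one side (32 + 16 from this step, 20 from each sphere)
   and to [44 X + 3 t] on the other. *)
rewrite !ler_distl => hl hu /andP[g1 g2] /andP[g3 g4].
by apply/andP; split; move: hl hu g1 g2 g3 g4 => /=; lra.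
Qed.

Lemma common_mean k : (k <= m.+2)%N ->
  `|(i k + r k) - (D * rho') ^+ k| <= 100 * (D ^+ k * (2 * D ^+ k / n%:R + 2 / B)).
Proof.
have [q0 q1] := andP q_in; have [r0 r1] := andP rho_in.
have D0 : 0 <= D by apply: le_trans D_ge2; rewrite ler0n.
move=> km; apply: (@perturbed_power _ (fun k => i k + r k) (D * rho') B n%:R 100 m.+2) => //.
- have c0 : 0 <= rho' by rewrite addr_ge0 // mulr_ge0 //; lra.
  rewrite mulr_ge0 //= ler_piMr //.
  have : (1 - rho) * q <= (1 - rho) * 1 by apply: ler_wpM2l; lra.
  by lra.
- rewrite -[gsphere _ 0]/(gball (graph_of f1 w) 0) -[gsphere (graph_of f2 w) 0]/(gball (graph_of f1 w) 0).
  rewrite finset.setIid card_ball0 /mixed /= !finset.setDv !finset.setI0 cards0.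
  by rewrite addr0.
by move=> j jm; apply: common_step.
Qed.

End TwoGraphs.
End Growth.

(* Sizes divided by n, except s = q |sphere m|; u and U are the numbers of vertices
   outside of the balls of radii m and m+1, e and E the edges leaving the spheres m
   and m+1, T the edges of the DAG, and x stands for (n q)^(m+1) / n. *)
Record single_estimates (R : realType) (D B x q tau tau' s u U p e E T tl : R) : Prop := {
  se_s : `|s - x| <= 40 * x * (x / D + 1 / B);
  se_u : 1 - 8 * (x / D) <= u <= 1;
  se_U : `|U - u * p| <= tau;
  se_U0 : 0 <= U <= u;
  se_p : expR (- ((1 + 4 * q) * s)) <= p <= expR (- s);
  se_e : `|e - s * u| <= tau;
  se_E : `|E - (u - U) * U * D| <= tau';
  se_T : e + E <= T <= e + E + (6 * (x / D) + tl);
  se_tl : 0 <= tl <= B * ((U + tau) * D * expR (- (D * (u - U) - q))) }.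

(* Here y and Y count the vertices outside of both balls, c = q |common part of the
   spheres m|, I is the size of the common part of the spheres m+1. *)
Record pair_estimates (R : realType) (D B x q rho rhom tau tau' s1 s2 A1 A2 U1
    c y Y p Q I e E T tl1 tl2 cr1 cr2 : R) : Prop := {
  pe_Q : `|Q - x * (2 - rho * rhom)| <= 280 * x * (x / D + 1 / B) + 4 * (q * x);
  pe_c : `|c - x * rhom| <= 200 * x * (x / D + 1 / B) + 8 * (x / D);
  pe_y : 1 - 8 * (x / D) <= y <= 1;
  pe_Y : `|Y - y * p| <= tau;
  pe_Y0 : 0 <= Y <= U1;
  pe_p : expR (- ((1 + 4 * q) * Q)) <= p <= expR (- Q);
  pe_I : `|I - (A1 + A2 - (y - Y))| <= 8 * (x / D);
  pe_I0 : 0 <= I <= 1;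
  pe_e : `|e - c * y * rho| <= tau;
  pe_E : `|E - I * Y * rho * D| <= tau';
  pe_T : e + E <= T <= e + E + (12 * (x / D) + tl1 + tl2 + cr1 + cr2);
  pe_cr1 : 0 <= cr1 <= B * ((s1 + q) * expR (- (s2 - 8 * (x / D) - q)));
  pe_cr2 : 0 <= cr2 <= B * ((s2 + q) * expR (- (s1 - 8 * (x / D) - q))) }.

(** * Deterministic estimates for the outcomes of the good event *)

Section Bridge.
Context (R : realType) (n : nat) (w : outcome n) (q B : R) (m : nat).
Hypothesis n_gt0 : (0 < n)%N.
Hypothesis m_gt0 : (0 < m)%N.
Hypothesis q_in : 0 <= q <= 4^-1.
Hypothesis qn : n%:R * q = B ^+ 4.
Hypothesis B_ge2 : 2 <= B.
Notation D := (B ^+ 4).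
Notation N := (n%:R : R).
Notation x := (D ^+ m.+1 / N).
Notation tau := (B ^+ (3 * m.+1) / N).
Notation tau' := (B ^+ (3 * m.+2) / N).

Let B_gt0 : 0 < B. Proof. by apply: lt_le_trans B_ge2; rewrite ltr0n. Qed.
Let D_gt0 : 0 < D. Proof. by rewrite exprn_gt0. Qed.
Let N_gt0 : 0 < N. Proof. by rewrite ltr0n. Qed.
Let q_ge0 : 0 <= q. Proof. by have /andP[] := q_in. Qed.
Let qE : q = D / N. Proof. by rewrite -qn mulrAC divff ?mul1r // gt_eqF. Qed.
Let Ni : 0 <= N^-1. Proof. by rewrite invr_ge0 ltW. Qed.
Let one_in : 0 <= (1 : R) <= 1. Proof. by rewrite ler01 lexx. Qed.
Let xE : x = q * D ^+ m. Proof. by rewrite qE exprS; ring. Qed.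
Let xD : x / D = D ^+ m / N.
Proof.
have aux (d e N' : R) : d != 0 -> d * e / N' / d = e / N'.
  by move=> d0; rewrite [d * e]mulrC mulrAC mulfK.
by rewrite (exprS D) aux // gt_eqF.
Qed.
Let tauN : N^-1 <= tau.
Proof.
rewrite -[leLHS]mul1r; apply: ler_wpM2r => //; apply: exprn_ege1.
by apply: le_trans B_ge2; rewrite ler1n.
Qed.

Let div_norm (a b c : R) : `|a - b| <= c -> `|a / N - b / N| <= c / N.
Proof. by move=> h; rewrite -mulrBl normrM (ger0_norm Ni) ler_wpM2r. Qed.

Section Single.
Context (f : bool * bool * bool -> bool).
Hypothesis reg : forall k, (k <= m.+1)%N -> regular f f q 1 (B ^+ (3 * k.+1)) k w.
Hypothesis conf : confined f f q B (@outside n) m.+1 w.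
Notation G := (graph_of f w).
Notation S k := (explore f f k w).

Lemma single_estimates_good :
  single_estimates D B x q tau tau' (q * #|gsphere G m|%:R)
    (#|outside (S m)|%:R / N) (#|outside (S m.+1)|%:R / N) (survival q 1 (S m))
    (#|layer_edges G m|%:R / N) (#|layer_edges G m.+1|%:R / N) (#|SPD G|%:R / N)
    (#|escape (~: gball G m.+1) G G m.+1|%:R / N).
Proof.
have AE : #|outside (S m)|%:R / N - #|outside (S m.+1)|%:R / N = #|gsphere G m.+1|%:R / N.
  by rewrite -mulrBl outside_diag_step.
split.
- rewrite xE -mulrBr normrM (ger0_norm q_ge0).
  have := growth_mean n_gt0 q_in qn B_ge2 reg (leqW (leqnSn m)).
  move=> /(ler_wpM2l q_ge0) /le_trans; apply; rewrite -xE xD xE.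
  by rewrite le_eqVlt; apply/orP; left; apply/eqP; ring.
- have [_ hb] := growth_bound n_gt0 q_in qn B_ge2 reg (leqW (leqnSn m)).
  have h1 := outside_ge R f f w m; have h2 := outside_le R f f w m.
  rewrite ler_pdivlMr // ler_pdivrMr // mul1r h2 andbT xD; apply: le_trans h1 => /=.
  by rewrite mulrBl mul1r -mulrA divfK ?gt_eqF //; lra.
- by rewrite mulrAC; apply: div_norm; have /andP[] := reg (leqnSn m).
- rewrite divr_ge0 // ?ler0n //= ler_wpM2r // -subr_ge0 outside_diag_step //.
- have h1 := survival_ge_exp q_in one_in (S m); have h2 := survival_le_exp q_in one_in (S m).
  by rewrite hazard_diag in h1 h2; rewrite h1 h2.
- rewrite (_ : q * _ * _ = #|gsphere G m|%:R * #|outside (S m)|%:R * q / N); last by ring.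
  by apply: div_norm; exact: (layer_edges_reg reg (leqnSn m)).
- rewrite AE (_ : _ * D = #|gsphere G m.+1|%:R * #|outside (S m.+1)|%:R * q / N); last first.
    by rewrite qE; ring.
  by apply: div_norm; exact: (layer_edges_reg reg (leqnn m.+1)).
- apply/andP; split; first by rewrite -mulrDl ler_wpM2r // -natrD ler_nat card_SPD_ge.
  rewrite xD mulrA -!mulrDl; apply: ler_wpM2r => //.
  have := card_SPD_le G m; rewrite -(ler_nat R) !natrD natr_sum => /le_trans; apply.
  by rewrite lerD2l lerD2r; exact: (low_layers n_gt0 q_in qn B_ge2 reg).
- rewrite divr_ge0 ?ler0n //=; have oE : outside (S m.+1) = ~: gball G m.+1.
    by apply/setP => v; rewrite in_outside finset.in_setC andbb.
  move: conf; rewrite /confined mixed_diag subr0 -{1}oE => h.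
  rewrite ler_pdivrMr //; apply: le_trans h _; rewrite -[leRHS]mulrA; apply: ler_wpM2l; first by rewrite ltW.
  rewrite AE -(mulrA (_ + 1)) qn (_ : D * (_ / N) - q = q * (#|gsphere G m.+1|%:R - 1)); last first.
    by rewrite qE; ring.
  rewrite [leRHS]mulrAC; apply: ler_wpM2r; first exact: expR_ge0.
  rewrite [leRHS]mulrAC; apply: ler_wpM2r; first by rewrite ltW.
  rewrite mulrDl divfK ?gt_eqF // lerD2l -[leLHS](mulVf (lt0r_neq0 N_gt0)).
  by apply: ler_wpM2r => //; rewrite ltW.
Qed.

End Single.

Section Pair.
Context (f1 f2 : bool * bool * bool -> bool) (rho : R).
Hypothesis rho_in : 0 <= rho <= 1.
Hypothesis reg1 : forall k, (k <= m.+1)%N -> regular f1 f1 q 1 (B ^+ (3 * k.+1)) k w.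
Hypothesis reg2 : forall k, (k <= m.+1)%N -> regular f2 f2 q 1 (B ^+ (3 * k.+1)) k w.
Hypothesis reg12 : forall k, (k <= m.+1)%N -> regular f1 f2 q rho (B ^+ (3 * k.+1)) k w.
Hypothesis conf12 : confined f1 f2 q B (fun s => s.1.1) m w.
Hypothesis conf21 : confined f2 f1 q B (fun s => s.1.1) m w.
Notation H1 := (graph_of f1 w).
Notation H2 := (graph_of f2 w).
Notation S k := (explore f1 f2 k w).
Notation S1 k := (explore f1 f1 k w).
Notation S2 k := (explore f2 f2 k w).
Notation rho' := (rho + (1 - rho) * q).
Notation r := ((mixed (S m))%:R : R).

Let mixedC k : mixed (explore f2 f1 k w) = mixed (S k).
Proof. by rewrite /mixed addnC. Qed.

(** Mixed vertices of step [m] lie in a ball of radius [m - 1], which exists as [0 < m] and is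
    smaller than the spheres of radius [m] by a factor of order [D]. *)
Let mixed_small : q * r <= 8 * (x / D).
Proof.
rewrite xD; case: m m_gt0 reg1 reg2 => // j _ r1 r2.
have [_ b1] := growth_bound n_gt0 q_in qn B_ge2 r1 (leqW (leqW (leqnSn j))).
have [_ b2] := growth_bound n_gt0 q_in qn B_ge2 r2 (leqW (leqW (leqnSn j))).
have := mixedS_le R f1 f2 w j; have jk : q * D ^+ j = D ^+ j.+1 / N by rewrite qE (exprS D); ring.
move=> /le_trans /(_ (lerD b1 b2)) /(ler_wpM2l q_ge0) /le_trans; apply.
by rewrite -jk le_eqVlt; apply/orP; left; apply/eqP; ring.
Qed.

Let cross_bound (g1 g2 : bool * bool * bool -> bool) :
  mixed (explore g1 g2 m w) = mixed (S m) ->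
  confined g1 g2 q B (fun s => s.1.1) m w ->
  0 <= #|escape (gsphere (graph_of g1 w) m) (graph_of g1 w) (graph_of g2 w) m|%:R / N
  <= B * ((q * #|gsphere (graph_of g1 w) m|%:R + q)
       * expR (- (q * #|gsphere (graph_of g2 w) m|%:R - 8 * (x / D) - q))).
Proof.
move=> mE; rewrite /confined mE -[(explore g1 g2 m w).1.1]/(gsphere (graph_of g1 w) m).
rewrite -[(explore g1 g2 m w).2.1]/(gsphere (graph_of g2 w) m).
set a1 : R := #|gsphere (graph_of g1 w) m|%:R; set a2 : R := #|gsphere (graph_of g2 w) m|%:R.
move=> h; rewrite divr_ge0 ?ler0n //= ler_pdivrMr //; apply: le_trans h _.
rewrite -[leRHS]mulrA; apply: ler_wpM2l; first by rewrite ltW.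
rewrite [leRHS](_ : _ = (a1 + 1) * N * q * expR (- (q * a2 - 8 * (x / D) - q))); last by ring.
apply: ler_wpM2l; first by rewrite !mulr_ge0 ?addr_ge0 ?ler0n.
rewrite ler_expR lerN2 !mulrBr mulr1; have := mixed_small.
by move: (q * r) (x / D) => z1 z2; lra.
Qed.

Lemma pair_estimates_good :
  pair_estimates D B x q rho' (rho' ^+ m) tau tau'
    (q * #|gsphere H1 m|%:R) (q * #|gsphere H2 m|%:R)
    (#|outside (S1 m)|%:R / N - #|outside (S1 m.+1)|%:R / N)
    (#|outside (S2 m)|%:R / N - #|outside (S2 m.+1)|%:R / N)
    (#|outside (S1 m.+1)|%:R / N)
    (q * #|gsphere H1 m :&: gsphere H2 m|%:R)
    (#|outside (S m)|%:R / N) (#|outside (S m.+1)|%:R / N)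
    (survival q rho (S m)) (hazard q rho (S m))
    (#|gsphere H1 m.+1 :&: gsphere H2 m.+1|%:R / N)
    (#|layer_edges H1 m :&: layer_edges H2 m|%:R / N)
    (#|layer_edges H1 m.+1 :&: layer_edges H2 m.+1|%:R / N)
    (#|SPD H1 :&: SPD H2|%:R / N)
    (#|escape (~: gball H1 m.+1) H1 H1 m.+1|%:R / N)
    (#|escape (~: gball H2 m.+1) H2 H2 m.+1|%:R / N)
    (#|escape (gsphere H1 m) H1 H2 m|%:R / N)
    (#|escape (gsphere H2 m) H2 H1 m|%:R / N).
Proof.
have [r0 r1] := andP rho_in.
have m2 : (m <= m.+2)%N := leqW (leqnSn m).
have [a1 b1] := growth_bound n_gt0 q_in qn B_ge2 reg1 m2.
have [a2 b2] := growth_bound n_gt0 q_in qn B_ge2 reg2 m2.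
have rp0 : 0 <= rho' by rewrite addr_ge0 // mulr_ge0 //; lra.
have rp1 : rho' <= 1.
  have : (1 - rho) * q <= (1 - rho) * 1 by apply: ler_wpM2l; have /andP[] := q_in; lra.
  by lra.
have x0 : 0 <= x by rewrite divr_ge0 ?exprn_ge0 // ltW.
pose eps := x / D + 1 / B.
have sp f (reg : forall k, (k <= m.+1)%N -> regular f f q 1 (B ^+ (3 * k.+1)) k w) :
    `|q * #|gsphere (graph_of f w) m|%:R - x| <= 40 * x * eps.
  rewrite /eps xE -mulrBr normrM (ger0_norm q_ge0).
  have := growth_mean n_gt0 q_in qn B_ge2 reg m2.
  move=> /(ler_wpM2l q_ge0) /le_trans; apply; rewrite -xE xD xE.
  by rewrite le_eqVlt; apply/orP; left; apply/eqP; ring.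
have cm : `|q * (#|gsphere H1 m :&: gsphere H2 m|%:R + r) - x * rho' ^+ m| <= 200 * x * eps.
  rewrite /eps xE -mulrA -exprMn -mulrBr normrM (ger0_norm q_ge0).
  have := common_mean n_gt0 q_in qn B_ge2 rho_in reg1 reg2 reg12 m2.
  move=> /(ler_wpM2l q_ge0) /le_trans; apply; rewrite -xE xD xE.
  by rewrite le_eqVlt; apply/orP; left; apply/eqP; ring.
have mx0 : 0 <= q * r by rewrite mulr_ge0.
have rq : q * r <= 4 * x.
  have := mixed_le R f1 f2 w m => /le_trans /(_ (lerD a1 a2)) /(ler_wpM2l q_ge0) /le_trans; apply.
  by rewrite xE le_eqVlt; apply/orP; left; apply/eqP; ring.
split.
- have := sp _ reg1; have := sp _ reg2; rewrite hazard_pair -/eps.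
  set z1 := q * #|gsphere H1 m|%:R; set z2 := q * #|gsphere H2 m|%:R.
  move=> h2 h1; set C := q * (_ + r) in cm *.
  have t1 : `|rho' * (C - x * rho' ^+ m)| <= 200 * x * eps.
    rewrite normrM (ger0_norm rp0); apply: le_trans cm; exact: ler_piMl.
  have t2 : 0 <= (1 - rho) * q * (q * r) <= 4 * (q * x).
    rewrite !mulr_ge0 //=; last by lra.
    rewrite (_ : 4 * _ = 1 * q * (4 * x)); last by ring.
    by apply: ler_pM => //; rewrite ?mulr_ge0 ?ler_wpM2r //; lra.
  rewrite (_ : _ - _ = (z1 - x) + (z2 - x) - rho' * (C - x * rho' ^+ m) + (1 - rho) * q * (q * r)); last first.
    by rewrite /z1 /z2 /C; ring.
  move: t2; move: ((1 - rho) * q * (q * r)) => z3.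
  move: h1 h2 t1; rewrite !ler_norml; move: (rho' * _) (z1 - x) (z2 - x) => z4 z5 z6.
  move: (x * eps) (q * x) => z7 z8 ; rewrite -!mulrA; move: (x * eps) => z9.
  by move=> /andP[? ?] /andP[? ?] /andP[? ?] /andP[? ?]; apply/andP; split; lra.
- move: cm mx0 mixed_small; rewrite -/eps mulrDr; move: (q * r) (q * _) => z1 z2.
  move: (x * rho' ^+ m) (200 * x * eps) (x / D) => z3 z4 z5.
  by rewrite !ler_norml => /andP[? ?] ? ?; apply/andP; split; lra.
- have h1 := outside_ge R f1 f2 w m; have h2 := outside_le R f1 f2 w m.
  rewrite ler_pdivlMr // ler_pdivrMr // mul1r h2 andbT xD; apply: le_trans h1 => /=.
  by rewrite mulrBl mul1r -mulrA divfK ?gt_eqF //; lra.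
- by rewrite mulrAC; apply: div_norm; have /andP[] := reg12 (leqnSn m).
- rewrite divr_ge0 // ?ler0n //= ler_wpM2r // ler_nat subset_leq_card //.
  by apply/fintype.subsetP => v; rewrite !in_outside => /andP[h _]; rewrite andbb.
- have h1 := survival_ge_exp q_in rho_in (S m); have h2 := survival_le_exp q_in rho_in (S m).
  by rewrite h1 h2.
(* Inclusion-exclusion is exact up to the mixed vertices of step [m + 1], which lie in the two balls
   of radius [m]. *)
- rewrite -!mulrBl !outside_diag_step outside_step xD.
  have := mixedS_le R f1 f2 w m.
  rewrite -[(S m.+1).1.1]/(gsphere H1 m.+1) -[(S m.+1).2.1]/(gsphere H2 m.+1).
  have : 0 <= (mixed (S m.+1))%:R :> R by rewrite ler0n.
  move: #|_ :&: _|%:R #|gsphere _ m.+1|%:R #|gsphere _ m.+1|%:R (mixed _)%:R => z1 z2 z3 z4 z40 h.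
  have z48 : z4 / N <= 8 * (D ^+ m / N).
    rewrite mulrA; apply: ler_wpM2r => //; apply: le_trans h _; apply: le_trans (lerD b1 b2) _.
    by rewrite -mulrDl -natrD.
  have z4N : 0 <= z4 / N by exact: mulr_ge0.
  rewrite (_ : _ - _ = - (z4 / N)); last by ring.
  by rewrite normrN ger0_norm.
- rewrite divr_ge0 // ?ler0n //= ler_pdivrMr // mul1r ler_nat.
  by rewrite -[X in (_ <= X)%N]card_ord; exact: max_card.
- rewrite (_ : q * _ * _ * _ = #|gsphere H1 m :&: gsphere H2 m|%:R * #|outside (S m)|%:R
     * (rho' * q) / N); last by ring.
  by apply: div_norm; have /andP[] := reg12 (leqnSn m).
- rewrite (_ : _ * D = #|gsphere H1 m.+1 :&: gsphere H2 m.+1|%:R * #|outside (S m.+1)|%:R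
     * (rho' * q) / N); last by rewrite qE; ring.
  by apply: div_norm; have /andP[] := reg12 (leqnn m.+1).
- apply/andP; split; first by rewrite -mulrDl ler_wpM2r // -natrD ler_nat card_SPDI_ge.
  rewrite xD mulrA -!mulrDl; apply: ler_wpM2r => //.
  have := card_SPDI_le H1 H2 m; rewrite -(ler_nat R) !natrD !natr_sum => /le_trans; apply.
  have := low_layers n_gt0 q_in qn B_ge2 reg1; have := low_layers n_gt0 q_in qn B_ge2 reg2.
  move: (\sum_(_ < _) _) (\sum_(_ < _) _) => z1 z2 h1 h2.
  move: (#|_ :&: _|%:R : R) (#|_ :&: _|%:R : R) (D ^+ m) h1 h2 => z3 z4 z5.
  by move: (#|escape _ _ _ _|%:R : R) (#|escape _ _ _ _|%:R : R) (#|escape _ _ _ _|%:R : R) (#|escape _ _ _ _|%:R : R) => z6 z7 z8 z9; lra.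
- exact: cross_bound.
- exact: cross_bound.
Qed.

End Pair.
End Bridge.

Local Open Scope classical_set_scope.

(** * Limits of real sequences *)

Section Limits.
Context (R : realType).
Implicit Types (f g h : nat -> R) (a b l : R).

Lemma lim_add f g a b : f @ \oo --> a -> g @ \oo --> b -> (fun n => f n + g n) @ \oo --> a + b.
Proof. exact: cvgD. Qed.

Lemma lim_sub f g a b : f @ \oo --> a -> g @ \oo --> b -> (fun n => f n - g n) @ \oo --> a - b.
Proof. exact: cvgB. Qed.

Lemma lim_mul f g a b : f @ \oo --> a -> g @ \oo --> b -> (fun n => f n * g n) @ \oo --> a * b.
Proof. exact: cvgM. Qed.

Lemma lim_opp f a : f @ \oo --> a -> (fun n => - f n) @ \oo --> - a.
Proof. exact: cvgN. Qed.

Lemma lim_cst a : (fun=> a) @ \oo --> a.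
Proof. exact: cvg_cst. Qed.
Arguments lim_cst : clear implicits.

Lemma lim_inv f a : a != 0 -> f @ \oo --> a -> (fun n => (f n)^-1) @ \oo --> a^-1.
Proof. exact: cvgV. Qed.

Lemma lim_exp f a : f @ \oo --> a -> (fun n => expR (f n)) @ \oo --> expR a.
Proof. by move=> fa; apply: (continuous_cvg _ _ fa); exact: continuous_expR. Qed.

Lemma lim_mul0 f g b : f @ \oo --> 0 -> g @ \oo --> b -> (fun n => f n * g n) @ \oo --> 0.
Proof. by move=> f0 gb; rewrite -(mul0r b); exact: lim_mul. Qed.

Lemma lim_near f g l : (\forall n \near \oo, f n = g n) -> g @ \oo --> l -> f @ \oo --> l.
Proof.
move=> fg gl; apply: cvg_trans gl; apply: near_eq_cvg.
by apply: filterS fg => n.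
Qed.

Lemma lim_le0 f h : (\forall n \near \oo, `|f n| <= h n) -> h @ \oo --> 0 -> f @ \oo --> 0.
Proof.
move=> fh h0; apply/cvgrPdist_le => e e0.
move/cvgrPdist_le: h0 => /(_ e e0) h0e.
apply: filterS2 fh h0e => n h1; rewrite !sub0r !normrN => h2.
exact: le_trans h1 (le_trans (ler_norm _) h2).
Qed.

Lemma lim_approx f g h l : (\forall n \near \oo, `|f n - g n| <= h n) ->
  h @ \oo --> 0 -> g @ \oo --> l -> f @ \oo --> l.
Proof.
move=> fg h0 gl; have := lim_add (lim_le0 fg h0) gl; rewrite add0r; apply: lim_near.
by apply: nearW => n; rewrite subrK.
Qed.

Lemma lim_pinfty_inv f : f @ \oo --> +oo -> (fun n => (f n)^-1) @ \oo --> 0.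
Proof.
move=> foo; have f0 : \forall n \near \oo, 0 < f n by move/cvgryPgt: foo; apply.
by have /(gtr0_cvgV0 f0) := foo.
Qed.

Lemma lim_pinfty_ge f g : (\forall n \near \oo, f n <= g n) -> f @ \oo --> +oo -> g @ \oo --> +oo.
Proof.
move=> fg /cvgryPge foo; apply/cvgryPge => A; have fooA : \forall n \near \oo, A <= f n by exact: foo.
apply: filterS2 fg fooA => n h1 h2.
exact: le_trans h1.
Qed.

Lemma lim_root f (k : nat) : (\forall n \near \oo, 0 <= f n) ->
  (fun n => f n ^+ k.+1) @ \oo --> 0 -> f @ \oo --> 0.
Proof.
move=> f0 fk; apply/cvgrPdist_le => e e0.
have ek : 0 < e ^+ k.+1 by rewrite exprn_gt0.
move/cvgrPdist_le: fk => /(_ _ ek) fke.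
apply: filterS2 f0 fke => n fn; rewrite !sub0r !normrN [`|f n|]ger0_norm //.
by rewrite ger0_norm ?exprn_ge0 // ler_pXn2r // nnegrE ?(ltW e0).
Qed.

Lemma expR_ge_pow (y : R) (k : nat) : 0 <= y -> (y / k.+1%:R) ^+ k.+1 <= expR y.
Proof.
move=> y0; have -> : y = k.+1%:R * (y / k.+1%:R) by rewrite mulrCA mulfV ?mulr1 // pnatr_eq0.
rewrite expRM_natl mulrAC mulfV ?pnatr_eq0 // mul1r.
have z0 : 0 <= y / k.+1%:R by rewrite divr_ge0.
rewrite ler_pXn2r ?nnegrE ?expR_ge0 //; apply: le_trans (expR_ge1Dx _).
by rewrite lerDr.
Qed.

Lemma lim_exp_decay f (c : R) (k : nat) : 0 < c -> f @ \oo --> +oo ->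
  (fun n => f n ^+ k * expR (- (c * f n))) @ \oo --> 0.
Proof.
move=> c0 foo; pose K := (k.+1%:R / c) ^+ k.+1.
have := lim_mul (lim_cst K) (lim_pinfty_inv foo); rewrite mulr0; apply: lim_le0.
have : \forall n \near \oo, 0 < f n by move/cvgryPgt: foo; apply.
apply: filterS => n fn.
have cf : 0 < c * f n by rewrite mulr_gt0.
have k0 : 0 < k.+1%:R :> R by rewrite ltr0n.
rewrite ger0_norm ?mulr_ge0 ?expR_ge0 ?exprn_ge0 ?(ltW fn) //.
rewrite expRN ler_pdivrMr ?expR_gt0 //.
apply: (@le_trans _ _ (K / f n * ((c * f n) / k.+1%:R) ^+ k.+1)); last first.
  apply: ler_wpM2l; last exact/expR_ge_pow/ltW.
  by rewrite divr_ge0 ?exprn_ge0 ?divr_ge0 // ltW.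
have ff : f n != 0 by rewrite gt_eqF.
rewrite /K mulrAC -exprMn (_ : k.+1%:R / c * (c * f n / k.+1%:R) = f n).
  by rewrite exprSr mulfK.
by field; rewrite !gt_eqF.
Qed.

Lemma expRN_le_sq (y : R) : 0 <= y -> expR (- y) <= 1 - y + y ^+ 2.
Proof.
move=> y0; rewrite expRN invf_ple ?posrE ?expR_gt0 //; last by nra.
apply: le_trans (expR_ge1Dx _).
rewrite -[leLHS]mul1r ler_pdivrMr; last by nra.
by have := exprn_ge0 3 y0; lra.
Qed.

Lemma lim_div_approx f g h (z : nat -> R) l : (\forall n \near \oo, 0 < z n) ->
  (\forall n \near \oo, `|f n - g n| <= h n) ->
  (fun n => h n / z n) @ \oo --> 0 -> (fun n => g n / z n) @ \oo --> l ->
  (fun n => f n / z n) @ \oo --> l.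
Proof.
move=> z0 fg hz gz; apply: (lim_approx _ hz gz); apply: filterS2 z0 fg => n zn h1.
by rewrite -mulrBl normrM [`|_^-1|]ger0_norm ?invr_ge0 ?(ltW zn) // ler_pM2r ?invr_gt0.
Qed.

Lemma lim_squeeze f g h l : (\forall n \near \oo, f n <= g n <= h n) ->
  f @ \oo --> l -> h @ \oo --> l -> g @ \oo --> l.
Proof. by move=> fgh fl hl; exact: (squeeze_cvgr fgh fl hl). Qed.

Lemma lim_near_le f a b : f @ \oo --> a -> a < b -> \forall n \near \oo, f n <= b.
Proof.
move=> /cvgrPdist_le fa ab; have ba : 0 < b - a by rewrite subr_gt0.
apply: filterS (fa _ ba) => n; rewrite ler_norml => /andP[h _]; lra.
Qed.

Lemma lim_near_ge f a b : f @ \oo --> a -> b < a -> \forall n \near \oo, b <= f n.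
Proof.
move=> /cvgrPdist_le fa ab; have ba : 0 < a - b by rewrite subr_gt0.
apply: filterS (fa _ ba) => n; rewrite ler_norml => /andP[_ h]; lra.
Qed.

End Limits.
Arguments lim_cst {R}.

(** * The three regimes *)

Section Regimes.
Context (R : realType) (B x q tau tau' : nat -> R).
Notation D n := (B n ^+ 4).
Notation eps n := (x n / D n + 1 / B n).
Hypothesis B_oo : B @ \oo --> +oo.
Hypothesis x_gt0 : \forall n \near \oo, 0 < x n.
Hypothesis xB1 : \forall n \near \oo, 1 <= x n * B n.
Hypothesis xD0 : (fun n => x n / D n) @ \oo --> 0.
Hypothesis q_ge0 : \forall n \near \oo, 0 <= q n.
Hypothesis qD0 : (fun n => q n * D n) @ \oo --> 0.
Hypothesis tau_ge0 : \forall n \near \oo, 0 <= tau n.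
Hypothesis tau0 : (fun n => D n * tau n / x n) @ \oo --> 0.
Hypothesis tau'0 : (fun n => tau' n / x n) @ \oo --> 0.

Lemma B_large (A : R) : \forall n \near \oo, A <= B n.
Proof. by move/cvgryPge: B_oo; apply. Qed.

Lemma D_ge_B : \forall n \near \oo, B n <= D n.
Proof.
apply: filterS (B_large 1) => n B1; rewrite exprS ler_peMr ?exprn_ege1 //.
exact: le_trans B1.
Qed.

Lemma D_oo : (fun n => D n) @ \oo --> +oo.
Proof. exact: (lim_pinfty_ge D_ge_B B_oo). Qed.

Lemma D_large (A : R) : \forall n \near \oo, A <= D n.
Proof. by move/cvgryPge: D_oo; apply. Qed.

Lemma Bi0 : (fun n => (B n)^-1) @ \oo --> 0.
Proof. exact: lim_pinfty_inv. Qed.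

Lemma Di0 : (fun n => (D n)^-1) @ \oo --> 0.
Proof. exact: (lim_pinfty_inv D_oo). Qed.

Lemma q0 : q @ \oo --> 0.
Proof.
apply: (lim_le0 _ qD0); apply: filterS2 q_ge0 (D_large 1) => n q0 D1.
by rewrite ger0_norm // ler_peMr.
Qed.

Lemma eps0 : (fun n => eps n) @ \oo --> 0.
Proof.
rewrite -(addr0 0); apply: lim_add xD0 _; apply: lim_near Bi0.
by apply: nearW => n; rewrite mul1r.
Qed.

Lemma tau_x0 : (fun n => tau n / x n) @ \oo --> 0.
Proof.
apply: (lim_le0 _ tau0); apply: filterS3 tau_ge0 (D_large 1) x_gt0 => n t0 D1 xn.
rewrite ger0_norm ?divr_ge0 ?(ltW xn) // -mulrA ler_peMl // divr_ge0 // ltW //.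
Qed.

Lemma tau_lim : tau @ \oo --> 0.
Proof.
have := lim_mul tau0 xD0; rewrite mulr0; apply: lim_near.
apply: filterS2 (D_large 1) x_gt0 => n D1 xn.
have D0 : D n != 0 by rewrite gt_eqF // (lt_le_trans ltr01).
move: D0; move: (D n) => d d0; by field; rewrite d0 gt_eqF.
Qed.

Lemma x_le_D : \forall n \near \oo, x n <= D n.
Proof.
have : \forall n \near \oo, x n / D n <= 1 by exact: (lim_near_le xD0 ltr01).
by apply: filterS2 (D_large 1) => n D1; rewrite ler_pdivrMr ?mul1r // (lt_le_trans ltr01).
Qed.

Lemma qx0 : (fun n => q n * x n) @ \oo --> 0.
Proof.
apply: (lim_le0 _ qD0); apply: filterS3 q_ge0 x_gt0 x_le_D => n q0 xn xD.
by rewrite ger0_norm ?mulr_ge0 ?(ltW xn) // ler_wpM2l.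
Qed.

(* A family of vertices, of proportion u, that survive with probability p. *)
Section Survival.
Context (Q u U p : nat -> R) (L : R).
Hypothesis u1 : u @ \oo --> (1 : R).
Hypothesis hU : \forall n \near \oo, `|U n - u n * p n| <= tau n.
Hypothesis hp : \forall n \near \oo, expR (- ((1 + 4 * q n) * Q n)) <= p n <= expR (- Q n).

(** The two bounds on [p] differ by the factor [expR (- (4 * q * Q))], which tends to 1. *)
Lemma survivors_ratio : (fun n => expR (x n - Q n)) @ \oo --> L ->
  (fun n => q n * Q n) @ \oo --> 0 -> (fun n => tau n / expR (- x n)) @ \oo --> 0 ->
  (fun n => U n / expR (- x n)) @ \oo --> L.
Proof.
move=> hL qQ tl; have l0 : \forall n \near \oo, 0 < expR (- x n) by apply: nearW => n; exact: expR_gt0.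
apply: (lim_div_approx l0 hU tl).
have pl : (fun n => p n / expR (- x n)) @ \oo --> L.
  have e1 := lim_exp (lim_mul (lim_cst (- 4)) qQ); rewrite mulr0 expR0 in e1.
  have := lim_mul hL e1; rewrite mulr1 => lo; apply: (lim_squeeze _ lo hL).
  apply: filterS hp => n /andP[p1 p2]; rewrite expRN invrK -expRD.
  apply/andP; split; last first.
    by rewrite [x n - Q n]addrC expRD; apply: ler_wpM2r; first exact: expR_ge0.
  rewrite (_ : x n - Q n + -4 * (q n * Q n) = - ((1 + 4 * q n) * Q n) + x n); last by ring.
  by rewrite expRD ler_wpM2r ?expR_ge0.
by have := lim_mul u1 pl; rewrite mul1r; apply: lim_near; apply: nearW => n; rewrite mulrA.
Qed.

(** For small [x] nearly everything survives and the losses themselves must be measured on the scale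
    [x]: [1 - p] lies between [Q - Q ^+ 2] and [(1 + 4 * q) * Q]. *)
Lemma losses_ratio : x @ \oo --> 0 -> (\forall n \near \oo, 0 <= Q n) ->
  (fun n => Q n / x n) @ \oo --> L ->
  (U @ \oo --> (1 : R)) /\ ((fun n => (u n - U n) / x n) @ \oo --> L).
Proof.
move=> x0 Q0 QL.
have Q_0 : Q @ \oo --> 0.
  have := lim_mul QL x0; rewrite mulr0; apply: lim_near.
  by apply: filterS x_gt0 => n xn; rewrite divfK ?gt_eqF.
have pL : (fun n => (1 - p n) / x n) @ \oo --> L.
  have lo := lim_mul QL (lim_sub (lim_cst 1) Q_0); rewrite subr0 mulr1 in lo.
  have hi := lim_mul (lim_add (lim_cst 1) (lim_mul (lim_cst 4) q0)) QL.
  rewrite mulr0 addr0 mul1r in hi; apply: (lim_squeeze _ lo hi).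
  apply: filterS3 x_gt0 Q0 hp => n xn Qn /andP[p1 p2].
  rewrite mulrAC [X in _ && (_ <= X)]mulrA !ler_pM2r ?invr_gt0 //; apply/andP; split.
    by have := expRN_le_sq Qn; lra.
  by have := expR_ge1Dx (- ((1 + 4 * q n) * Q n)); lra.
have d : (fun n => (u n - U n) / x n) @ \oo --> L.
  apply: (@lim_div_approx _ _ (fun n => u n * (1 - p n)) tau) => //.
  - by apply: filterS hU => n; rewrite (_ : u n - U n - _ = - (U n - u n * p n)) ?normrN //; ring.
  - exact: tau_x0.
  by have := lim_mul u1 pL; rewrite mul1r; apply: lim_near; apply: nearW => n; rewrite mulrA.
split=> //; have := lim_sub u1 (lim_mul d x0); rewrite mulr0 subr0; apply: lim_near.
by apply: filterS x_gt0 => n xn; rewrite divfK ?gt_eqF // opprB addrC subrK.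
Qed.

End Survival.

(** * Size of one DAG *)

Section OneGraphLimits.
Context (s u U p e E T tl : nat -> R).
Hypothesis est : \forall n \near \oo, single_estimates (D n) (B n) (x n) (q n) (tau n) (tau' n)
  (s n) (u n) (U n) (p n) (e n) (E n) (T n) (tl n).

Lemma s_x1 : (fun n => s n / x n) @ \oo --> (1 : R).
Proof.
have c := lim_mul (lim_cst 40) eps0; rewrite mulr0 in c.
apply: (@lim_div_approx _ _ x (fun n => 40 * x n * eps n)) => //.
- by apply: filterS est => n [].
- by apply: lim_near c; apply: filterS x_gt0 => n xn; rewrite mulrAC mulfK ?gt_eqF.
by apply: lim_near (lim_cst 1); apply: filterS x_gt0 => n xn; rewrite mulfV ?gt_eqF.
Qed.

Lemma u_1 : u @ \oo --> (1 : R).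
Proof.
have lo := lim_sub (lim_cst 1) (lim_mul (lim_cst 8) xD0); rewrite mulr0 subr0 in lo.
by apply: (lim_squeeze _ lo (lim_cst 1)); apply: filterS est => n [].
Qed.

Lemma e_x1 : (fun n => e n / x n) @ \oo --> (1 : R).
Proof.
apply: (@lim_div_approx _ _ (fun n => s n * u n) tau) => //.
- by apply: filterS est => n [].
- exact: tau_x0.
by have := lim_mul s_x1 u_1; rewrite mul1r; apply: lim_near; apply: nearW => n; rewrite mulrAC.
Qed.

Lemma s_near (c : R) : c < 1 -> \forall n \near \oo, c * x n <= s n.
Proof.
move=> c1; have : \forall n \near \oo, c <= s n / x n by exact: (lim_near_ge s_x1 c1).
by apply: filterS2 x_gt0 => n xn; rewrite ler_pdivlMr.
Qed.

Section LargeX.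
Hypothesis x_oo : x @ \oo --> +oo.
Hypothesis Dx0 : (fun n => D n * expR (- x n) / x n) @ \oo --> 0.

Lemma sqrtB_oo : (fun n => Num.sqrt (B n)) @ \oo --> +oo.
Proof.
apply/cvgryPge => A; apply: filterS (B_large (A ^+ 2)) => n h.
by apply: le_trans (ler_norm A) _; rewrite -sqrtr_sqr ler_sqrt // (le_trans (sqr_ge0 A)).
Qed.

(** The ratio [s / x] tends to 1, but this does not control [expR (x - s)] for large [x]. Let [b] be
    the square root of [B]. If [x <= b] then [x - s <= 1]; if [x > b] then [s >= x / 2] and the
    factor [expR (- b / 2)] beats [D = b ^+ 8]. *)
Lemma decay_s : (fun n => D n * expR (- s n) / x n) @ \oo --> 0.
Proof.
pose b n := Num.sqrt (B n).
have h1 := lim_mul (lim_cst (expR 1)) Dx0.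
have h2 := @lim_exp_decay _ b 2^-1 8 _ sqrtB_oo.
rewrite mulr0 in h1; have := lim_add h1 (h2 _); rewrite addr0 => H.
have {H} := H ltac:(by rewrite invr_gt0 ltr0n); apply: lim_le0.
have e80 : \forall n \near \oo, eps n <= 80^-1 by apply: (lim_near_le eps0); rewrite invr_gt0 ltr0n.
have x1 : \forall n \near \oo, 1 <= x n by move/cvgryPge: x_oo; apply.
have b80 : \forall n \near \oo, 80 <= b n by move/cvgryPge: sqrtB_oo; apply.
have all4 : \forall n \near \oo, [/\ eps n <= 80^-1, 1 <= x n, 80 <= b n & 1 <= B n].
  by apply: filterS3 e80 x1 (filterI b80 (B_large 1)) => n ? ? [].
apply: filterS2 all4 est => n [en xn bn Bn] [/ler_normlP[sx _] _ _ _ _ _ _ _ _].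
have x_0 : 0 < x n by lra.
have b0 : 0 < b n by lra.
have bB : B n = b n ^+ 2 by rewrite sqr_sqrtr // (le_trans ler01).
have DE : D n = b n ^+ 8 by rewrite bB -exprM.
have D0 : 0 < D n by rewrite DE exprn_gt0.
have sx' : x n - s n <= 40 * x n * eps n by move: sx; rewrite opprB.
have w0' y : 0 <= D n * expR y / x n.
  by apply: divr_ge0; [apply: mulr_ge0; [exact: ltW|exact: expR_ge0]|exact: ltW].
rewrite ger0_norm; last exact: w0'.
have w0 := w0' (- x n).
have d0 : 0 <= b n ^+ 8 * expR (- (2^-1 * b n)).
  by apply: mulr_ge0; [apply: exprn_ge0; exact: ltW|exact: expR_ge0].
case: (leP (x n) (b n)) => xb.
  apply: (@le_trans _ _ (expR 1 * (D n * expR (- x n) / x n))); last by rewrite lerDl.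
  rewrite [leRHS](_ : _ = D n * (expR 1 * expR (- x n)) / x n); last by ring.
  apply: ler_wpM2r; first by rewrite invr_ge0 ltW.
  apply: ler_wpM2l; first exact: ltW.
  rewrite -expRD ler_expR.
  (* Two halves: each of [x ^+ 2 / D] and [x / B] is at most 1/80 here. *)
  suff : 40 * x n * eps n <= 1 by lra.
  have i1 : x n / D n <= 80^-1 / b n.
    rewrite ler_pdivrMr // DE (exprS _ 7) mulrA divfK ?gt_eqF //.
    have b7 : 80 * b n <= b n ^+ 7.
      rewrite (exprS _ 6) mulrC; apply: ler_wpM2l; first exact: ltW.
      rewrite (exprS _ 5) -[leLHS]mulr1; apply: ler_pM => //.
      by apply: exprn_ege1; lra.
    by rewrite mulrC ler_pdivlMr //; lra.
  have i2 : x n / B n <= 80^-1.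
    rewrite ler_pdivrMr ?bB ?exprn_gt0 // mulrC ler_pdivlMr // expr2.
    by have : b n * 80 <= b n * b n by [apply: ler_wpM2l => //; exact: ltW]; lra.
  have i3 : x n * (x n / D n) <= 80^-1.
    apply: (@le_trans _ _ (b n * (80^-1 / b n))); last by rewrite mulrC divfK ?gt_eqF.
    by apply: ler_pM => //; [exact: ltW|rewrite divr_ge0 ?ltW].
  have -> : 40 * x n * eps n = 40 * (x n * (x n / D n)) + 40 * (x n / B n) by ring.
  by lra.
apply: (@le_trans _ _ (b n ^+ 8 * expR (- (2^-1 * b n)))); last by rewrite lerDr mulr_ge0 ?expR_ge0.
rewrite -DE ler_pdivrMr // -[leRHS]mulrA; apply: ler_wpM2l; first exact: ltW.
apply: (@le_trans _ _ (expR (- (2^-1 * b n)) * 1)); last by apply: ler_wpM2l; first exact: expR_ge0.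
rewrite mulr1 ler_expR lerN2.
have : 40 * x n * eps n <= 40 * x n * 80^-1 by apply: ler_wpM2l => //; lra.
by lra.
Qed.

(** The edges leaving the sphere of radius [m + 1] number at most about [D U], so the next lemmas
    discard them against [x]. *)
Lemma U_decay : (fun n => D n * U n / x n) @ \oo --> 0.
Proof.
have := lim_add decay_s tau0; rewrite addr0; apply: lim_le0.
apply: filterS3 (D_large 1) x_gt0 est => n D1 xn.
move=> [_ /andP[_ u1] /ler_normlP[_ hU] /andP[U0 _] /andP[p1 p2] _ _ _ _].
have D0 : 0 <= D n := le_trans ler01 D1.
rewrite ger0_norm; last by apply: divr_ge0; [exact: mulr_ge0|exact: ltW].
rewrite -mulrDl; apply: ler_wpM2r; first by rewrite invr_ge0 ltW.
rewrite -mulrDr; apply: ler_wpM2l => //.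
have p0 : 0 <= p n by apply: le_trans p1; exact: expR_ge0.
have : u n * p n <= 1 * p n by apply: ler_wpM2r.
by lra.
Qed.

Lemma U_lim0 : U @ \oo --> 0.
Proof.
have := lim_mul U_decay xD0; rewrite mulr0; apply: lim_near.
apply: filterS2 (D_large 1) x_gt0 => n D1 xn.
have D0 : D n != 0 by rewrite gt_eqF // (lt_le_trans ltr01).
by move: D0; move: (D n) => d d0; field; rewrite d0 gt_eqF.
Qed.

Lemma E_x0 : (fun n => E n / x n) @ \oo --> 0.
Proof.
have := lim_add U_decay tau'0; rewrite addr0; apply: lim_le0.
apply: filterS3 (D_large 1) x_gt0 est => n D1 xn.
move=> [_ /andP[_ u1] _ /andP[U0 Uu] _ _ hE _ _].
have D0 : 0 <= D n := le_trans ler01 D1.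
rewrite normrM [`|(x n)^-1|]ger0_norm ?invr_ge0 ?(ltW xn) // -mulrDl.
apply: ler_wpM2r; first by rewrite invr_ge0 ltW.
have : 0 <= (u n - U n) * U n * D n <= D n * U n.
  apply/andP; split; first by apply: mulr_ge0 => //; apply: mulr_ge0; rewrite ?subr_ge0.
  by rewrite mulrC; apply: ler_wpM2l => //; rewrite ler_piMl //; lra.
move: hE; move: ((u n - U n) * U n * D n) => z /ler_normlP[h1 h2] /andP[z0 z1].
by apply/ler_normlP; split; lra.
Qed.

(** Eventually the sphere of radius [m + 1] contains half of the vertices, so missing it has
    probability of order [expR (- D / 2)]. *)
Lemma tl_x0 : (fun n => tl n / x n) @ \oo --> 0.
Proof.
have h1 : (fun n => D n * U n / x n + D n * tau n / x n) @ \oo --> 0.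
  by have := lim_add U_decay tau0; rewrite addr0.
have h2 := lim_exp_decay 1 (_ : 0 < 2^-1) D_oo.
have half : 0 < 2^-1 :> R by rewrite invr_gt0 ltr0n.
have := lim_mul (lim_mul h1 (h2 half)) (lim_cst (expR 1)); rewrite !mul0r; apply: lim_le0.
have q1 : \forall n \near \oo, q n <= 1 by apply: (lim_near_le q0 ltr01).
have uU := lim_sub u_1 U_lim0; rewrite subr0 in uU.
have uU2 : \forall n \near \oo, 2^-1 <= u n - U n by apply: (lim_near_ge uU); lra.
have all4 : \forall n \near \oo, [/\ q n <= 1, 2^-1 <= u n - U n, 1 <= B n & B n <= D n].
  by apply: filterS3 q1 uU2 (filterI (B_large 1) D_ge_B) => n ? ? [].
apply: filterS3 all4 (filterI x_gt0 tau_ge0) est => n [qn un B1 BD] [xn tn].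
move=> [_ _ _ /andP[U0 Uu] _ _ _ _ /andP[t0 t1]].
have D0 : 0 < D n by lra.
rewrite ger0_norm ?divr_ge0 ?(ltW xn) // ler_pdivrMr //; apply: le_trans t1 _.
rewrite expr1 [leRHS](_ : _ = D n * ((U n + tau n) * D n * (expR (- (2^-1 * D n)) * expR 1))); last first.
  by field; rewrite gt_eqF.
have UD : 0 <= (U n + tau n) * D n by apply: mulr_ge0; [exact: addr_ge0|exact: ltW].
apply: ler_pM => //; [lra|by apply: mulr_ge0 => //; exact: expR_ge0|].
apply: ler_wpM2l => //.
rewrite -expRD ler_expR.
have : D n * 2^-1 <= D n * (u n - U n) by apply: ler_wpM2l => //; exact: ltW.
by lra.
Qed.

Lemma T_x1 : (fun n => T n / x n) @ \oo --> (1 : R).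
Proof.
apply: (@lim_div_approx _ _ (fun n => e n + E n) (fun n => 6 * (x n / D n) + tl n)) => //.
- by apply: filterS est => n [] *; apply/ler_normlP; split; lra.
- have := lim_add (lim_mul (lim_cst 6) Di0) tl_x0; rewrite mulr0 addr0; apply: lim_near.
  apply: filterS x_gt0 => n xn; rewrite mulrDl; congr (_ + _).
  by rewrite -mulrA; congr (_ * _); rewrite mulrAC mulfV ?mul1r ?gt_eqF.
have := lim_add e_x1 E_x0; rewrite addr0; apply: lim_near; apply: nearW => n.
by rewrite mulrDl.
Qed.

End LargeX.

Section SmallX.
Hypothesis x0 : x @ \oo --> 0.

Lemma small_UA : (U @ \oo --> (1 : R)) /\ ((fun n => (u n - U n) / x n) @ \oo --> (1 : R)).
Proof.
apply: (@losses_ratio s u U p 1) => //.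
- exact: u_1.
- by apply: filterS est => n [].
- by apply: filterS est => n [].
- have := @s_near 2^-1; have h : 2^-1 < 1 :> R by lra.
  move=> /(_ h); apply: filterS2 x_gt0 => n xn; apply: le_trans.
  by apply: mulr_ge0; [rewrite invr_ge0|exact: ltW].
exact: s_x1.
Qed.

Lemma Dx_gt0 : \forall n \near \oo, 0 < D n * x n.
Proof.
by apply: filterS2 (D_large 1) x_gt0 => n D1 xn; apply: mulr_gt0 => //; apply: lt_le_trans D1.
Qed.

Lemma div_Dx (f : nat -> R) : (fun n => f n / (D n * x n)) = (fun n => f n / x n * (D n)^-1).
Proof. by apply: funext => n; rewrite invfM mulrA mulrAC. Qed.

Lemma small_E : (fun n => E n / (D n * x n)) @ \oo --> (1 : R).
Proof.
have [U1 A1] := small_UA.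
apply: (@lim_div_approx _ _ (fun n => (u n - U n) * U n * D n) tau').
- exact: Dx_gt0.
- by apply: filterS est => n [].
- by rewrite div_Dx; have := lim_mul tau'0 Di0; rewrite mulr0.
have := lim_mul A1 U1; rewrite mulr1; apply: lim_near.
apply: filterS2 (D_large 1) x_gt0 => n D1 xn.
have : D n != 0 by rewrite gt_eqF // (lt_le_trans ltr01).
by move: (D n) => d d0; field; rewrite d0 gt_eqF.
Qed.

(** The sphere of radius [m + 1] now has only about [n x] vertices, but missing it is still
    unlikely: [1 <= x * B] gives [D * x >= B], and [expR (- B / 2)] beats [B ^+ 2]. *)
Lemma small_tl : (fun n => tl n / (D n * x n)) @ \oo --> 0.
Proof.
have [U1 A1] := small_UA; have half : 0 < 2^-1 :> R by rewrite invr_gt0 ltr0n.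
have h2 := lim_exp_decay 2 half B_oo.
have := lim_mul h2 (lim_cst (3 * expR 1)); rewrite mul0r; apply: lim_le0.
have q1 : \forall n \near \oo, q n <= 1 by apply: (lim_near_le q0 ltr01).
have t1 : \forall n \near \oo, tau n <= 1 by apply: (lim_near_le tau_lim ltr01).
have uU2 : \forall n \near \oo, 2^-1 <= (u n - U n) / x n by apply: (lim_near_ge A1); lra.
have all6 : \forall n \near \oo, [/\ q n <= 1, tau n <= 1, 2^-1 <= (u n - U n) / x n,
    1 <= B n & 1 <= x n * B n].
  by apply: filterS3 q1 (filterI t1 uU2) (filterI (B_large 1) xB1) => n ? [? ?] [].
apply: filterS3 all6 (filterI x_gt0 tau_ge0) est => n [qn t1n un B1 xB] [xn tn].
move=> [_ /andP[_ u1'] _ /andP[U0 Uu] _ _ _ _ /andP[t0 tb]].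
have B0 : 0 < B n by lra.
have D0 : 0 < D n by rewrite exprn_gt0.
rewrite ler_pdivlMr // in un.
rewrite ger0_norm; last by apply: divr_ge0 => //; apply: mulr_ge0; exact: ltW.
rewrite ler_pdivrMr; last exact: mulr_gt0.
apply: le_trans tb _.
rewrite [leRHS](_ : _ = B n * ((x n * B n * 3) * D n * (expR (- (2^-1 * B n)) * expR 1))); last by ring.
apply: ler_wpM2l; first exact: ltW.
have c1 : 0 <= U n + tau n by apply: addr_ge0.
apply: ler_pM.
- by apply: mulr_ge0 => //; exact: ltW.
- exact: expR_ge0.
- apply: ler_wpM2r; first exact: ltW.
  by lra.
rewrite -expRD ler_expR.
have k1 : D n * (2^-1 * x n) <= D n * (u n - U n) by apply: ler_wpM2l => //; exact: ltW.
have k2 : B n <= D n * x n.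
  rewrite exprSr -mulrA (mulrC (B n)) -[leLHS]mulr1; apply: ler_pM => //; first exact: ltW.
  by rewrite exprS; apply: ler_peMr; [exact: ltW|exact: exprn_ege1].
by lra.
Qed.

Lemma small_T : (fun n => T n / (D n * x n)) @ \oo --> (1 : R).
Proof.
apply: (@lim_div_approx _ _ (fun n => e n + E n) (fun n => 6 * (x n / D n) + tl n)).
- exact: Dx_gt0.
- by apply: filterS est => n [] *; apply/ler_normlP; split; lra.
- have h := lim_mul (lim_mul (lim_cst 6) Di0) Di0; rewrite mulr0 in h.
  have := lim_add h small_tl; rewrite addr0; apply: lim_near.
  apply: filterS2 (D_large 1) x_gt0 => n D1 xn; rewrite mulrDl; congr (_ + _).
  have : D n != 0 by rewrite gt_eqF // (lt_le_trans ltr01).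
  by move: (D n) => d d0; field; rewrite d0 gt_eqF.
have h := lim_mul e_x1 Di0; rewrite mulr0 in h.
have := lim_add h small_E; rewrite add0r; apply: lim_near; apply: nearW => n.
by rewrite mulrDl; congr (_ + _); rewrite invfM mulrA mulrAC.
Qed.

End SmallX.

Section MiddleX.
Context (la eta : R).
Hypothesis la_lim : (fun n => expR (- x n)) @ \oo --> la.
Hypothesis la1 : la < 1.
Hypothesis eta_lim : (fun n => x n / (D n * expR (- x n))) @ \oo --> eta.
Notation lam n := (expR (- x n)).

Lemma lam_gt0 : \forall n \near \oo, 0 < lam n.
Proof. by apply: nearW => n; exact: expR_gt0. Qed.

Lemma Dlam_gt0 : \forall n \near \oo, 0 < D n * lam n.
Proof.
apply: filterS (D_large 1) => n D1; apply: mulr_gt0; last exact: expR_gt0.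
exact: lt_le_trans D1.
Qed.

(** From [(x / 4) ^+ 4 <= expR x], the fifth power of [x / B] is at most [256 / B] times the ratio
    that converges to [eta]. This uses that [eta] is finite. *)
Lemma x_B0 : (fun n => x n / B n) @ \oo --> 0.
Proof.
apply: (@lim_root _ _ 4).
  by apply: filterS2 (B_large 1) x_gt0 => n B1 xn; apply: divr_ge0; lra.
have := lim_mul (lim_mul (lim_cst 256) eta_lim) Bi0; rewrite mulr0; apply: lim_le0.
apply: filterS2 (B_large 1) x_gt0 => n B1 xn.
have B0 : 0 < B n by lra.
have BE : x n / B n >= 0 by apply: divr_ge0; exact: ltW.
rewrite ger0_norm ?exprn_ge0 // expRN invfM invrK.
have := @expR_ge_pow _ (x n) 3 (ltW xn).
rewrite (_ : 3.+1%:R = 4 :> R) // => h.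
have h' : x n ^+ 4 <= 256 * expR (x n).
  have : 256 * (x n / 4) ^+ 4 <= 256 * expR (x n) by apply: ler_wpM2l.
  by apply: le_trans; rewrite le_eqVlt; apply/orP; left; apply/eqP; field.
have B5 : 0 < B n ^+ 5 by rewrite exprn_gt0.
rewrite exprMn exprVn ler_pdivrMr // [leRHS](_ : _ = x n * (256 * expR (x n))).
  by rewrite exprS; apply: ler_wpM2l => //; exact: ltW.
by field; rewrite gt_eqF.
Qed.

(** The relative error [eps] becomes an absolute error [x * eps] that vanishes, as is required
    before taking exponentials. Note that [x ^+ 2 / D] is the square of [x / B] divided by
    [B ^+ 2]. *)
Lemma x_eps0 : (fun n => x n * eps n) @ \oo --> 0.
Proof.
have h := lim_add (lim_mul (lim_mul x_B0 x_B0) (lim_mul Bi0 Bi0)) x_B0.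
rewrite !mul0r addr0 in h; apply: lim_near h; apply: filterS (B_large 1) => n B1.
by field; rewrite gt_eqF //; lra.
Qed.

Lemma s_x0 : (fun n => x n - s n) @ \oo --> 0.
Proof.
have := lim_mul (lim_cst 40) x_eps0; rewrite mulr0; apply: lim_le0.
by apply: filterS est => n [h *]; rewrite distrC mulrA.
Qed.

Lemma tau_lam0 : (fun n => tau n / lam n) @ \oo --> 0.
Proof.
have := lim_mul tau0 eta_lim; rewrite mul0r; apply: lim_near.
apply: filterS2 (D_large 1) x_gt0 => n D1 xn.
have : D n != 0 by rewrite gt_eqF // (lt_le_trans ltr01).
have : lam n != 0 by rewrite gt_eqF // expR_gt0.
by move: (D n) (lam n) => d l l0 d0; field; rewrite d0 l0 gt_eqF.
Qed.

Lemma middle_U : (fun n => U n / lam n) @ \oo --> (1 : R).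
Proof.
apply: (@survivors_ratio s u U p 1).
- exact: u_1.
- by apply: filterS est => n [].
- by apply: filterS est => n [].
- by have := lim_exp s_x0; rewrite expR0.
- have := lim_mul qx0 s_x1; rewrite mul0r; apply: lim_near.
  by apply: filterS x_gt0 => n xn; field; rewrite gt_eqF.
exact: tau_lam0.
Qed.

Lemma middle_Ula : U @ \oo --> la.
Proof.
have := lim_mul middle_U la_lim; rewrite mul1r; apply: lim_near.
by apply: nearW => n; rewrite divfK // gt_eqF // expR_gt0.
Qed.

Lemma middle_A : (fun n => u n - U n) @ \oo --> 1 - la.
Proof. exact: lim_sub u_1 middle_Ula. Qed.

Lemma tau'_Dlam0 : (fun n => tau' n / (D n * lam n)) @ \oo --> 0.
Proof.
have := lim_mul tau'0 eta_lim; rewrite mul0r; apply: lim_near.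
by apply: filterS x_gt0 => n xn; rewrite mulrA divfK ?gt_eqF.
Qed.

Lemma middle_E : (fun n => E n / (D n * lam n)) @ \oo --> 1 - la.
Proof.
apply: (@lim_div_approx _ _ (fun n => (u n - U n) * U n * D n) tau').
- exact: Dlam_gt0.
- by apply: filterS est => n [].
- exact: tau'_Dlam0.
have := lim_mul middle_A middle_U; rewrite mulr1; apply: lim_near.
apply: filterS (D_large 1) => n D1.
have : D n != 0 by rewrite gt_eqF // (lt_le_trans ltr01).
have : lam n != 0 by rewrite gt_eqF // expR_gt0.
by move: (D n) (lam n) => d l l0 d0; field; rewrite d0 l0.
Qed.

Lemma over_x_Dlam (f : nat -> R) (l : R) : (fun n => f n / x n) @ \oo --> l ->
  (fun n => f n / (D n * lam n)) @ \oo --> l * eta.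
Proof.
move=> fl; have := lim_mul fl eta_lim; apply: lim_near.
by apply: filterS x_gt0 => n xn; rewrite mulrA divfK ?gt_eqF.
Qed.

Lemma middle_tl : (fun n => tl n / (D n * lam n)) @ \oo --> 0.
Proof.
have c0 : 0 < (1 - la) / 2 by rewrite divr_gt0 ?subr_gt0.
have h := lim_mul (lim_add middle_U tau_lam0)
   (lim_mul (lim_exp_decay 1 c0 D_oo) (lim_cst (expR 1))).
rewrite mul0r mulr0 in h; move: h; apply: lim_le0.
have q1 : \forall n \near \oo, q n <= 1 by apply: (lim_near_le q0 ltr01).
have uU2 : \forall n \near \oo, (1 - la) / 2 <= u n - U n by apply: (lim_near_ge middle_A); lra.
have all4 : \forall n \near \oo, [/\ q n <= 1, (1 - la) / 2 <= u n - U n, 1 <= B n & B n <= D n].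
  by apply: filterS3 q1 uU2 (filterI (B_large 1) D_ge_B) => n ? ? [].
apply: filterS3 all4 tau_ge0 est => n [qn un B1 BD] tn.
move=> [_ _ _ /andP[U0 Uu] _ _ _ _ /andP[t0 t1]].
have D0 : 0 < D n by lra.
have l0 : 0 < lam n by exact: expR_gt0.
rewrite ger0_norm; last by apply: divr_ge0 => //; apply: mulr_ge0; exact: ltW.
rewrite ler_pdivrMr; last exact: mulr_gt0.
apply: le_trans t1 _; rewrite expr1.
rewrite [leRHS](_ : _ = D n * ((U n + tau n) * D n * (expR (- ((1 - la) / 2 * D n)) * expR 1))); last first.
  by field; rewrite gt_eqF.
have UD : 0 <= (U n + tau n) * D n by apply: mulr_ge0; [exact: addr_ge0|exact: ltW].
apply: ler_pM => //; [lra|by apply: mulr_ge0 => //; exact: expR_ge0|].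
apply: ler_wpM2l => //; rewrite -expRD ler_expR.
have : D n * ((1 - la) / 2) <= D n * (u n - U n) by apply: ler_wpM2l => //; exact: ltW.
by lra.
Qed.

Lemma middle_T : (fun n => T n / (D n * lam n)) @ \oo --> 1 - la + eta.
Proof.
apply: (@lim_div_approx _ _ (fun n => e n + E n) (fun n => 6 * (x n / D n) + tl n)).
- exact: Dlam_gt0.
- by apply: filterS est => n [] *; apply/ler_normlP; split; lra.
- have h := lim_mul (lim_mul (lim_cst 6) Di0) eta_lim; rewrite mulr0 mul0r in h.
  have := lim_add h middle_tl; rewrite addr0; apply: lim_near.
  apply: nearW => n; rewrite mulrDl; congr (_ + _); ring.
have := lim_add (over_x_Dlam e_x1) middle_E; rewrite mul1r addrC; apply: lim_near.
by apply: nearW => n; rewrite mulrDl.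
Qed.

End MiddleX.

End OneGraphLimits.
Lemma q_x0 : (fun n => q n / x n) @ \oo --> 0.
Proof.
apply: (lim_le0 _ qD0); apply: filterS3 (filterI q_ge0 xB1) D_ge_B x_gt0 => n [qn xB] BD xn.
rewrite ger0_norm ?divr_ge0 ?(ltW xn) // ler_pdivrMr // -mulrA ler_peMr //.
by apply: le_trans xB _; rewrite mulrC; apply: ler_wpM2r => //; exact: ltW.
Qed.

(** * Size of the intersection of the two DAGs *)

Section TwoGraphLimits.
Context (s1 u1 U1 p1 e1 E1 T1 tl1 s2 u2 U2 p2 e2 E2 T2 tl2 : nat -> R).
Context (rho rhom c y Y p Q I e E T cr1 cr2 : nat -> R) (gamma rholim : R).
Hypothesis est1 : \forall n \near \oo, single_estimates (D n) (B n) (x n) (q n) (tau n) (tau' n)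
  (s1 n) (u1 n) (U1 n) (p1 n) (e1 n) (E1 n) (T1 n) (tl1 n).
Hypothesis est2 : \forall n \near \oo, single_estimates (D n) (B n) (x n) (q n) (tau n) (tau' n)
  (s2 n) (u2 n) (U2 n) (p2 n) (e2 n) (E2 n) (T2 n) (tl2 n).
Hypothesis est12 : \forall n \near \oo, pair_estimates (D n) (B n) (x n) (q n) (rho n) (rhom n)
  (tau n) (tau' n) (s1 n) (s2 n) (u1 n - U1 n) (u2 n - U2 n) (U1 n)
  (c n) (y n) (Y n) (p n) (Q n) (I n) (e n) (E n) (T n) (tl1 n) (tl2 n) (cr1 n) (cr2 n).
Hypothesis rho_in : \forall n \near \oo, 0 <= rho n <= 1.
Hypothesis gamma_lim : (fun n => rho n * rhom n) @ \oo --> gamma.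
Hypothesis rho_lim : rho @ \oo --> rholim.

Lemma y_1 : y @ \oo --> (1 : R).
Proof.
have lo := lim_sub (lim_cst 1) (lim_mul (lim_cst 8) xD0); rewrite mulr0 subr0 in lo.
by apply: (lim_squeeze _ lo (lim_cst 1)); apply: filterS est12 => n [].
Qed.

Lemma ce_x : (fun n => e n / x n) @ \oo --> gamma.
Proof.
apply: (@lim_div_approx _ _ (fun n => c n * y n * rho n) tau) => //.
- by apply: filterS est12 => n [].
- exact: tau_x0.
have cg : (fun n => c n / x n * rho n) @ \oo --> gamma.
  have h := lim_add (lim_mul (lim_cst 200) eps0) (lim_mul (lim_cst 8) Di0).
  rewrite !mulr0 addr0 in h; apply: (lim_approx _ h gamma_lim).
  apply: filterS3 x_gt0 rho_in est12 => n xn /andP[r0 r1] [_ hc _ _ _ _ _ _ _ _ _ _ _].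
  rewrite (_ : _ - _ = rho n * ((c n - x n * rhom n) / x n)); last by field; rewrite gt_eqF.
  rewrite normrM (ger0_norm r0) -[leRHS]mul1r; apply: ler_pM => //.
  rewrite normrM [`|(x n)^-1|]ger0_norm ?invr_ge0 ?(ltW xn) // ler_pdivrMr //.
  by apply: le_trans hc _; rewrite le_eqVlt; apply/orP; left; apply/eqP; ring.
have := lim_mul cg y_1; rewrite mulr1; apply: lim_near; apply: nearW => n; ring.
Qed.

Lemma sq_x1 (s : nat -> R) : (fun n => s n / x n) @ \oo --> (1 : R) ->
  (fun n => (s n + q n) / x n) @ \oo --> (1 : R).
Proof.
move=> h; have := lim_add h q_x0; rewrite addr0; apply: lim_near.
by apply: nearW => n; rewrite mulrDl.
Qed.

Lemma total_split (z : nat -> R) (l : R) : (\forall n \near \oo, 0 < z n) ->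
  (fun n => (x n / D n) / z n) @ \oo --> 0 ->
  (fun n => tl1 n / z n) @ \oo --> 0 -> (fun n => tl2 n / z n) @ \oo --> 0 ->
  (fun n => cr1 n / z n) @ \oo --> 0 -> (fun n => cr2 n / z n) @ \oo --> 0 ->
  (fun n => (e n + E n) / z n) @ \oo --> l -> (fun n => T n / z n) @ \oo --> l.
Proof.
move=> z0 h1 h2 h3 h4 h5; apply: (@lim_div_approx _ _ (fun n => e n + E n)
   (fun n => 12 * (x n / D n) + tl1 n + tl2 n + cr1 n + cr2 n)) => //.
  by apply: filterS est12 => n [] *; apply/ler_normlP; split; lra.
have h := lim_add (lim_add (lim_add (lim_add (lim_mul (lim_cst 12) h1) h2) h3) h4) h5.
rewrite mulr0 !addr0 in h; apply: lim_near h; apply: nearW => n; ring.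
Qed.

Section LargeX2.
Hypothesis x_oo : x @ \oo --> +oo.
Hypothesis Dx0 : (fun n => D n * expR (- x n) / x n) @ \oo --> 0.

(** The fourth power is [D * expR (- 2 x)], the product of [D * expR (- x) / x] and
    [x * expR (- x)], which both tend to 0. *)
Lemma B_exp0 : (fun n => B n * expR (- (x n / 2))) @ \oo --> 0.
Proof.
apply: (@lim_root _ _ 3).
  apply: filterS (B_large 1) => n B1; apply: mulr_ge0; last exact: expR_ge0.
  exact: le_trans B1.
have h := lim_mul Dx0 (lim_exp_decay 1 ltr01 x_oo); rewrite mul0r in h; apply: lim_near h.
apply: filterS x_gt0 => n xn; rewrite exprMn -expRM_natl expr1 mul1r.
rewrite (_ : 4%:R * - (x n / 2) = - x n + - x n); last by field.
by rewrite expRD; move: (expR _) => z; field; rewrite gt_eqF.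
Qed.

Lemma large_cross (s s' cr : nat -> R) :
  (fun n => s n / x n) @ \oo --> (1 : R) -> (fun n => s' n / x n) @ \oo --> (1 : R) ->
  (\forall n \near \oo,
    0 <= cr n <= B n * ((s n + q n) * expR (- (s' n - 8 * (x n / D n) - q n)))) ->
  (fun n => cr n / x n) @ \oo --> 0.
Proof.
move=> s_1 s'_1 hc.
have h := lim_mul (lim_mul (sq_x1 s_1) B_exp0) (lim_cst (expR 2)).
rewrite mulr0 mul0r in h; move: h; apply: lim_le0.
have a1 : \forall n \near \oo, q n <= 1 by apply: (lim_near_le q0 ltr01).
have a2 : \forall n \near \oo, x n / D n <= 8^-1 by apply: (lim_near_le xD0); lra.
have a3 : \forall n \near \oo, 2^-1 <= s' n / x n by apply: (lim_near_ge s'_1); lra.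
have a4 : \forall n \near \oo, 0 <= s n / x n by apply: (lim_near_ge s_1); lra.
apply: filterS3 (filterI (filterI a1 a2) (filterI a3 a4)) (filterI (B_large 1) (filterI q_ge0 x_gt0)) hc.
move=> n [[h1 h2] [h3 h4]] [B1 [qn xn]] /andP[c0 c1].
rewrite ler_pdivlMr // in h3; rewrite ler_pdivlMr // mul0r in h4.
rewrite ger0_norm ?divr_ge0 ?(ltW xn) // ler_pdivrMr //; apply: le_trans c1 _.
rewrite [leRHS](_ : _ = B n * ((s n + q n) * (expR (- (x n / 2)) * expR 2))); last first.
  by field; rewrite gt_eqF.
apply: ler_wpM2l; first lra.
apply: ler_wpM2l; first exact: addr_ge0.
by rewrite -expRD ler_expR; lra.
Qed.

(** Since [Y <= U1], the common edges are at most of the order of [D U1], which is already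
    negligible for the first graph. *)
Lemma large_E12 : (fun n => E n / x n) @ \oo --> 0.
Proof.
have h := lim_add (U_decay est1 x_oo Dx0) tau'0; rewrite addr0 in h; move: h; apply: lim_le0.
apply: filterS3 (filterI (D_large 1) x_gt0) rho_in est12 => n [D1 xn] /andP[r0 r1].
move=> [_ _ _ _ /andP[Y0 YU] _ _ /andP[I0 I1] _ hE _ _ _].
have D0 : 0 <= D n := le_trans ler01 D1.
rewrite normrM [`|(x n)^-1|]ger0_norm ?invr_ge0 ?(ltW xn) // -mulrDl.
apply: ler_wpM2r; first by rewrite invr_ge0 ltW.
have z : 0 <= I n * Y n * rho n * D n <= D n * U1 n.
  apply/andP; split; first by apply: mulr_ge0 => //; apply: mulr_ge0 => //; apply: mulr_ge0.
  rewrite mulrC; apply: ler_wpM2l => //.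
  apply: (@le_trans _ _ (Y n)) => //; rewrite -[leRHS]mulr1; apply: ler_pM => //.
    exact: mulr_ge0.
  by rewrite ler_piMl.
move: hE z; move: (I n * Y n * rho n * D n) => z /ler_normlP[h1 h2] /andP[z0 z1].
by apply/ler_normlP; split; lra.
Qed.

Lemma large_T12 : (fun n => T n / x n) @ \oo --> gamma.
Proof.
apply: total_split => //.
- apply: lim_near Di0; apply: filterS x_gt0 => n xn.
  by rewrite mulrAC mulfV ?mul1r // gt_eqF.
- exact: (tl_x0 est1).
- exact: (tl_x0 est2).
- apply: (large_cross (s_x1 est1) (s_x1 est2)); by apply: filterS est12 => n [].
- apply: (large_cross (s_x1 est2) (s_x1 est1)); by apply: filterS est12 => n [].
have := lim_add ce_x large_E12; rewrite addr0; apply: lim_near; apply: nearW => n.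
by rewrite mulrDl.
Qed.

End LargeX2.

Lemma Q_x : (fun n => (Q n - x n * (2 - rho n * rhom n)) / x n) @ \oo --> 0.
Proof.
have h := lim_add (lim_mul (lim_cst 280) eps0) (lim_mul (lim_cst 4) q0).
rewrite !mulr0 addr0 in h; move: h; apply: lim_le0.
apply: filterS2 x_gt0 est12 => n xn [hQ _ _ _ _ _ _ _ _ _ _ _ _].
rewrite normrM [`|(x n)^-1|]ger0_norm ?invr_ge0 ?(ltW xn) // ler_pdivrMr //.
by apply: le_trans hQ _; rewrite le_eqVlt; apply/orP; left; apply/eqP; ring.
Qed.

Section SmallX2.
Hypothesis x0 : x @ \oo --> 0.
Hypothesis gamma_le1 : gamma <= 1.

Lemma Q_x_lim : (fun n => Q n / x n) @ \oo --> 2 - gamma.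
Proof.
have := lim_add Q_x (lim_sub (lim_cst 2) gamma_lim); rewrite add0r; apply: lim_near.
by apply: filterS x_gt0 => n xn; field; rewrite gt_eqF.
Qed.

Lemma small_Y : (Y @ \oo --> (1 : R)) /\ ((fun n => (y n - Y n) / x n) @ \oo --> 2 - gamma).
Proof.
apply: (@losses_ratio Q y Y p (2 - gamma)) => //.
- exact: y_1.
- by apply: filterS est12 => n [].
- by apply: filterS est12 => n [].
- have : \forall n \near \oo, 0 <= Q n / x n by apply: (lim_near_ge Q_x_lim); have := gamma_le1; lra.
  by apply: filterS2 x_gt0 => n xn; rewrite ler_pdivlMr // mul0r.
exact: Q_x_lim.
Qed.

(** Inclusion-exclusion on the scale [x]: 1 + 1 - (2 - gamma) = gamma. *)
Lemma small_I : (fun n => I n / x n) @ \oo --> gamma.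
Proof.
apply: (@lim_div_approx _ _ (fun n => u1 n - U1 n + (u2 n - U2 n) - (y n - Y n))
   (fun n => 8 * (x n / D n))) => //.
- by apply: filterS est12 => n [].
- have h := lim_mul (lim_cst 8) Di0; rewrite mulr0 in h; apply: lim_near h.
  by apply: filterS x_gt0 => n xn; rewrite -mulrA; congr (_ * _); rewrite mulrAC mulfV ?mul1r ?gt_eqF.
have [_ h1] := small_UA est1 x0; have [_ h2] := small_UA est2 x0; have [_ h3] := small_Y.
have := lim_sub (lim_add h1 h2) h3; rewrite (_ : 1 + 1 - (2 - gamma) = gamma); last by ring.
by apply: lim_near; apply: nearW => n; ring.
Qed.

Lemma small_E12 : (fun n => E n / (D n * x n)) @ \oo --> gamma * rholim.
Proof.
have [Y1 _] := small_Y.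
apply: (@lim_div_approx _ _ (fun n => I n * Y n * rho n * D n) tau').
- exact: Dx_gt0.
- by apply: filterS est12 => n [].
- by rewrite div_Dx; have := lim_mul tau'0 Di0; rewrite mulr0.
have := lim_mul (lim_mul small_I Y1) rho_lim; rewrite mulr1; apply: lim_near.
apply: filterS2 (D_large 1) x_gt0 => n D1 xn.
have : D n != 0 by rewrite gt_eqF // (lt_le_trans ltr01).
by move: (D n) => d d0; field; rewrite d0 gt_eqF.
Qed.

(** The exponential factor stays of order 1 here; the bound is of order [B * x], which suffices
    against [D * x]. *)
Lemma small_cross (s s' cr : nat -> R) :
  (fun n => s n / x n) @ \oo --> (1 : R) -> (fun n => s' n / x n) @ \oo --> (1 : R) ->
  (\forall n \near \oo,
    0 <= cr n <= B n * ((s n + q n) * expR (- (s' n - 8 * (x n / D n) - q n)))) ->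
  (fun n => cr n / (D n * x n)) @ \oo --> 0.
Proof.
move=> s_1 s'_1 hc.
have h := lim_mul (lim_mul (sq_x1 s_1) Bi0) (lim_cst (expR 2)).
rewrite mulr0 mul0r in h; move: h; apply: lim_le0.
have a1 : \forall n \near \oo, q n <= 1 by apply: (lim_near_le q0 ltr01).
have a2 : \forall n \near \oo, x n / D n <= 8^-1 by apply: (lim_near_le xD0); lra.
have a3 : \forall n \near \oo, 0 <= s' n / x n by apply: (lim_near_ge s'_1); lra.
have a4 : \forall n \near \oo, 0 <= s n / x n by apply: (lim_near_ge s_1); lra.
apply: filterS3 (filterI (filterI a1 a2) (filterI a3 a4)) (filterI (B_large 1) (filterI q_ge0 x_gt0)) hc.
move=> n [[h1 h2] [h3 h4]] [B1 [qn xn]] /andP[c0 c1].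
rewrite ler_pdivlMr // mul0r in h3; rewrite ler_pdivlMr // mul0r in h4.
have B0 : 0 < B n by lra.
have D0 : 0 < D n by rewrite exprn_gt0.
rewrite ger0_norm; last by apply: divr_ge0 => //; apply: mulr_ge0; exact: ltW.
rewrite ler_pdivrMr; last exact: mulr_gt0.
apply: le_trans c1 _.
rewrite [leRHS](_ : _ = B n ^+ 3 * ((s n + q n) * expR 2)); last first.
  by field; rewrite !gt_eqF.
apply: ler_pM; [lra| | |].
- by apply: mulr_ge0; [exact: addr_ge0|exact: expR_ge0].
- by rewrite exprS; apply: ler_peMr; [lra|exact: exprn_ege1].
apply: ler_wpM2l; first exact: addr_ge0.
by rewrite ler_expR; lra.
Qed.

Lemma small_T12 : (fun n => T n / (D n * x n)) @ \oo --> gamma * rholim.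
Proof.
apply: total_split.
- exact: Dx_gt0.
- have := lim_mul Di0 Di0; rewrite mulr0; apply: lim_near.
  apply: filterS2 (D_large 1) x_gt0 => n D1 xn.
  have : D n != 0 by rewrite gt_eqF // (lt_le_trans ltr01).
  by move: (D n) => d d0; field; rewrite d0 gt_eqF.
- exact: (small_tl est1).
- exact: (small_tl est2).
- apply: (small_cross (s_x1 est1) (s_x1 est2)); by apply: filterS est12 => n [].
- apply: (small_cross (s_x1 est2) (s_x1 est1)); by apply: filterS est12 => n [].
have h := lim_mul ce_x Di0; rewrite mulr0 in h.
have := lim_add h small_E12; rewrite add0r; apply: lim_near; apply: nearW => n.
by rewrite mulrDl; congr (_ + _); rewrite invfM mulrA mulrAC.
Qed.

End SmallX2.

Section MiddleX2.
Context (la eta xi : R).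
Hypothesis la_lim : (fun n => expR (- x n)) @ \oo --> la.
Hypothesis la1 : la < 1.
Hypothesis eta_lim : (fun n => x n / (D n * expR (- x n))) @ \oo --> eta.
Hypothesis xi_lim : (fun n => expR (- (x n * (1 - rho n * rhom n)))) @ \oo --> xi.
Notation lam n := (expR (- x n)).

Lemma Q_diff : (fun n => Q n - x n * (2 - rho n * rhom n)) @ \oo --> 0.
Proof.
have h := lim_add (lim_mul (lim_cst 280) (x_eps0 eta_lim)) (lim_mul (lim_cst 4) qx0).
rewrite !mulr0 addr0 in h; move: h; apply: lim_le0.
by apply: filterS est12 => n [hQ *]; rewrite mulrA.
Qed.

(** By [Q_diff], [x - Q] is [- x (1 - rho * rhom)] up to a vanishing error, which is where [xi]
    comes from. *)
Lemma middle_Y : (fun n => Y n / lam n) @ \oo --> xi.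
Proof.
apply: (@survivors_ratio Q y Y p xi).
- exact: y_1.
- by apply: filterS est12 => n [].
- by apply: filterS est12 => n [].
- have h := lim_mul xi_lim (lim_exp (lim_opp Q_diff)); rewrite oppr0 expR0 mulr1 in h.
  apply: lim_near h; apply: nearW => n; rewrite -expRD; congr expR; ring.
- have h := lim_add (lim_mul q0 Q_diff) (lim_mul qx0 (lim_sub (lim_cst 2) gamma_lim)).
  rewrite !mul0r addr0 in h; apply: lim_near h; apply: nearW => n; ring.
exact: (tau_lam0 eta_lim).
Qed.

Lemma middle_Yla : Y @ \oo --> xi * la.
Proof.
have := lim_mul middle_Y la_lim; apply: lim_near.
by apply: nearW => n; rewrite divfK // gt_eqF // expR_gt0.
Qed.

(** Inclusion-exclusion with limits [1 - la] for each sphere and [1 - xi * la] for their union. *)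
Lemma middle_I : I @ \oo --> 1 - (2 - xi) * la.
Proof.
have h := lim_mul (lim_cst 8) xD0; rewrite mulr0 in h.
apply: (@lim_approx _ _ (fun n => u1 n - U1 n + (u2 n - U2 n) - (y n - Y n)) _ _ _ h).
  by apply: filterS est12 => n [].
have := lim_sub (lim_add (middle_A est1 la_lim eta_lim) (middle_A est2 la_lim eta_lim))
  (lim_sub y_1 middle_Yla).
by rewrite (_ : 1 - la + (1 - la) - (1 - xi * la) = 1 - (2 - xi) * la) //; ring.
Qed.

Lemma middle_E12 : (fun n => E n / (D n * lam n)) @ \oo --> (1 - (2 - xi) * la) * xi * rholim.
Proof.
apply: (@lim_div_approx _ _ (fun n => I n * Y n * rho n * D n) tau').
- exact: Dlam_gt0.
- by apply: filterS est12 => n [].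
- exact: (tau'_Dlam0 eta_lim).
have := lim_mul (lim_mul middle_I middle_Y) rho_lim; apply: lim_near.
apply: filterS (D_large 1) => n D1.
have : D n != 0 by rewrite gt_eqF // (lt_le_trans ltr01).
have : lam n != 0 by rewrite gt_eqF // expR_gt0.
by move: (D n) (lam n) => d l l0 d0; field; rewrite d0 l0.
Qed.

(** The bound has order [B * x * lam], and its ratio to [D * lam] is [x / B] times [B^-2]. The
    exponent has to be known up to [o(1)], hence the hypothesis on the difference [x - s']. *)
Lemma middle_cross (s s' cr : nat -> R) :
  (fun n => s n / x n) @ \oo --> (1 : R) -> (fun n => x n - s' n) @ \oo --> 0 ->
  (\forall n \near \oo,
    0 <= cr n <= B n * ((s n + q n) * expR (- (s' n - 8 * (x n / D n) - q n)))) ->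
  (fun n => cr n / (D n * lam n)) @ \oo --> 0.
Proof.
move=> s_1 s'_0 hc.
have h := lim_mul (lim_mul (sq_x1 s_1) (lim_mul (x_B0 eta_lim) (lim_mul Bi0 Bi0)))
  (lim_exp (lim_add s'_0 (lim_add (lim_mul (lim_cst 8) xD0) q0))).
rewrite !mul0r mulr0 mul0r in h; move: h; apply: lim_le0.
apply: filterS3 (B_large 1) x_gt0 hc => n B1 xn /andP[c0 c1].
have B0 : 0 < B n by lra.
have D0 : 0 < D n by rewrite exprn_gt0.
have l0 : 0 < lam n by exact: expR_gt0.
rewrite ger0_norm; last by apply: divr_ge0 => //; apply: mulr_ge0; exact: ltW.
rewrite ler_pdivrMr; last exact: mulr_gt0.
apply: le_trans c1 _; rewrite le_eqVlt; apply/orP; left; apply/eqP.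
set V := x n - s' n + (8 * (x n / D n) + q n).
rewrite (_ : - (s' n - 8 * (x n / D n) - q n) = - x n + V); last by rewrite /V; ring.
rewrite expRD; move: (expR V) (lam n) => z1 z2.
by field; rewrite !gt_eqF.
Qed.

Lemma middle_T12 : (fun n => T n / (D n * lam n)) @ \oo -->
  gamma * eta + (1 - (2 - xi) * la) * xi * rholim.
Proof.
apply: total_split.
- exact: Dlam_gt0.
- have := lim_mul Di0 eta_lim; rewrite mul0r; apply: lim_near.
  by apply: nearW => n; ring.
- exact: (middle_tl est1 la_lim la1 eta_lim).
- exact: (middle_tl est2 la_lim la1 eta_lim).
- apply: (middle_cross (s_x1 est1) (s_x0 est2 eta_lim)); by apply: filterS est12 => n [].
- apply: (middle_cross (s_x1 est2) (s_x0 est1 eta_lim)); by apply: filterS est12 => n [].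
have := lim_add (over_x_Dlam eta_lim ce_x) middle_E12; apply: lim_near; apply: nearW => n.
by rewrite mulrDl.
Qed.

End MiddleX2.
End TwoGraphLimits.
End Regimes.

Lemma lim_similarity (R : realType) (T T1 T2 z : nat -> R) (k l : R) :
  (\forall n \near \oo, 0 < z n) -> 0 < k ->
  (fun n => T1 n / z n) @ \oo --> k -> (fun n => T2 n / z n) @ \oo --> k ->
  (fun n => T n / z n) @ \oo --> l ->
  (fun n => T n / Num.sqrt (T1 n * T2 n)) @ \oo --> l / k.
Proof.
move=> z0 k0 h1 h2 h.
have hs : (fun n => Num.sqrt (T1 n / z n * (T2 n / z n))) @ \oo --> k.
  have -> : k = Num.sqrt (k * k) by rewrite -expr2 sqrtr_sqr gtr0_norm.
  by apply: (continuous_cvg _ _ (lim_mul h1 h2)); exact: sqrt_continuous.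
have kn : k != 0 by rewrite gt_eqF.
have := lim_mul h (lim_inv kn hs); apply: lim_near.
apply: filterS z0 => n zn.
have -> : T1 n / z n * (T2 n / z n) = T1 n * T2 n * (z n)^-1 ^+ 2 by ring.
have zi : 0 <= (z n)^-1 by rewrite invr_ge0 ltW.
rewrite (_ : Num.sqrt (T1 n * T2 n * _) = (z n)^-1 * Num.sqrt (T1 n * T2 n)); last first.
  by rewrite [T1 n * T2 n * _]mulrC sqrtrM ?sqr_ge0 // sqrtr_sqr ger0_norm.
by rewrite invfM invrK mulrA divfK ?gt_eqF.
Qed.

(** * Asymptotics of the parameters *)

Lemma limn_einf_gt0_near (R : realType) (u : nat -> R) :
  (0 < limn_einf (fun n => (u n)%:E))%E -> exists2 c, 0 < c & \forall n \near \oo, c <= u n.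
Proof.
rewrite -[limn_einf _]/(limf_einf _ \oo) limf_einfE.
move=> /ereal_sup_gt[_ [V FV <-]] h.
have lb n : V n -> (ereal_inf [set (u m)%:E | m in V] <= (u n)%:E)%E.
  by move=> Vn; apply: ereal_inf_lbound; exists n.
move: h lb; case: (ereal_inf _) => [r||] // h lb.
  by exists r; [rewrite -lte_fin|apply: filterS FV => n /lb; rewrite lee_fin].
by exists 1 => //; apply: filterS FV => n /lb.
Qed.

Lemma limn_esup_ltey_near (R : realType) (u : nat -> R) :
  (limn_esup (fun n => (u n)%:E) < +oo)%E -> exists C, \forall n \near \oo, u n <= C.
Proof.
rewrite /limn_esup limf_esupE => /ereal_inf_lt[_ [V FV <-]] h.
have ub n : V n -> ((u n)%:E <= ereal_sup [set (u m)%:E | m in V])%E.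
  by move=> Vn; apply: ereal_sup_ubound; exists n.
move: h ub; case: (ereal_sup _) => [r||] // h ub.
  by exists r; apply: filterS FV => n /ub; rewrite lee_fin.
by exists 0; apply: filterS FV => n /ub.
Qed.

Lemma lim_ln_nat (R : realType) : (fun n => ln n%:R : R) @ \oo --> +oo.
Proof.
apply/cvgryPge => A; apply: filterS (nbhs_infty_ger (expR A)) => n h.
by rewrite -ler_expR lnK // posrE (lt_le_trans (expR_gt0 A)).
Qed.

Lemma lim_ln_pinfty (R : realType) (f : nat -> R) : f @ \oo --> +oo ->
  (fun n => ln (f n)) @ \oo --> +oo.
Proof.
move=> /cvgryPge foo; apply/cvgryPge => A; apply: filterS (foo (expR A)) => n h.
by rewrite -ler_expR lnK // posrE (lt_le_trans (expR_gt0 A)).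
Qed.

(** Each of the [k] terms of [1 + r + ... + r^(k-1)] is at least [r^k], and this sum times [1 - r]
    is [1 - r^k]. *)
Lemma mul_pow_le1 (R : realType) (r : R) (k : nat) : 0 <= r <= 1 ->
  k%:R * ((1 - r) * r ^+ k) <= 1 - r ^+ k.
Proof.
move=> /andP[r0 r1]; elim: k => [|k IH]; first by rewrite mul0r expr0 subrr.
have p0 : 0 <= r ^+ k by rewrite exprn_ge0.
have p1 : r ^+ k <= 1 by rewrite exprn_ile1.
have h : r * (k%:R * ((1 - r) * r ^+ k)) <= r * (1 - r ^+ k) by apply: ler_wpM2l.
have h2 : (1 - r) * (r * r ^+ k) <= (1 - r) * 1.
  by apply: ler_wpM2l; [lra|rewrite -exprS exprn_ile1].
by rewrite exprS -natr1; move: h h2; move: (r ^+ k) (k%:R : R) => z c; lra.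
Qed.

Lemma pow_diff_le (R : realType) (a b : R) (k : nat) : 0 <= a <= 1 -> 0 <= b <= 1 -> a <= b ->
  `|b ^+ k - a ^+ k| <= k%:R * (b - a).
Proof.
move=> /andP[a0 a1] /andP[b0 b1] ab; rewrite ger0_norm; last first.
  by rewrite subr_ge0; apply: lerXn2r; rewrite ?nnegrE.
elim: k => [|k IH]; first by rewrite !expr0 subrr mul0r.
have p0 : 0 <= a ^+ k by rewrite exprn_ge0.
have p1 : a ^+ k <= 1 by rewrite exprn_ile1.
have d0 : 0 <= b ^+ k - a ^+ k by rewrite subr_ge0; apply: lerXn2r; rewrite ?nnegrE.
have h1 : b * (b ^+ k - a ^+ k) <= 1 * (b ^+ k - a ^+ k) by apply: ler_wpM2r.
have h2 : (b - a) * a ^+ k <= (b - a) * 1 by apply: ler_wpM2l => //; rewrite subr_ge0.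
by rewrite !exprS -natr1 mulrDl mul1r; move: h1 h2 IH; move: (k%:R * _) (a ^+ k) (b ^+ k) => z y t; lra.
Qed.

Section Scales.
Context (R : realType) (alpha rho : nat -> R).
Hypothesis alpha_gt0 : forall n, 0 < alpha n.
Hypothesis alpha_liminf : (0 < limn_einf (fun n => (alpha n)%:E))%E.
Hypothesis alpha_limsup : (limn_esup (fun n => (alpha n)%:E) < +oo)%E.
Hypothesis rho_in : forall n, 0 < rho n < 1.

Definition degree (n : nat) : R := n%:R * q_ alpha n.
Definition degree4 (n : nat) : R := Num.sqrt (Num.sqrt (degree n)).
Definition radius (n : nat) : nat := (`|dstar alpha n|%N).-1.
Definition xseq (n : nat) : R := (degree4 n ^+ 4) ^+ (radius n).+1 / n%:R.
(** Conditional probability that an edge of the first graph is also in the second: it is kept, or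
    resampled and drawn again. This, rather than [rho], is the factor of the recursion for the
    common part of the spheres. *)
Definition keep (n : nat) : R := rho n + (1 - rho n) * q_ alpha n.

Lemma near_pos : \forall n \near \oo, 0 < n%:R :> R.
Proof.
by apply: filterS (nbhs_infty_ger (1 : R)) => n; apply: lt_le_trans; rewrite ltr01.
Qed.

Lemma degreeE : \forall n \near \oo, degree n = alpha n * ln n%:R.
Proof.
by apply: filterS near_pos => n n0; rewrite /degree /q_ mulrC divfK // gt_eqF.
Qed.

Lemma degree_ge : exists2 c, 0 < c & \forall n \near \oo, c * ln n%:R <= degree n.
Proof.
have [c c0 hc] := limn_einf_gt0_near alpha_liminf; exists c => //.
have l0 : \forall n \near \oo, 0 <= ln n%:R :> R by move/cvgryPge: (@lim_ln_nat R); apply.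
by apply: filterS3 hc degreeE l0 => n h1 -> h2; apply: ler_wpM2r.
Qed.

Lemma degree_oo : degree @ \oo --> +oo.
Proof.
have [c c0 hc] := degree_ge; apply: (lim_pinfty_ge hc); apply/cvgryPge => A.
have : \forall n \near \oo, A / c <= ln n%:R by move/cvgryPge: (@lim_ln_nat R); apply.
by apply: filterS => n; rewrite ler_pdivrMr // mulrC.
Qed.

Lemma degree4E : \forall n \near \oo, degree4 n ^+ 4 = degree n.
Proof.
have : \forall n \near \oo, 0 <= degree n by move/cvgryPge: degree_oo; apply.
apply: filterS => n d0; rewrite -[4%N]/(2 * 2)%N exprM /degree4.
by rewrite sqr_sqrtr ?sqrtr_ge0 // sqr_sqrtr.
Qed.

Lemma degree4_oo : degree4 @ \oo --> +oo.
Proof.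
apply/cvgryPge => A.
have : \forall n \near \oo, `|A| ^+ 4 <= degree n by move/cvgryPge: degree_oo; apply.
apply: filterS => n h; apply: le_trans (ler_norm A) _.
have -> : `|A| = Num.sqrt (Num.sqrt (`|A| ^+ 4)).
  by rewrite -[4%N]/(2 * 2)%N exprM sqrtr_sqr (ger0_norm (exprn_ge0 2 (normr_ge0 A))) sqrtr_sqr normr_id.
rewrite /degree4 ler_sqrt ?sqrtr_ge0 // ler_sqrt //; apply: le_trans h; exact: exprn_ge0.
Qed.

(** The degree is O(log n), and a fixed power of log n is negligible against n. Hence [dstar] tends
    to infinity. *)
Lemma degree_pow_small (M : nat) :
  \forall n \near \oo, degree n ^+ M < n%:R / (ln (ln n%:R)) ^+ 2.
Proof.
have [C hC] := limn_esup_ltey_near alpha_limsup.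
pose K := (`|C| + 1) ^+ M.
have K0 : 0 < K by rewrite exprn_gt0 // ltr_wpDl.
have lo := @lim_ln_nat R.
have dec := lim_exp_decay M.+2 ltr01 lo.
have d : \forall n \near \oo, ln n%:R ^+ M.+2 * expR (- (1 * ln n%:R)) <= (2 * K)^-1.
  by apply: (lim_near_le dec); rewrite invr_gt0 mulr_gt0.
have l1 : \forall n \near \oo, 1 <= ln n%:R :> R by move/cvgryPge: lo; apply.
have ll1 : \forall n \near \oo, 1 <= ln (ln n%:R) :> R.
  by move/cvgryPge: (lim_ln_pinfty lo); apply.
apply: filterS3 (filterI hC d) (filterI degreeE near_pos) (filterI l1 ll1).
move=> n [aC hd] [dE n0] [L1 l1n]; rewrite ltr_pdivlMr; last by rewrite exprn_gt0 //; lra.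
set L := ln n%:R in hd dE L1 l1n *.
have L0 : 0 < L by lra.
have lL : ln L <= L by apply: ltW; exact: ln_sublinear.
rewrite mul1r expRN lnK ?posrE // ler_pdivrMr // in hd.
have a0 := alpha_gt0 n.
have dK : degree n ^+ M <= K * L ^+ M.
  rewrite dE exprMn; apply: ler_wpM2r; first by apply: exprn_ge0; lra.
  apply: lerXn2r; rewrite ?nnegrE ?addr_ge0 ?(ltW a0) //.
  by have := ler_norm C; lra.
have l2 : ln L ^+ 2 <= L ^+ 2 by apply: lerXn2r; rewrite ?nnegrE; lra.
apply: (@le_lt_trans _ _ (K * L ^+ M.+2)).
  rewrite -[M.+2]addn2 exprD [leRHS]mulrA.
  have dM0 : 0 <= degree n ^+ M by rewrite dE; apply: exprn_ge0; apply: mulr_ge0; lra.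
  exact: (ler_pM dM0 (sqr_ge0 _) dK l2).
have : K * L ^+ M.+2 <= K * ((2 * K)^-1 * n%:R) by apply: ler_wpM2l => //; exact: ltW.
move=> /le_lt_trans; apply; rewrite (_ : K * _ = n%:R / 2); first by lra.
by field; rewrite gt_eqF.
Qed.

Lemma dstar_large (M : nat) : \forall n \near \oo,
  [/\ dstar alpha n = (radius n).+1%:Z, (M <= radius n)%N,
      n%:R / (ln (ln n%:R)) ^+ 2 <= degree n ^+ (radius n).+1 &
      degree n ^+ radius n < n%:R / (ln (ln n%:R)) ^+ 2].
Proof.
have d2 : \forall n \near \oo, 2 <= degree n by move/cvgryPge: degree_oo; apply.
have ll1 : \forall n \near \oo, 1 <= ln (ln n%:R) :> R.
  by move/cvgryPge: (lim_ln_pinfty (@lim_ln_nat R)); apply.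
apply: filterS3 d2 ll1 (degree_pow_small M) => n D2 l1 hM.
have D0 : 0 < degree n by apply: lt_le_trans D2; rewrite ltr0n.
have D1 : 1 <= degree n by apply: le_trans D2; rewrite ler1n.
have [hd hmin] := @dstarP R alpha n (lt_le_trans ltr01 l1)
  (lt_le_trans (ltr1n R 2) D2 : 1 < n%:R * q_ alpha n).
rewrite /dstar_set /= -/(degree n) in hd hmin.
have Md : (M%:Z < dstar alpha n)%R.
  rewrite ltNge; apply/negP => le.
  by have := le_trans hd (ler_weXz2l D1 le); rewrite leNgt -exprnP hM.
have dE : dstar alpha n = (radius n).+1%:Z.
  by rewrite /radius; case: (dstar alpha n) Md => [[|k]|k] //.
rewrite dE in hd Md; split => //; rewrite ltNge; apply/negP => h.
by have := hmin (radius n)%:Z h; rewrite dE lez_nat ltnn.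
Qed.

Notation B := degree4.
Notation x := xseq.
Notation m := radius.
Notation q := (q_ alpha).
Notation tau := (fun n => B n ^+ (3 * (m n).+1) / n%:R).
Notation tau' := (fun n => B n ^+ (3 * (m n).+2) / n%:R).

(* The facts on the parameters that hold for all large n. *)
Lemma regime : \forall n \near \oo, [/\ 4 <= B n, (5 <= m n)%N, 1 <= n%:R :> R,
  degree n = B n ^+ 4 & [/\ 1 <= ln (ln n%:R) :> R, dstar alpha n = (m n).+1%:Z,
  n%:R / (ln (ln n%:R)) ^+ 2 <= (B n ^+ 4) ^+ (m n).+1 &
  (B n ^+ 4) ^+ m n < n%:R / (ln (ln n%:R)) ^+ 2]].
Proof.
have B4 : \forall n \near \oo, 4 <= B n by move/cvgryPge: degree4_oo; apply.
have ll1 : \forall n \near \oo, 1 <= ln (ln n%:R) :> R.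
  by move/cvgryPge: (lim_ln_pinfty (@lim_ln_nat R)); apply.
apply: filterS3 (filterI B4 degree4E) (filterI (nbhs_infty_ger (1 : R)) ll1) (dstar_large 5).
by move=> n [h1 h2] [h3 h4] [h5 h6 h7 h8]; split => //; rewrite h2.
Qed.

Lemma n_ge_pow n : 1 <= n%:R :> R -> 1 <= ln (ln n%:R) :> R ->
  (B n ^+ 4) ^+ m n < n%:R / (ln (ln n%:R)) ^+ 2 -> (B n ^+ 4) ^+ m n <= n%:R.
Proof.
move=> n1 l1 /ltW h; apply: le_trans h _; rewrite ler_pdivrMr ?exprn_gt0 ?(lt_le_trans ltr01) //.
by rewrite ler_peMr ?exprn_ege1 // (le_trans ler01).
Qed.

Lemma xseq_gt0 : \forall n \near \oo, 0 < x n.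
Proof.
apply: filterS regime => n [B4 _ n1 _ _]; apply: divr_gt0; last exact: lt_le_trans n1.
by rewrite !exprn_gt0 // (lt_le_trans _ B4).
Qed.

(** Minimality of [dstar]: one power less stays below the threshold, so [x / D < (log log n)^-2]. *)
Lemma xseq_D0 : (fun n => x n / B n ^+ 4) @ \oo --> 0.
Proof.
have li := lim_pinfty_inv (lim_ln_pinfty (@lim_ln_nat R)); move: li; apply: lim_le0.
apply: filterS2 regime xseq_gt0 => n [B4 _ n1 _ [l1 _ _ h]] x0.
have D0 : 0 < B n ^+ 4 by rewrite exprn_gt0 // (lt_le_trans _ B4).
have n0 : 0 < n%:R :> R by exact: lt_le_trans n1.
have l0 : 0 < ln (ln n%:R) :> R by exact: lt_le_trans l1.
rewrite ger0_norm; last by apply: divr_ge0; exact: ltW.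
rewrite /xseq.
have -> : (B n ^+ 4) ^+ (m n).+1 / n%:R / B n ^+ 4 = (B n ^+ 4) ^+ m n / n%:R.
  by rewrite [_ ^+ (m n).+1]exprSr [LHS]mulrAC mulfK ?gt_eqF.
rewrite ler_pdivrMr //; apply: le_trans (ltW h) _; rewrite mulrC; apply: ler_wpM2r; first exact: ltW.
rewrite lef_pV2 ?posrE ?exprn_gt0 // expr2.
by apply: ler_peMr => //; exact: ltW.
Qed.

(** The threshold gives [x >= (log log n)^-2], and [(log log n)^8] is eventually below a multiple of
    log n that bounds the degree [B ^+ 4] from below. *)
Lemma xseq_B1 : \forall n \near \oo, 1 <= x n * B n.
Proof.
have [c c0 hc] := degree_ge.
have dec := lim_exp_decay 8 ltr01 (lim_ln_pinfty (@lim_ln_nat R)).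
have d := lim_near_le dec c0.
have l1 : \forall n \near \oo, 1 <= ln n%:R :> R by move/cvgryPge: (@lim_ln_nat R); apply.
apply: filterS3 regime (filterI hc d) l1 => n [B4 _ n1 dE [ll1 _ h _]] [hD hd] L1.
have B0 : 0 < B n by apply: lt_le_trans B4; rewrite ltr0n.
have l0 : 0 < ln (ln n%:R) :> R by exact: lt_le_trans ll1.
have L0 : 0 < ln n%:R :> R by exact: lt_le_trans L1.
have n0 : 0 < n%:R :> R by exact: lt_le_trans n1.
rewrite mul1r expRN lnK ?posrE // ler_pdivrMr // in hd.
have lB : ln (ln n%:R) ^+ 2 <= B n.
  rewrite -(@ler_pXn2r _ 4) ?nnegrE ?exprn_ge0 ?(ltW B0) ?(ltW l0) //.
  by rewrite -exprM -dE; exact: le_trans hd hD.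
have xl : (ln (ln n%:R) ^+ 2)^-1 <= x n.
  by rewrite /xseq ler_pdivlMr // mulrC.
rewrite -(@mulVf _ (ln (ln n%:R) ^+ 2 : R)) ?gt_eqF ?exprn_gt0 //.
by apply: ler_pM => //; rewrite ?invr_ge0 exprn_ge0 // ltW.
Qed.

Lemma Bi_lim : (fun n => (B n)^-1) @ \oo --> 0.
Proof. exact: (lim_pinfty_inv degree4_oo). Qed.

(** As [q = D / n] and [D ^+ m <= n], the claim reduces to [(m + 1) * B ^+ 9 <= B ^+ (4 * m)]; use
    [m + 1 <= 2 ^+ m <= B ^+ m]. The factor [m + 1] is the price of replacing [rho] by [keep] in a
    power of exponent [m + 1]. *)
Lemma qD_le : \forall n \near \oo,
  0 <= q n /\ (m n).+1%:R * (q n * B n ^+ 4) <= (B n)^-1.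
Proof.
apply: filterS regime => n [B4 m5 n1 dE [l1 _ _ h]].
have n0 : 0 < n%:R :> R by exact: lt_le_trans n1.
have B0 : 0 < B n by apply: lt_le_trans B4; rewrite ltr0n.
have B1 : 1 <= B n by apply: le_trans B4; rewrite ler1n.
have qE : q n = B n ^+ 4 / n%:R by rewrite -dE /degree mulrAC divff ?mul1r ?gt_eqF.
have Dm := n_ge_pow n1 l1 h.
split; first by rewrite qE divr_ge0 ?exprn_ge0 ?(ltW n0) ?(ltW B0).
have mB : (m n).+1%:R <= B n ^+ m n.
  apply: (@le_trans _ _ (2 ^+ m n)); first by rewrite -natrX ler_nat ltn_expl.
  by apply: lerXn2r; rewrite ?nnegrE ?(ltW B0) // (le_trans _ B4) // ler_nat.
rewrite qE -[leRHS]mul1r ler_pdivlMr // [leLHS](_ : _ = (m n).+1%:R * B n ^+ 9 / n%:R); last by ring.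
rewrite ler_pdivrMr // mul1r; apply: le_trans Dm; rewrite -exprM.
apply: (@le_trans _ _ (B n ^+ m n * B n ^+ 9)).
  by apply: ler_wpM2r => //; rewrite exprn_ge0 // ltW.
by rewrite -exprD; apply: ler_weXn2l => //; lia.
Qed.

Lemma mqD0 : (fun n => (m n).+1%:R * (q n * B n ^+ 4)) @ \oo --> 0.
Proof.
apply: (lim_le0 _ Bi_lim); apply: filterS2 qD_le regime => n [q0 h] [B4 _ _ _ _].
rewrite ger0_norm // mulr_ge0 // mulr_ge0 // exprn_ge0 // (le_trans _ B4) //.
Qed.

Lemma qseq_ge0 : \forall n \near \oo, 0 <= q n.
Proof. by apply: filterS qD_le => n []. Qed.

Lemma qD_lim : (fun n => q n * B n ^+ 4) @ \oo --> 0.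
Proof.
apply: (lim_le0 _ mqD0); apply: filterS2 qseq_ge0 regime => n q0 [B4 _ _ _ _].
have z0 : 0 <= q n * B n ^+ 4 by rewrite mulr_ge0 // exprn_ge0 // (le_trans _ B4).
by rewrite ger0_norm // ler_peMl // ler1n.
Qed.

Lemma tau_ge0' : \forall n \near \oo, 0 <= tau n.
Proof.
by apply: filterS regime => n [B4 _ n1 _ _]; rewrite divr_ge0 ?exprn_ge0 // (le_trans _ B4).
Qed.

(** The exponent of [B] is [4 + 3 (m + k + 1) - 4 (m + 1) = 3 - m + 3 k], so [m >= 4] is enough; the
    bound [5 <= m] of [regime] covers it. *)
Lemma tau_over_x (k : nat) : (k <= 1)%N -> \forall n \near \oo,
  `|B n ^+ 4 * (B n ^+ (3 * (m n + k).+1) / n%:R) / x n| <= (B n)^-1 * B n ^+ (3 * k).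
Proof.
move=> k1; apply: filterS regime => n [B4 m5 n1 _ _].
have B0 : 0 < B n by apply: lt_le_trans B4; rewrite ltr0n.
have B1 : 1 <= B n by apply: le_trans B4; rewrite ler1n.
have n0 : 0 < n%:R :> R by exact: lt_le_trans n1.
have -> : B n ^+ 4 * (B n ^+ (3 * (m n + k).+1) / n%:R) / x n =
    B n ^+ (4 + 3 * (m n + k).+1) / B n ^+ (4 * (m n).+1).
  have X0 : B n ^+ (4 * (m n).+1) != 0 by rewrite gt_eqF // exprn_gt0.
  have N0 : n%:R != 0 :> R by rewrite gt_eqF.
  rewrite /xseq exprD -exprM; move: X0 N0.
  move: (B n ^+ (4 * _)) (B n ^+ (3 * _)) (B n ^+ 4) (n%:R : R) => X P D N X0 N0.
  by field; rewrite X0 N0.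
rewrite ger0_norm ?divr_ge0 ?exprn_ge0 ?(ltW B0) // ler_pdivrMr ?exprn_gt0 //.
rewrite -mulrA -exprD -[leRHS]mulrC ler_pdivlMr // -exprSr.
by apply: ler_weXn2l => //; lia.
Qed.

Lemma tau_lim1 : (fun n => B n ^+ 4 * tau n / x n) @ \oo --> 0.
Proof.
have := Bi_lim; apply: lim_le0; apply: filterS (tau_over_x (leq0n 1)) => n.
by rewrite addn0 muln0 expr0 mulr1.
Qed.

Lemma tau'_lim : (fun n => tau' n / x n) @ \oo --> 0.
Proof.
have := Bi_lim; apply: lim_le0; apply: filterS2 (tau_over_x (leqnn 1)) regime => n.
rewrite addn1 => h [B4 _ _ _ _].
have B1 : 1 <= B n by apply: le_trans B4; rewrite ler1n.
have B0 : 0 < B n by exact: lt_le_trans B1.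
rewrite -mulrA normrM [`|B n ^+ 4|]ger0_norm ?exprn_ge0 ?(ltW B0) // in h.
have D0 : 0 < B n ^+ 4 by rewrite exprn_gt0.
rewrite -(ler_pM2l D0); apply: le_trans h _; rewrite mulrC; apply: ler_wpM2r.
  by rewrite invr_ge0 ltW.
by apply: ler_weXn2l.
Qed.

Lemma keep_in : \forall n \near \oo, [/\ 0 <= rho n <= 1, 0 <= keep n <= 1, rho n <= keep n &
  keep n - rho n <= q n].
Proof.
apply: filterS2 qseq_ge0 (lim_near_le (q0 degree4_oo qseq_ge0 qD_lim) ltr01) => n q0 q1.
have /andP[r0 r1] := rho_in n; rewrite /keep.
have h : (1 - rho n) * q n <= (1 - rho n) * 1 by apply: ler_wpM2l => //; lra.
have h2 : (1 - rho n) * q n <= 1 * q n by apply: ler_wpM2r => //; lra.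
have h3 : 0 <= (1 - rho n) * q n by rewrite mulr_ge0 //; lra.
by split; rewrite ?(ltW r0) ?(ltW r1) //=; lra.
Qed.

Lemma gamma_diff : \forall n \near \oo,
  `|keep n * keep n ^+ m n - gamma_ alpha rho n| <= (m n).+1%:R * q n.
Proof.
apply: filterS2 regime keep_in => n [_ _ _ _ [_ dE _ _]] [r k rk kq].
rewrite /gamma_ dE -exprS -exprnP; apply: le_trans (pow_diff_le _ r k rk) _.
by apply: ler_wpM2l.
Qed.

Lemma mq0 : (fun n => (m n).+1%:R * q n) @ \oo --> 0.
Proof.
apply: (lim_le0 _ mqD0); apply: filterS2 qseq_ge0 regime => n q0 [B4 _ _ _ _].
have z0 : 0 <= (m n).+1%:R * q n by apply: mulr_ge0.
rewrite ger0_norm // mulrA; apply: ler_peMr => //; apply: exprn_ege1.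
by apply: le_trans B4; rewrite ler1n.
Qed.

Lemma keep_gamma (gamma : R) : gamma_ alpha rho n @[n --> \oo] --> gamma ->
  (fun n => keep n * keep n ^+ m n) @ \oo --> gamma.
Proof. exact: (lim_approx gamma_diff mq0). Qed.

Lemma keep_lim (rholim : R) : rho n @[n --> \oo] --> rholim -> keep @ \oo --> rholim.
Proof.
apply: (lim_approx _ (q0 degree4_oo qseq_ge0 qD_lim)).
by apply: filterS keep_in => n [_ _ h1 h2]; rewrite ger0_norm // subr_ge0.
Qed.

Lemma lambda_x : \forall n \near \oo, lambda_ alpha n = expR (- x n).
Proof.
apply: filterS regime => n [_ _ _ dg [_ dE _ _]].
by rewrite /lambda_ dE -/(degree n) dg /xseq.
Qed.

(** The error on gamma is multiplied by [x] in the exponent. As [x <= D], the product is at most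
    [(m + 1) * q * D], which tends to 0. *)
Lemma keep_xi (xi : R) : lambda_ alpha n `^ (1 - gamma_ alpha rho n) @[n --> \oo] --> xi ->
  (fun n => expR (- (x n * (1 - keep n * keep n ^+ m n)))) @ \oo --> xi.
Proof.
move=> h.
have d0 : (fun n => x n * (keep n * keep n ^+ m n - gamma_ alpha rho n)) @ \oo --> 0.
  have xD := x_le_D degree4_oo xseq_D0.
  apply: (lim_le0 _ mqD0); apply: filterS3 gamma_diff xseq_gt0 xD => n h1 x0 xd.
  rewrite normrM (gtr0_norm x0) mulrC mulrA; apply: ler_pM => //; exact: ltW.
have := lim_mul h (lim_exp d0); rewrite expR0 mulr1; apply: lim_near.
apply: filterS lambda_x => n ->; rewrite /powR gt_eqF ?expR_gt0 // expRK -expRD; congr expR.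
by move: (x n) (gamma_ alpha rho n) (keep n * _) => a b c; ring.
Qed.

(** With [k = dstar], [k (1 - rho) rho^k <= 1] and [k] tends to infinity, so [(1 - rho) * gamma]
    vanishes in the limit. *)
Lemma gamma_rho (gamma rholim : R) : gamma_ alpha rho n @[n --> \oo] --> gamma ->
  rho n @[n --> \oo] --> rholim -> gamma * rholim = gamma.
Proof.
move=> hg hr.
have moo : (fun n => (m n).+1%:R : R) @ \oo --> +oo.
  apply/cvgryPge => A; apply: filterS (dstar_large (Num.bound A)) => n [_ h _ _].
  apply: le_trans (ler_norm A) _; apply: ltW; apply: (lt_le_trans (archi_boundP (normr_ge0 A))).
  by rewrite ler_nat; apply: leq_trans (leqnSn _); move: h; rewrite /Num.bound /= normr_id.
have z : (fun n => (1 - rho n) * gamma_ alpha rho n) @ \oo --> 0.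
  apply: (lim_le0 _ (lim_pinfty_inv moo)); apply: filterS regime => n [_ _ _ _ [_ dE _ _]].
  have /andP[r0 r1] := rho_in n; have r01 : 0 <= rho n <= 1 by rewrite !ltW.
  rewrite /gamma_ dE -exprnP ger0_norm; last by rewrite mulr_ge0 ?exprn_ge0 ?subr_ge0 ?(ltW r0) ?(ltW r1).
  rewrite -[leRHS]mul1r ler_pdivlMr ?ltr0n // mulrC; apply: le_trans (mul_pow_le1 _ r01) _.
  by rewrite gerBl exprn_ge0 // ltW.
have z' := lim_mul (lim_sub (lim_cst 1) hr) hg.
have e := cvg_unique _ z' z; have : (1 - rholim) * gamma = 0 by exact: e.
by rewrite mulrBl mul1r mulrC => /eqP; rewrite subr_eq0 => /eqP <-.
Qed.

(** * The similarity along a sequence of good outcomes *)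

Section Selection.
Context (w : forall n, outcome n).
Hypothesis w_good : \forall n \near \oo, good (q n) (rho n) (B n) (m n) (w n).
Notation g1 := first_adj.
Notation g2 := second_adj.
Notation H f n := (graph_of f (w n)).
Notation O f f' k n := (#|outside (explore f f' k (w n))|%:R / n%:R : R).
Notation sS f := (fun n => q n * #|gsphere (H f n) (m n)|%:R).
Notation sT f := (fun n => #|SPD (H f n)|%:R / n%:R : R).
Notation sL f := (fun n => #|escape (~: gball (H f n) (m n).+1) (H f n) (H f n) (m n).+1|%:R / n%:R : R).
Notation sC f f' := (fun n => #|escape (gsphere (H f n) (m n)) (H f n) (H f' n) (m n)|%:R / n%:R : R).

Lemma base_near : \forall n \near \oo, [/\ (0 < n)%N, (0 < m n)%N, 0 <= q n <= 4^-1,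
  n%:R * q n = B n ^+ 4 & 2 <= B n].
Proof.
have q4 : \forall n \near \oo, q n <= 4^-1.
  by apply: (lim_near_le (q0 degree4_oo qseq_ge0 qD_lim)); rewrite invr_gt0 ltr0n.
apply: filterS3 regime qseq_ge0 q4 => n [B4 m5 n1 dE _] q0 q1; split => //.
- by rewrite -(ltr0n R); exact: lt_le_trans n1.
- exact: leq_trans m5.
- by rewrite q0 q1.
- by apply: le_trans B4; rewrite ler_nat.
Qed.

Lemma good_reg n : good (q n) (rho n) (B n) (m n) (w n) -> forall k, (k <= (m n).+1)%N ->
  [/\ regular g1 g1 (q n) 1 (B n ^+ (3 * k.+1)) k (w n),
      regular g2 g2 (q n) 1 (B n ^+ (3 * k.+1)) k (w n) &
      regular g1 g2 (q n) (rho n) (B n ^+ (3 * k.+1)) k (w n)].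
Proof.
move=> /and5P[/forallP h _ _ _ _] k km.
by have /and3P := h (Ordinal (km : (k < (m n).+2)%N)).
Qed.

Lemma estimates1 : \forall n \near \oo,
  single_estimates (B n ^+ 4) (B n) (x n) (q n) (tau n) (tau' n)
    (sS g1 n) (O g1 g1 (m n) n) (O g1 g1 (m n).+1 n) (survival (q n) 1 (explore g1 g1 (m n) (w n)))
    (#|layer_edges (H g1 n) (m n)|%:R / n%:R) (#|layer_edges (H g1 n) (m n).+1|%:R / n%:R)
    (sT g1 n) (sL g1 n).
Proof.
apply: filterS2 base_near w_good => n [n0 m0 qi qn B2] gd.
apply: (single_estimates_good n0 qi qn B2); last by have /and5P[_ h _ _ _] := gd.
by move=> k km; have [] := good_reg gd km.
Qed.

Lemma estimates2 : \forall n \near \oo,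
  single_estimates (B n ^+ 4) (B n) (x n) (q n) (tau n) (tau' n)
    (sS g2 n) (O g2 g2 (m n) n) (O g2 g2 (m n).+1 n) (survival (q n) 1 (explore g2 g2 (m n) (w n)))
    (#|layer_edges (H g2 n) (m n)|%:R / n%:R) (#|layer_edges (H g2 n) (m n).+1|%:R / n%:R)
    (sT g2 n) (sL g2 n).
Proof.
apply: filterS2 base_near w_good => n [n0 m0 qi qn B2] gd.
apply: (single_estimates_good n0 qi qn B2); last by have /and5P[_ _ h _ _] := gd.
by move=> k km; have [] := good_reg gd km.
Qed.

Lemma estimates12 : \forall n \near \oo,
  pair_estimates (B n ^+ 4) (B n) (x n) (q n) (keep n) (keep n ^+ m n) (tau n) (tau' n)
    (sS g1 n) (sS g2 n) (O g1 g1 (m n) n - O g1 g1 (m n).+1 n)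
    (O g2 g2 (m n) n - O g2 g2 (m n).+1 n) (O g1 g1 (m n).+1 n)
    (q n * #|gsphere (H g1 n) (m n) :&: gsphere (H g2 n) (m n)|%:R)
    (O g1 g2 (m n) n) (O g1 g2 (m n).+1 n)
    (survival (q n) (rho n) (explore g1 g2 (m n) (w n)))
    (hazard (q n) (rho n) (explore g1 g2 (m n) (w n)))
    (#|gsphere (H g1 n) (m n).+1 :&: gsphere (H g2 n) (m n).+1|%:R / n%:R)
    (#|layer_edges (H g1 n) (m n) :&: layer_edges (H g2 n) (m n)|%:R / n%:R)
    (#|layer_edges (H g1 n) (m n).+1 :&: layer_edges (H g2 n) (m n).+1|%:R / n%:R)
    (#|SPD (H g1 n) :&: SPD (H g2 n)|%:R / n%:R) (sL g1 n) (sL g2 n) (sC g1 g2 n) (sC g2 g1 n).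
Proof.
apply: filterS2 base_near w_good => n [n0 m0 qi qn B2] gd.
have ri : 0 <= rho n <= 1 by have /andP[r0 r1] := rho_in n; rewrite !ltW.
apply: (pair_estimates_good n0 m0 qi qn B2 ri).
- by move=> k km; have [] := good_reg gd km.
- by move=> k km; have [] := good_reg gd km.
- by move=> k km; have [] := good_reg gd km.
- by have /and5P[_ _ _ h _] := gd.
- by have /and5P[_ _ _ _ h] := gd.
Qed.

Lemma similarity_lim_of (z : nat -> R) (k l : R) : (\forall n \near \oo, 0 < z n) -> 0 < k ->
  (fun n => sT g1 n / z n) @ \oo --> k -> (fun n => sT g2 n / z n) @ \oo --> k ->
  (fun n => #|SPD (H g1 n) :&: SPD (H g2 n)|%:R / n%:R / z n) @ \oo --> l ->
  (fun n => similarity R (G1 (w n)) (G2 (w n))) @ \oo --> l / k.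
Proof.
move=> z0 k0 h1 h2 h.
have nz : \forall n \near \oo, 0 < n%:R * z n.
  by apply: filterS2 near_pos z0 => n n0 zn; exact: mulr_gt0.
have tr (f : nat -> R) (a : R) : (fun n => f n / n%:R / z n) @ \oo --> a ->
    (fun n => f n / (n%:R * z n)) @ \oo --> a.
  by move=> h'; apply: lim_near h'; apply: nearW => n; rewrite invfM mulrA.
exact: (lim_similarity nz k0 (tr _ _ h1) (tr _ _ h2) (tr _ _ h)).
Qed.

Lemma similarity_lim (lambda gamma xi rholim : R) (eta : \bar R) :
  0 <= lambda <= 1 -> 0 <= gamma <= 1 -> (0 <= eta)%E ->
  lambda_ alpha n @[n --> \oo] --> lambda ->
  gamma_ alpha rho n @[n --> \oo] --> gamma ->
  ((ln (lambda_ alpha n)^-1 / (alpha n * lambda_ alpha n * ln n%:R))%:E @[n --> \oo] --> eta) ->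
  lambda_ alpha n `^ (1 - gamma_ alpha rho n) @[n --> \oo] --> xi ->
  rho n @[n --> \oo] --> rholim ->
  (fun n => similarity R (G1 (w n)) (G2 (w n))) @ \oo -->
    (if (lambda == 1) || (eta == +oo%E) then gamma
     else rholim * (((1 - (2 - xi) * lambda) * xi + fine eta * gamma)
                    / (1 - lambda + fine eta)) : R).
Proof.
move=> /andP[la0 la1] /andP[ga0 ga1] eta0 hla hga heta hxi hrho.
have gr := gamma_rho hga hrho.
have hk := keep_gamma hga; have hkr := keep_lim hrho.
have kin : \forall n \near \oo, 0 <= keep n <= 1 by apply: filterS keep_in => n [].
have etaE : \forall n \near \oo, ln (lambda_ alpha n)^-1 / (alpha n * lambda_ alpha n * ln n%:R)
    = x n / (B n ^+ 4 * expR (- x n)).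
  apply: filterS3 lambda_x degreeE degree4E => n -> dE ->.
  have -> : ln (expR (- x n))^-1 = x n by rewrite -expRN opprK expRK.
  rewrite dE; congr (_ / _).
  by move: (expR _) (ln _) (alpha n) => a b c; ring.
have lax : (fun n => expR (- x n)) @ \oo --> lambda.
  by apply: lim_near hla; apply: filterS lambda_x => n ->.
case: eta eta0 heta => [r||] //= r0 heta; last first.
  rewrite orbT; have {}heta : (fun n => x n / (B n ^+ 4 * expR (- x n))) @ \oo --> +oo.
    move/cvgeryP: heta; apply: lim_pinfty_ge; by apply: filterS etaE => n ->.
  have Dx0 : (fun n => B n ^+ 4 * expR (- x n) / x n) @ \oo --> 0.
    have := lim_pinfty_inv heta; apply: lim_near; apply: nearW => n.
    by rewrite [RHS]invf_div.
  have xoo : x @ \oo --> +oo.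
    (* Once [D >= |A| * expR |A|], a value [x < |A|] would make the ratio [x / (D * expR (- x))] at
       most 1, although it tends to infinity. *)
    apply/cvgryPge => A; have := D_large degree4_oo (`|A| * expR `|A|).
    have e1 : \forall n \near \oo, 1 < x n / (B n ^+ 4 * expR (- x n)) by move/cvgryPgt: heta; apply.
    apply: filterS3 e1 xseq_gt0 => n h x0 hD; rewrite leNgt; apply/negP => xA.
    have xA' : x n < `|A| := lt_le_trans xA (ler_norm A).
    have A0 : 0 < `|A| := lt_trans x0 xA'.
    have D0 : 0 < B n ^+ 4 by apply: lt_le_trans hD; rewrite mulr_gt0 ?expR_gt0.
    have P0 : 0 < B n ^+ 4 * expR (- x n) by apply: mulr_gt0 => //; exact: expR_gt0.
    move: h; rewrite (ltr_pdivlMr _ _ P0) mul1r => h.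
    have h3 : B n ^+ 4 * expR (- x n) * expR (x n) < x n * expR (x n).
      by rewrite ltr_pM2r // expR_gt0.
    rewrite -mulrA -expRD addNr expR0 mulr1 in h3.
    have := le_lt_trans hD h3; rewrite ltNge => /negP; apply.
    by apply: ler_pM; rewrite ?expR_ge0 ?ler_expR ?(ltW x0) ?(ltW xA').
  rewrite -[gamma]divr1; apply: (similarity_lim_of xseq_gt0 ltr01).
  - exact: (T_x1 degree4_oo xseq_gt0 xseq_D0 qseq_ge0 qD_lim tau_ge0' tau_lim1 tau'_lim estimates1 xoo Dx0).
  - exact: (T_x1 degree4_oo xseq_gt0 xseq_D0 qseq_ge0 qD_lim tau_ge0' tau_lim1 tau'_lim estimates2 xoo Dx0).
  - exact: (large_T12 degree4_oo xseq_gt0 xseq_B1 xseq_D0 qseq_ge0 qD_lim tau_ge0' tau_lim1 tau'_lim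
       estimates1 estimates2 estimates12 kin hk xoo Dx0).
have {}heta : (fun n => x n / (B n ^+ 4 * expR (- x n))) @ \oo --> r.
  move/fine_cvgP: heta => [_ h]; apply: lim_near h.
  by apply: filterS etaE => n <-.
rewrite orbF; case: eqVneq => [l1|l1].
  have x0 : x @ \oo --> 0.
    have lax1 : (fun n => expR (- x n)) @ \oo --> (1 : R) by move: lax; rewrite l1.
    have h1 := lim_sub (lim_inv (oner_neq0 R) lax1) (lim_cst 1).
    rewrite invr1 subrr in h1; move: h1; apply: lim_le0.
    apply: filterS xseq_gt0 => n xn; rewrite gtr0_norm // -expRN opprK.
    by have := expR_ge1Dx (x n); lra.
  (* The edges leaving the sphere of radius [m + 1] dominate and carry an extra factor [rholim],
     which [gamma] absorbs. *)
  have -> : gamma = gamma * rholim / 1 by rewrite divr1 gr.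
  have zx : \forall n \near \oo, 0 < B n ^+ 4 * x n.
    by apply: Dx_gt0; [exact: degree4_oo|exact: xseq_gt0].
  apply: (similarity_lim_of zx ltr01).
  - exact: (small_T degree4_oo xseq_gt0 xseq_B1 xseq_D0 qseq_ge0 qD_lim tau_ge0' tau_lim1 tau'_lim estimates1 x0).
  - exact: (small_T degree4_oo xseq_gt0 xseq_B1 xseq_D0 qseq_ge0 qD_lim tau_ge0' tau_lim1 tau'_lim estimates2 x0).
  - exact: (small_T12 degree4_oo xseq_gt0 xseq_B1 xseq_D0 qseq_ge0 qD_lim tau_ge0' tau_lim1 tau'_lim
       estimates1 estimates2 estimates12 kin hk hkr x0 ga1).
have ll1 : lambda < 1 by rewrite lt_neqAle l1.
have rr : 0 <= r by rewrite -lee_fin.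
have k0 : 0 < 1 - lambda + r by lra.
have -> : rholim * (((1 - (2 - xi) * lambda) * xi + r * gamma) / (1 - lambda + r)) =
   (gamma * r + (1 - (2 - xi) * lambda) * xi * rholim) / (1 - lambda + r).
  by rewrite -[in RHS]gr; ring.
have zl : \forall n \near \oo, 0 < B n ^+ 4 * expR (- x n) by apply: Dlam_gt0; exact: degree4_oo.
apply: (similarity_lim_of zl k0).
- exact: (middle_T degree4_oo xseq_gt0 xseq_D0 qseq_ge0 qD_lim tau_ge0' tau_lim1 tau'_lim estimates1 lax ll1 heta).
- exact: (middle_T degree4_oo xseq_gt0 xseq_D0 qseq_ge0 qD_lim tau_ge0' tau_lim1 tau'_lim estimates2 lax ll1 heta).
- exact: (middle_T12 degree4_oo xseq_gt0 xseq_B1 xseq_D0 qseq_ge0 qD_lim tau_ge0' tau_lim1 tau'_lim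
       estimates1 estimates2 estimates12 kin hk hkr lax ll1 heta (keep_xi hxi)).
Qed.

End Selection.

Lemma not_good_small : \forall n \near \oo,
  Pr (q n) (rho n) (fun w : outcome n => ~~ good (q n) (rho n) (B n) (m n) w) <= 22 / B n.
Proof.
apply: filterS base_near => n [n0 m0 qi qn B2]; apply: Pr_not_good => //.
by have /andP[r0 r1] := rho_in n; rewrite !ltW.
Qed.

(* It is enough to treat, for each n, the worst outcome of the good event. *)
Lemma cvg_in_probability_of_good (X : forall n, outcome n -> R) (l : R) :
  (forall w : (forall n, outcome n),
    (\forall n \near \oo, good (q n) (rho n) (B n) (m n) (w n)) ->
    (fun n => X n (w n)) @ \oo --> l) ->
  cvg_in_probability q rho X l.
Proof.
move=> det eps eps0; have B22 := lim_mul (lim_cst 22) Bi_lim; rewrite mulr0 in B22.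
pose gd n (w : outcome n) := good (q n) (rho n) (B n) (m n) w.
pose bad n (w : outcome n) := gd n w && (eps < `|X n w - l|).
(* A good outcome violating the conclusion is chosen whenever there is one, so the limit along this
   single sequence bounds all good outcomes. The last branch only makes [w] total. *)
pose w n : outcome n := if [pick v | bad n v] is Some v then v
  else if [pick v | gd n v] is Some v then v else [ffun=> blank].
have wg : \forall n \near \oo, gd n (w n).
  apply: filterS3 not_good_small (lim_near_le B22 (_ : 0 < 2^-1)) near_pos; last by rewrite invr_gt0 ltr0n.
  move=> n h1 h2 _; rewrite /w; case: pickP => [v /andP[]//|_]; case: pickP => [//|none].
  (* Without any good outcome the complement would have probability 1, yet it is at most
     [22 / B <= 1 / 2]. *)
  exfalso; move: h1; rewrite (_ : Pr _ _ _ = 1); first by move=> /le_trans /(_ h2); lra.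
  rewrite -(Pr_total n (q n) (rho n)); apply: eq_bigl => v; by rewrite [good _ _ _ _ _]none.
have /cvgrPdist_le /(_ eps eps0) close := det w wg.
apply: (lim_le0 _ B22); apply: filterS3 close not_good_small base_near.
move=> n hc hn [n0 m0 qi qn B2].
have ri : 0 <= rho n <= 1 by have /andP[r0 r1] := rho_in n; rewrite !ltW.
have q1 : 0 <= q n <= 1 by have /andP[-> h] := qi; lra.
have mu0 := pair_law_ge0 q1 ri.
have allgood v : gd n v -> `|X n v - l| <= eps.
  move=> gv; rewrite leNgt; apply/negP => bv; move: hc; rewrite /w.
  case: pickP => [v' /andP[_ b']|/(_ v)]; last by rewrite /bad gv bv.
  by rewrite distrC leNgt b'.
rewrite !Pr_PrE in hn *; rewrite ger0_norm; last by apply: Ex_ge0.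
apply: le_trans hn; apply: PrE_le => // v bv; apply/negP => gv.
by move: bv; rewrite ltNge allgood.
Qed.

End Scales.

Local Open Scope classical_set_scope.
Local Open Scope ring_scope.

Theorem theorem4p5 (R : realType) (alpha rho : nat -> R)
    (lambda gamma xi rholim : R) (eta : \bar R)
    (alpha_gt0 : forall n, 0 < alpha n)
    (alpha_liminf : (0 < limn_einf (fun n => (alpha n)%:E))%E)
    (alpha_limsup : (limn_esup (fun n => (alpha n)%:E) < +oo)%E)
    (rho_in : forall n, 0 < rho n < 1)
    (lambda_in : 0 <= lambda <= 1)
    (gamma_in : 0 <= gamma <= 1)
    (eta_in : (0 <= eta)%E)
    (xi_in : 0 <= xi <= 1)
    (rholim_in : 0 <= rholim <= 1)
    (lambda_cvg : lambda_ alpha n @[n --> \oo] --> lambda)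
    (gamma_cvg : gamma_ alpha rho n @[n --> \oo] --> gamma)
    (eta_cvg :
      (ln (lambda_ alpha n)^-1 / (alpha n * lambda_ alpha n * ln n%:R))%:E
        @[n --> \oo] --> eta)
    (xi_cvg :
      lambda_ alpha n `^ (1 - gamma_ alpha rho n) @[n --> \oo] --> xi)
    (rho_cvg : rho n @[n --> \oo] --> rholim) :
  cvg_in_probability (q_ alpha) rho
    (fun n w => similarity R (G1 w) (G2 w))
    (if (lambda == 1) || (eta == +oo%E) then gamma
     else rholim * (((1 - (2 - xi) * lambda) * xi + fine eta * gamma)
                    / (1 - lambda + fine eta))).
Proof.
apply: cvg_in_probability_of_good => // w wg.
by apply: similarity_lim => //.
Qed.
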